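(* Let $A$ be a Hopf $\ast$-algebra, let $H$ be a compact quantum group algebra, and let $B=A^{\mathrm{co}(H)}$ be a quantum homogeneous space. Let $(\Omega^\bullet,\wedge,d)$ be an $A$-covariant $\ast$-differential calculus on $B$ such that $\Omega^1$ is an object of the category ${}^{A}_{B}\mathrm{mod}_0$. Then the space of left $A$-covariant metrics on $\Omega^1$ admits a free and transitive action of the group $\mathrm{Aut}(\Phi(\Omega^1))$ of automorphisms of $\Phi(\Omega^1)$ in the category of finite dimensional left $H$-comodules. In particular, if $\Phi(\Omega^1)\simeq\bigoplus_{i=1}^m V_i^{\oplus n_i}$ is the decomposition of $\Phi(\Omega^1)$ into irreducible $H$-comodules, with $V_i$ and $V_j$ not isomorphic for $i\neq j$, then $$\mathrm{Aut}(\Phi(\Omega^1))\cong\prod_{i=1}^m \mathrm{GL}_{n_i}(\mathbb{C}),$$ and in this case the set of all left $A$-covariant metrics on $\Omega^1$ is parametrized by the group $\prod_{i=1}^m \mathrm{GL}_{n_i}(\mathbb{C})$.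
   Context: All algebras are unital over $\mathbb{C}$; unadorned $\otimes$ is over $\mathbb{C}$; antipodes are bijective; Sweedler notation is $\Delta(a)=a_{(1)}\otimes a_{(2)}$ and $m\mapsto m_{(-1)}\otimes m_{(0)}$ for left coactions. Quantum homogeneous space: $A,H$ are Hopf $\ast$-algebras, $\pi:A\to H$ is a surjective Hopf $\ast$-algebra map, $B=A^{\mathrm{co}(H)}=\{a\in A: a_{(1)}\otimes\pi(a_{(2)})=a\otimes 1\}$, and $A$ is faithfully flat as a right $B$-module. $B$ is a left $A$-comodule $\ast$-algebra via $\Delta$. $H$ is a compact quantum group algebra if it is the Hopf $\ast$-algebra spanned by the matrix coefficients of the irreducible unitary corepresentations of a compact quantum group. ${}^{A}_{B}\mathcal{M}_B$ is the category of $B$-bimodules $M$ with a left $A$-coaction satisfying $\delta(bmc)=b_{(1)}m_{(-1)}c_{(1)}\otimes b_{(2)}m_{(0)}c_{(2)}$; morphisms are $B$-bilinear, left $A$-colinear maps. Let $B^+=B\cap\ker\epsilon$. ${}^{A}_{B}\mathrm{mod}_0$ is the full subcategory of objects $M$ that are finitely generated as left $B$-modules and satisfy $MB^+=B^+M$; it is monoidal under $\otimes_B$. The functor $\Phi(M)=M/(B^+M)$, with left $H$-coaction $[m]\mapsto\pi(m_{(-1)})\otimes[m_{(0)}]$, is a monoidal equivalence from ${}^{A}_{B}\mathrm{mod}_0$ to the category of finite dimensional left $H$-comodules (Takeuchi). A differential calculus over $B$ is a differential graded algebra $(\Omega^\bullet=\bigoplus_{k\ge0}\Omega^k,\wedge,d)$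 with $\Omega^0=B$, generated as an algebra by $B$ and $dB$. It is a $\ast$-differential calculus if $\ast$ on $B$ extends to a conjugate-linear involution of $\Omega^\bullet$ preserving degrees with $(d\omega)^*=d(\omega^* )$ and $(\omega\wedge\nu)^*=(-1)^{kl}\nu^*\wedge\omega^*$ for $\omega\in\Omega^k,\nu\in\Omega^l$. It is $A$-covariant if the coaction of $B$ extends to a comodule algebra coaction ($\ast$-compatible in the $\ast$-case) on $\Omega^\bullet$ such that every $\Omega^k$ is an object of ${}^{A}_{B}\mathcal{M}_B$ and $d$ is $A$-colinear. A metric on $\Omega^1$ is a pair $(g,(\ ,\ ))$ with $g\in\Omega^1\otimes_B\Omega^1$ and $(\ ,\ ):\Omega^1\otimes_B\Omega^1\to B$ a $B$-bilinear map such that $((\omega,\ )\otimes_B\mathrm{id})g=\omega=(\mathrm{id}\otimes_B(\ ,\omega))g$ for all $\omega\in\Omega^1$. It is ($A$-)covariant if $(\ ,\ )$ and $B\to\Omega^1\otimes_B\Omega^1$, $b\mapsto bg$, are left $A$-colinear. The action in question: identifying $\mathrm{Aut}(\Phi(\Omega^1))$ with the automorphism group of $\Omega^1$ in ${}^{A}_{B}\mathrm{mod}_0$ via $\Phi$, an automorphism $\tau$ acts by $\tau\cdot(g,(\ ,\ ))=\big((\mathrm{id}\otimes_B\tau)g,\ (\ ,\ )\circ(\tau^{-1}\otimes_B\mathrm{id})\big)$. *)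

(* Defs.v *)
From HB Require Import structures.
From mathcomp Require Import all_boot all_order all_algebra.
From mathcomp Require Import boolp classical_sets reals.
From mathcomp Require Import complex.

Set Implicit Arguments.
Unset Strict Implicit.
Unset Printing Implicit Defensive.
Import Order.TTheory GRing.Theory Num.Theory.
Local Open Scope ring_scope.
Local Open Scope quotient_scope.
Local Open Scope classical_set_scope.

Section Tensor.
Variables (K : fieldType) (M N : lmodType K).

Definition balanced (W : zmodType) (f : M -> N -> W) : Prop :=
  [/\ forall m m' n, f (m + m') n = f m n + f m' n,
      forall m n n', f m (n + n') = f m n + f m n'
    & forall c m n, f (c *: m) n = f m (c *: n)].

Definition fsum (W : zmodType) (f : M -> N -> W) (s : seq (M * N)) : W :=
  \sum_(p <- s) f p.1 p.2.

(* M ⊗ N is built as formal sums of pairs, two sums being identified when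
   every balanced biadditive map to an abelian group takes the same value. *)
Definition tens_rel : rel (seq (M * N)) := fun s t =>
  `[< forall (W : zmodType) (f : M -> N -> W), balanced f -> fsum f s = fsum f t >].

Lemma tens_rel_equiv : equiv_class_of tens_rel.
Proof.
split=> [s|s t|t s u].
- by apply/asboolP.
- by apply/asboolP/asboolP => h W f bf; rewrite h.
- by move=> /asboolP h1 /asboolP h2; apply/asboolP => W f bf; rewrite h1 ?h2.
Qed.
Canonical tens_equiv := EquivRelPack tens_rel_equiv.

Definition tensor : Type := {eq_quot tens_rel}.
HB.instance Definition _ := EqQuotient.on tensor.
HB.instance Definition _ := Choice.on tensor.

(* tlift f is the map induced on the tensor product; it is meaningful only for
   balanced f (see tlift_tens). In particular conjugate-linear maps can be
   tensored, since balanced maps take values in abelian groups. *)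
Definition tlift (W : zmodType) (f : M -> N -> W) (t : tensor) : W :=
  fsum f (repr t).

Lemma repr_pi_tens s : tens_rel (repr (\pi_tensor s)) s.
Proof.
have h : repr (\pi_tensor s) = s %[mod_eq tens_equiv] by exact: reprK.
by apply/eqmodP; exact: h.
Qed.

Lemma tlift_pi (W : zmodType) (f : M -> N -> W) s :
  balanced f -> tlift f (\pi_tensor s) = fsum f s.
Proof. by move=> bf; have /asboolP := repr_pi_tens s; apply. Qed.

Lemma pi_tensP s t :
  (forall (W : zmodType) (f : M -> N -> W), balanced f -> fsum f s = fsum f t) ->
  \pi_tensor s = \pi_tensor t.
Proof.
move=> h; have : tens_rel s t by apply/asboolP.
by move/eqmodP => e; exact: e.
Qed.

Lemma fsum_cat (W : zmodType) (f : M -> N -> W) s t :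
  fsum f (s ++ t) = fsum f s + fsum f t.
Proof. by rewrite /fsum big_cat. Qed.

Definition tzero : tensor := \pi_tensor [::].
Definition tadd (x y : tensor) : tensor := \pi_tensor (repr x ++ repr y).
Definition tscale (c : K) (x : tensor) : tensor :=
  \pi_tensor [seq (c *: p.1, p.2) | p <- repr x].
Definition topp (x : tensor) : tensor :=
  \pi_tensor [seq (- p.1, p.2) | p <- repr x].

Lemma tlift0 (W : zmodType) (f : M -> N -> W) : balanced f -> tlift f tzero = 0.
Proof. by move=> bf; rewrite tlift_pi // /fsum big_nil. Qed.
Lemma tliftD (W : zmodType) (f : M -> N -> W) x y :
  balanced f -> tlift f (tadd x y) = tlift f x + tlift f y.
Proof. by move=> bf; rewrite tlift_pi // fsum_cat. Qed.
Lemma balancedN (W : zmodType) (f : M -> N -> W) m n : balanced f -> f (- m) n = - f m n.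
Proof.
case=> fD _ _; apply/eqP; rewrite -addr_eq0 -fD addNr.
by apply/eqP/(addrI (f 0 n)); rewrite -fD !addr0.
Qed.
Lemma tliftN (W : zmodType) (f : M -> N -> W) x :
  balanced f -> tlift f (topp x) = - tlift f x.
Proof.
move=> bf; rewrite tlift_pi // /fsum big_map -sumrN; apply: eq_bigr => p _.
by rewrite balancedN.
Qed.
Lemma balancedZ (W : zmodType) (f : M -> N -> W) c :
  balanced f -> balanced (fun m n => f (c *: m) n).
Proof.
case=> f1 f2 f3; split=> [m m' n|m n n'|d m n].
- by rewrite scalerDr f1.
- by rewrite f2.
- by rewrite -f3 !scalerA mulrC.
Qed.
Lemma tliftZ (W : zmodType) (f : M -> N -> W) c x :
  balanced f -> tlift f (tscale c x) = tlift (fun m n => f (c *: m) n) x.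
Proof. by move=> bf; rewrite tlift_pi // /fsum big_map. Qed.

Lemma tens_ext x y :
  (forall (W : zmodType) (f : M -> N -> W), balanced f -> tlift f x = tlift f y) ->
  x = y.
Proof. by move=> h; rewrite -[x]reprK -[y]reprK; apply: pi_tensP => W f /h. Qed.

Lemma taddA : associative tadd.
Proof. by move=> x y z; apply: tens_ext => W f bf; rewrite !tliftD // addrA. Qed.
Lemma taddC : commutative tadd.
Proof. by move=> x y; apply: tens_ext => W f bf; rewrite !tliftD // addrC. Qed.
Lemma tadd0 : left_id tzero tadd.
Proof. by move=> x; apply: tens_ext => W f bf; rewrite tliftD // tlift0 // add0r. Qed.
Lemma taddN : left_inverse tzero topp tadd.
Proof. by move=> x; apply: tens_ext => W f bf; rewrite tliftD // tliftN // tlift0 // addNr. Qed.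
HB.instance Definition _ := GRing.isZmodule.Build tensor taddA taddC tadd0 taddN.

Lemma tscaleA a b v : tscale a (tscale b v) = tscale (a * b) v.
Proof.
apply: tens_ext => W f bf; rewrite tliftZ // tliftZ ?tliftZ //; last exact: balancedZ.
by congr tlift; apply/funext => m; apply/funext => n; rewrite scalerA.
Qed.
Lemma tscale1 : left_id 1 tscale.
Proof.
move=> v; apply: tens_ext => W f bf; rewrite tliftZ //.
by congr tlift; apply/funext => m; apply/funext => n; rewrite scale1r.
Qed.
Lemma tscaleDr : right_distributive tscale +%R.
Proof.
move=> c x y; apply: tens_ext => W f bf.
by rewrite !(tliftZ, tliftD) //; exact: balancedZ.
Qed.
Lemma tscaleDl v : {morph tscale^~ v : a b / a + b}.
Proof.
move=> a b; apply: tens_ext => W f bf; rewrite !(tliftZ, tliftD) // /tlift /fsum -big_split.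
by apply: eq_bigr => p _ /=; rewrite scalerDl; case: bf => ->.
Qed.
HB.instance Definition _ :=
  GRing.Zmodule_isLmodule.Build K tensor tscaleA tscale1 tscaleDr tscaleDl.

Definition tens (m : M) (n : N) : tensor := \pi_tensor [:: (m, n)].

Lemma tlift_tens (W : zmodType) (f : M -> N -> W) m n :
  balanced f -> tlift f (tens m n) = f m n.
Proof. by move=> bf; rewrite tlift_pi // /fsum big_seq1. Qed.

Lemma tens_balanced : balanced tens.
Proof.
split=> [m m' n|m n n'|c m n]; apply: tens_ext => W f bf; have [f1 f2 f3] := bf.
- by rewrite tliftD // !tlift_tens // f1.
- by rewrite tliftD // !tlift_tens // f2.
- by rewrite !tlift_tens // f3.
Qed.

Lemma tensDl m m' n : tens (m + m') n = tens m n + tens m' n.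
Proof. by case: tens_balanced. Qed.
Lemma tensDr m n n' : tens m (n + n') = tens m n + tens m n'.
Proof. by case: tens_balanced. Qed.
Lemma tensZl c m n : tens (c *: m) n = c *: tens m n.
Proof. by apply: tens_ext => W f bf; rewrite tliftZ // !tlift_tens //; exact: balancedZ. Qed.
Lemma tensZr c m n : tens m (c *: n) = c *: tens m n.
Proof. by case: tens_balanced => _ _ <-; rewrite tensZl. Qed.

Lemma tlift_add (W : zmodType) (f : M -> N -> W) : balanced f -> {morph tlift f : x y / x + y}.
Proof. by move=> bf x y; rewrite tliftD. Qed.
Lemma tlift_zero (W : zmodType) (f : M -> N -> W) : balanced f -> tlift f 0 = 0.
Proof. exact: tlift0. Qed.

Lemma tens_span (x : tensor) : x = \sum_(p <- repr x) tens p.1 p.2.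
Proof.
apply: tens_ext => W f bf.
rewrite (big_morph _ (tlift_add bf) (tlift_zero bf)).
by apply: eq_bigr => p _; rewrite tlift_tens.
Qed.

Lemma tensor_ind (P : tensor -> Prop) :
  P 0 -> (forall x y, P x -> P y -> P (x + y)) -> (forall m n, P (tens m n)) ->
  forall x, P x.
Proof.
by move=> P0 PD Pt x; rewrite (tens_span x); elim/big_ind: _.
Qed.

Definition bilin (W : lmodType K) (f : M -> N -> W) : Prop :=
  (forall n, linear (fun m => f m n)) /\ (forall m, linear (f m)).

Lemma bilin_balanced (W : lmodType K) (f : M -> N -> W) : bilin f -> balanced f.
Proof.
move=> [fl fr].
have Dl m m' n : f (m + m') n = f m n + f m' n.
  by have := fl n 1 m m'; rewrite !scale1r.
have Dr m n n' : f m (n + n') = f m n + f m n'.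
  by have := fr m 1 n n'; rewrite !scale1r.
have f0l n : f 0 n = 0 by apply: (addrI (f 0 n)); rewrite -Dl !addr0.
have f0r m : f m 0 = 0 by apply: (addrI (f m 0)); rewrite -Dr !addr0.
split=> // c m n.
have := fl n c m 0; have := fr m c n 0.
by rewrite !addr0 f0l f0r !addr0 => -> ->.
Qed.

Lemma bilinDl (W : lmodType K) (f : M -> N -> W) m m' n : bilin f -> f (m + m') n = f m n + f m' n.
Proof. by case/bilin_balanced. Qed.
Lemma bilinDr (W : lmodType K) (f : M -> N -> W) m n n' : bilin f -> f m (n + n') = f m n + f m n'.
Proof. by case/bilin_balanced. Qed.
Lemma bilin0l (W : lmodType K) (f : M -> N -> W) n : bilin f -> f 0 n = 0.
Proof. by move=> bf; apply: (addrI (f 0 n)); rewrite -bilinDl // !addr0. Qed.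
Lemma bilin0r (W : lmodType K) (f : M -> N -> W) m : bilin f -> f m 0 = 0.
Proof. by move=> bf; apply: (addrI (f m 0)); rewrite -bilinDr // !addr0. Qed.
Lemma bilinZl (W : lmodType K) (f : M -> N -> W) c m n : bilin f -> f (c *: m) n = c *: f m n.
Proof. by move=> bf; have := bf.1 n c m 0; rewrite !addr0 bilin0l // addr0. Qed.
Lemma bilinZr (W : lmodType K) (f : M -> N -> W) c m n : bilin f -> f m (c *: n) = c *: f m n.
Proof. by move=> bf; have := bf.2 m c n 0; rewrite !addr0 bilin0r // addr0. Qed.

Lemma tens_bilin : bilin tens.
Proof.
by split=> [n c x y|m c x y]; rewrite ?tensDl ?tensDr ?tensZl ?tensZr.
Qed.

Lemma tlift_linear (W : lmodType K) (f : M -> N -> W) : bilin f -> linear (tlift f).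
Proof.
move=> bf c x y; have baf := bilin_balanced bf; rewrite tlift_add //; congr (_ + _).
elim/tensor_ind: x => [|x x' IH IH'|m n].
- by rewrite scaler0 tlift_zero // scaler0.
- by rewrite scalerDr !tlift_add // IH IH' scalerDr.
- by rewrite -tensZl !tlift_tens // bilinZl.
Qed.
End Tensor.

Arguments tens {K M N}.
Arguments tlift {K M N W}.

Section LinearPred.
Variables (K : fieldType) (V W : lmodType K) (f : V -> W).
Hypothesis lf : linear f.
Lemma linD : {morph f : x y / x + y}.
Proof. by move=> x y; have := lf 1 x y; rewrite !scale1r. Qed.
Lemma lin0 : f 0 = 0.
Proof. by apply: (addrI (f 0)); rewrite -linD !addr0. Qed.
Lemma linZ c x : f (c *: x) = c *: f x.
Proof. by have := lf c x 0; rewrite !addr0 lin0 addr0. Qed.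
Lemma linN x : f (- x) = - f x.
Proof. by rewrite -scaleN1r linZ scaleN1r. Qed.
Lemma linB x y : f (x - y) = f x - f y.
Proof. by rewrite linD linN. Qed.
End LinearPred.

Lemma tens_linear_ext (K : fieldType) (M N : lmodType K) (W : zmodType)
    (f g : tensor M N -> W) :
  {morph f : x y / x + y} -> {morph g : x y / x + y} ->
  (forall m n, f (tens m n) = g (tens m n)) -> f =1 g.
Proof.
move=> fD gD e; elim/tensor_ind => [|x y Hx Hy|//]; last by rewrite fD gD Hx Hy.
have f0 : f 0 = 0 by apply: (addrI (f 0)); rewrite -fD !addr0.
have g0 : g 0 = 0 by apply: (addrI (g 0)); rewrite -gD !addr0.
by rewrite f0 g0.
Qed.

Section TensorMaps.
Variable K : fieldType.
Implicit Types U V W : lmodType K.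

Definition tmap U V U' V' (f : U -> U') (g : V -> V') : tensor U V -> tensor U' V' :=
  tlift (fun u v => tens (f u) (g v)).

(* (u ⊗ v, u' ⊗ v') |-> f u u' ⊗ g v v' *)
Definition tmap2 U V U' V' U'' V'' (f : U -> U' -> U'') (g : V -> V' -> V'')
    (x : tensor U V) (y : tensor U' V') : tensor U'' V'' :=
  tlift (fun u v => tmap (f u) (g v) y) x.

Definition tassoc U V W : tensor (tensor U V) W -> tensor U (tensor V W) :=
  tlift (fun t w => tlift (fun u v => tens u (tens v w)) t).

Lemma tmap_bilin U V U' V' (f : U -> U') (g : V -> V') : linear f -> linear g ->
  bilin (fun u v => tens (f u) (g v)).
Proof.
move=> lf lg; split=> [n c x y|m c x y] /=.
  by rewrite lf tensDl tensZl.
by rewrite lg tensDr tensZr.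
Qed.

Lemma tmap_tens U V U' V' (f : U -> U') (g : V -> V') u v : linear f -> linear g ->
  tmap f g (tens u v) = tens (f u) (g v).
Proof. by move=> lf lg; rewrite /tmap tlift_tens //; exact/bilin_balanced/tmap_bilin. Qed.

Lemma tmap_linear U V U' V' (f : U -> U') (g : V -> V') : linear f -> linear g ->
  linear (tmap f g).
Proof. by move=> lf lg; apply: tlift_linear; exact: tmap_bilin. Qed.

Lemma tmap_id U V (x : tensor U V) : tmap id id x = x.
Proof. by apply/esym; rewrite {1}(tens_span x). Qed.

Lemma tmap_comp U V U' V' U'' V'' (f : U -> U') (g : V -> V') (f' : U' -> U'')
    (g' : V' -> V'') (x : tensor U V) :
  linear f -> linear g -> linear f' -> linear g' ->
  tmap f' g' (tmap f g x) = tmap (f' \o f) (g' \o g) x.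
Proof.
move=> lf lg lf' lg'.
have lff : linear (f' \o f) by move=> c a b; rewrite /= lf lf'.
have lgg : linear (g' \o g) by move=> c a b; rewrite /= lg lg'.
move: x; apply: tens_linear_ext.
- by move=> x y; rewrite !(linD (tmap_linear _ _)).
- by apply: linD; apply: tmap_linear.
- by move=> m n; rewrite !tmap_tens.
Qed.

Section TMap2.
Variables (U V U' V' U'' V'' : lmodType K) (f : U -> U' -> U'') (g : V -> V' -> V'').
Hypotheses (bf : bilin f) (bg : bilin g).
Lemma tmap2_bilin0 (y : tensor U' V') : bilin (fun u v => tmap (f u) (g v) y).
Proof.
split=> [v c u u'|u c v v'] /=.
  elim/tensor_ind: y => [|x x' IH IH'|m n].
  - by rewrite !(lin0 (tmap_linear (bf.2 _) (bg.2 _))) scaler0 addr0.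
  - by rewrite !(linD (tmap_linear (bf.2 _) (bg.2 _))) IH IH' scalerDr addrACA.
  - by rewrite !(tmap_tens _ _ (bf.2 _) (bg.2 _)) (bilinDl _ _ _ bf) (bilinZl _ _ _ bf) tensDl tensZl.
elim/tensor_ind: y => [|x x' IH IH'|m n].
- by rewrite !(lin0 (tmap_linear (bf.2 _) (bg.2 _))) scaler0 addr0.
- by rewrite !(linD (tmap_linear (bf.2 _) (bg.2 _))) IH IH' scalerDr addrACA.
- by rewrite !(tmap_tens _ _ (bf.2 _) (bg.2 _)) (bilinDl _ _ _ bg) (bilinZl _ _ _ bg) tensDr tensZr.
Qed.

Lemma tmap2_tens u v u' v' :
  tmap2 f g (tens u v) (tens u' v') = tens (f u u') (g v v').
Proof.
rewrite /tmap2 tlift_tens; last exact/bilin_balanced/tmap2_bilin0.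
by rewrite tmap_tens //; [exact: bf.2|exact: bg.2].
Qed.

Lemma tmap2_bilin : bilin (tmap2 f g).
Proof.
split=> [y|x]; first exact: tlift_linear (tmap2_bilin0 y).
move=> c y y'; rewrite /tmap2 /tlift /fsum scaler_sumr -big_split; apply: eq_bigr => p _ /=.
by rewrite (tmap_linear (bf.2 _) (bg.2 _)).
Qed.
End TMap2.

Lemma tassoc_bilin U V W :
  bilin (fun (t : tensor U V) (w : W) => tlift (fun u v => tens u (tens v w)) t).
Proof.
have b1 (w0 : W) : bilin (fun (u : U) (v : V) => tens u (tens v w0)).
  by split=> [n c x y|m c x y] /=; rewrite !(tensDl, tensDr, tensZl, tensZr).
split=> [w0|t]; first exact: tlift_linear.
move=> c x y; elim/tensor_ind: t => [|t t' IH IH'|m n].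
- by rewrite !(lin0 (tlift_linear (b1 _))) scaler0 addr0.
- by rewrite !(linD (tlift_linear (b1 _))) IH IH' scalerDr addrACA.
- by rewrite !(tlift_tens _ _ (bilin_balanced (b1 _))) !(tensDr, tensZr).
Qed.

Lemma tassoc_linear U V W : linear (@tassoc U V W).
Proof. exact/tlift_linear/tassoc_bilin. Qed.

Lemma tassoc_tens U V W (u : U) (v : V) (w : W) :
  tassoc (tens (tens u v) w) = tens u (tens v w).
Proof.
rewrite /tassoc tlift_tens; last exact/bilin_balanced/tassoc_bilin.
rewrite tlift_tens //; apply: bilin_balanced.
by split=> [n c x y|m c x y] /=; rewrite !(tensDl, tensDr, tensZl, tensZr).
Qed.

Lemma tassoc_nat U V W U' V' W' (f : U -> U') (g : V -> V') (h : W -> W') x :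
  linear f -> linear g -> linear h ->
  tassoc (tmap (tmap f g) h x) = tmap f (tmap g h) (tassoc x).
Proof.
move=> lf lg lh; have lfg := tmap_linear lf lg; have lgh := tmap_linear lg lh.
have l1 := tmap_linear lfg lh; have l2 := tmap_linear lf lgh.
have la := @tassoc_linear; move: x.
apply: tens_linear_ext => [x y|x y|t w].
- by rewrite (linD l1) (linD (la _ _ _)).
- by rewrite (linD (la _ _ _)) (linD l2).
rewrite tmap_tens //; move: t; apply: tens_linear_ext => [x y|x y|u v].
- by rewrite (linD lfg) tensDl (linD (la _ _ _)).
- by rewrite tensDl (linD (la _ _ _)) (linD l2).
- by rewrite tmap_tens // !tassoc_tens !tmap_tens.
Qed.
End TensorMaps.

Section LinearQuotient.
Variables (K : fieldType) (V : lmodType K).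

Definition lspan (G : set V) : set V := [set v | exists s : seq (K * V),
  (forall p, p \in s -> G p.2) /\ v = \sum_(p <- s) p.1 *: p.2].

Lemma lspan0 G : lspan G 0.
Proof. by exists [::]; split => //; rewrite big_nil. Qed.
Lemma lspanD G x y : lspan G x -> lspan G y -> lspan G (x + y).
Proof.
move=> [s [hs ->]] [t [ht ->]]; exists (s ++ t); split; last by rewrite big_cat.
by move=> p; rewrite mem_cat => /orP[/hs|/ht].
Qed.
Lemma lspanZ G c x : lspan G x -> lspan G (c *: x).
Proof.
move=> [s [hs ->]]; exists [seq (c * p.1, p.2) | p <- s]; split.
  by move=> p /mapP[q /hs qG ->].
by rewrite big_map scaler_sumr; apply: eq_bigr => p _; rewrite scalerA.
Qed.
Lemma lspanN G x : lspan G x -> lspan G (- x).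
Proof. by move=> h; rewrite -scaleN1r; exact: lspanZ. Qed.
Lemma lspan_gen (G : set V) x : G x -> lspan G x.
Proof.
move=> Gx; exists [:: (1, x)]; split; last by rewrite big_seq1 scale1r.
by move=> p; rewrite inE => /eqP ->.
Qed.

Variable G : set V.
Definition lquot_rel : rel V := fun u v => `[< lspan G (u - v) >].
Lemma lquot_rel_equiv : equiv_class_of lquot_rel.
Proof.
split=> [s|s t|t s u].
- by apply/asboolP; rewrite subrr; exact: lspan0.
- by apply/asboolP/asboolP => h; rewrite -opprB; exact: lspanN.
- move=> /asboolP h1 /asboolP h2; apply/asboolP.
  by rewrite -(subrK t s) -addrA; exact: lspanD.
Qed.
Canonical lquot_equiv := EquivRelPack lquot_rel_equiv.

Definition lquot : Type := {eq_quot lquot_rel}.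
HB.instance Definition _ := EqQuotient.on lquot.
HB.instance Definition _ := Choice.on lquot.

Definition lproj (v : V) : lquot := \pi_lquot v.

Lemma lprojP u v : lproj u = lproj v <-> lspan G (u - v).
Proof.
split=> [h|h].
  have e : u = v %[mod_eq lquot_equiv] by exact: h.
  by have /asboolP := introT (eqmodP lquot_equiv _ _) e.
have r : lquot_equiv u v by apply/asboolP.
exact: (elimT (eqmodP lquot_equiv _ _) r).
Qed.

Lemma repr_lproj v : lspan G (repr (lproj v) - v).
Proof. by apply/lprojP; rewrite /lproj reprK. Qed.

Lemma lproj_repr x : lproj (repr x) = x.
Proof. exact: reprK. Qed.

Definition lqadd (x y : lquot) : lquot := lproj (repr x + repr y).
Definition lqopp (x : lquot) : lquot := lproj (- repr x).
Definition lqscale c (x : lquot) : lquot := lproj (c *: repr x).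

Lemma lqaddE u v : lqadd (lproj u) (lproj v) = lproj (u + v).
Proof. by apply/lprojP; rewrite opprD addrACA; apply: lspanD; exact: repr_lproj. Qed.
Lemma lqoppE u : lqopp (lproj u) = lproj (- u).
Proof. by apply/lprojP; rewrite -opprD; apply: lspanN; exact: repr_lproj. Qed.
Lemma lqscaleE c u : lqscale c (lproj u) = lproj (c *: u).
Proof. by apply/lprojP; rewrite -scalerBr; apply: lspanZ; exact: repr_lproj. Qed.

Lemma lquot_ind (P : lquot -> Prop) : (forall v, P (lproj v)) -> forall x, P x.
Proof. by move=> h x; rewrite -(lproj_repr x). Qed.

Lemma lqaddA : associative lqadd.
Proof. by do 3![elim/lquot_ind=> ?]; rewrite !lqaddE addrA. Qed.
Lemma lqaddC : commutative lqadd.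
Proof. by do 2![elim/lquot_ind=> ?]; rewrite !lqaddE addrC. Qed.
Lemma lqadd0 : left_id (lproj 0) lqadd.
Proof. by elim/lquot_ind=> ?; rewrite !lqaddE add0r. Qed.
Lemma lqaddN : left_inverse (lproj 0) lqopp lqadd.
Proof. by elim/lquot_ind=> ?; rewrite lqoppE lqaddE addNr. Qed.
HB.instance Definition _ := GRing.isZmodule.Build lquot lqaddA lqaddC lqadd0 lqaddN.
Lemma lprojD u v : lproj u + lproj v = lproj (u + v).
Proof. exact: lqaddE. Qed.
Lemma lqscaleA a b v : lqscale a (lqscale b v) = lqscale (a * b) v.
Proof. by elim/lquot_ind: v => ?; rewrite !lqscaleE scalerA. Qed.
Lemma lqscale1 : left_id 1 lqscale.
Proof. by elim/lquot_ind=> ?; rewrite lqscaleE scale1r. Qed.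
Lemma lqscaleDr : right_distributive lqscale +%R.
Proof. by move=> c; do 2![elim/lquot_ind=> ?]; rewrite !(lprojD, lqscaleE) scalerDr. Qed.
Lemma lqscaleDl v : {morph lqscale^~ v : a b / a + b}.
Proof. by move=> a b; elim/lquot_ind: v => ?; rewrite !(lprojD, lqscaleE) scalerDl. Qed.
HB.instance Definition _ :=
  GRing.Zmodule_isLmodule.Build K lquot lqscaleA lqscale1 lqscaleDr lqscaleDl.

Lemma lproj_linear : linear lproj.
Proof. by move=> c x y; apply/esym; rewrite -lqaddE -lqscaleE. Qed.

Lemma lproj_eq0 v : lproj v = 0 <-> lspan G v.
Proof. by rewrite -[X in lspan G X]subr0; exact: lprojP. Qed.

Definition qlift (T : Type) (f : V -> T) (x : lquot) : T := f (repr x).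

Lemma qlift_proj (W : lmodType K) (f : V -> W) v :
  linear f -> (forall g, G g -> f g = 0) -> qlift f (lproj v) = f v.
Proof.
move=> lf fG; rewrite /qlift; apply/eqP; rewrite -subr_eq0 -linB //; apply/eqP.
have [s [hs ->]] := repr_lproj v.
rewrite (big_morph f (linD lf) (lin0 lf)) big_seq big1 // => p /hs /fG h.
by rewrite linZ // h scaler0.
Qed.

Lemma qlift_linear (W : lmodType K) (f : V -> W) :
  linear f -> (forall g, G g -> f g = 0) -> linear (qlift f).
Proof.
move=> lf fG c; do 2![elim/lquot_ind=> ?].
by rewrite -lproj_linear !qlift_proj // lf.
Qed.
End LinearQuotient.

Arguments lproj {K V}.
Arguments qlift {K V G T}.
Section Complements.
Variable K : fieldType.

Definition linear_set (V : lmodType K) (S : set V) : Prop :=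
  forall c x y, S x -> S y -> S (c *: x + y).

Lemma linear_set0 (V : lmodType K) (S : set V) x : linear_set S -> S x -> S 0.
Proof. by move=> lS Sx; have := lS (-1) x x Sx Sx; rewrite scaleN1r addNr. Qed.

Lemma linear_setZ (V : lmodType K) (S : set V) c x : linear_set S -> S x -> S (c *: x).
Proof. by move=> lS Sx; rewrite -[_ *: _]addr0; apply: (lS) => //; exact: linear_set0 lS Sx. Qed.

Lemma linear_setB (V : lmodType K) (S : set V) x y : linear_set S -> S x -> S y -> S (x - y).
Proof. by move=> lS Sx Sy; rewrite addrC -scaleN1r; exact: lS. Qed.

Lemma complement (V : lmodType K) (L : set V) : linear_set L -> L 0 ->
  exists S : set V, [/\ linear_set S, S 0, forall x, L x -> S x -> x = 0
    & forall v, exists k s, [/\ L k, S s & v = k + s]].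
Proof.
move=> lL L0.
pose P (S : set V) := linear_set S /\ forall x, L x -> S x -> x = 0.
have [|S [[lS LS] Smax]] := @Zorn_bigcup V P.
  move=> F FP Ftot; split.
    move=> c x y [X FX Xx] [Y FY Yy].
    have [XY|YX] := Ftot _ _ FX FY.
      by exists Y => //; apply: (FP _ FY).1 => //; exact: XY.
    by exists X => //; apply: (FP _ FX).1 => //; exact: YX.
  by move=> x Lx [X FX Xx]; exact: (FP _ FX).2.
have S0 : S 0.
  apply: contrapT => nS0; apply: (Smax [set 0]).
    split; last by move=> /(_ 0 erefl).
    by move=> x Sx; have := linear_set0 lS Sx.
  split=> [c x y -> ->|x _ -> //]; by rewrite /= scaler0 addr0.
exists S; split=> // v; apply: contrapT => nv.
apply: (Smax [set x | exists s c, S s /\ x = s + c *: v]).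
  split; first by move=> s Ss; exists s, 0; rewrite scale0r addr0.
  move=> /(_ v) Sv; apply: nv; exists 0, v; split=> //; last by rewrite add0r.
  by apply: Sv; exists 0, 1; rewrite scale1r add0r.
split=> [c x y [s [d [Ss ->]]] [s' [d' [Ss' ->]]]|x Lx [s [c [Ss xE]]]].
  exists (c *: s + s'), (c * d + d'); split; first exact: lS.
  by rewrite scalerDr scalerDl scalerA addrACA.
have [c0|c0] := eqVneq c 0.
  by apply: LS => //; rewrite xE c0 scale0r addr0.
exfalso; apply: nv; exists (c^-1 *: x), (- c^-1 *: s); split.
- exact: linear_setZ.
- exact: linear_setZ.
by rewrite xE scalerDr scalerA mulVf // scale1r scaleNr addrAC subrr add0r.
Qed.

Lemma generalized_inverse (V W : lmodType K) (f : V -> W) : linear f ->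
  exists g : W -> V, linear g /\ forall v, f (g (f v)) = f v.
Proof.
move=> lf.
have [||S [lS S0 kS kSE]] := @complement V [set v | f v = 0].
- by move=> c x y /= fx fy; rewrite lf fx fy scaler0 addr0.
- exact: lin0.
have [||T [lT T0 iT iTE]] := @complement W [set w | exists v, f v = w].
- by move=> c x y [v <-] [v' <-]; exists (c *: v + v'); rewrite lf.
- by exists 0; exact: lin0.
pose Q w s := S s /\ exists t, T t /\ w = f s + t.
have Qex w : exists s, Q w s.
  have [k [t [[v <-] Tt ->]]] := iTE w.
  have [k' [s [/= fk Ss vE]]] := kSE v.
  by exists s; split=> //; exists t; rewrite vE (linD lf) fk add0r.
have Quniq w s s' : Q w s -> Q w s' -> s = s'.
  move=> [Ss [t [Tt e]]] [Ss' [t' [Tt' e']]].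
  apply/eqP; rewrite -subr_eq0; apply/eqP/kS; last exact: linear_setB.
  have h : f (s - s') = t' - t.
    have fs : f s = w - t by rewrite e addrK.
    have fs' : f s' = w - t' by rewrite e' addrK.
    by rewrite (linB lf) fs fs' opprB addrC addrA subrK.
  by rewrite /= h; apply: iT; [exists (s - s')|exact: linear_setB].
have [g gQ] := choice Qex.
exists g; split.
  move=> c x y; apply: (Quniq (c *: x + y)); first exact: gQ.
  have [Sx [t [Tt xE]]] := gQ x; have [Sy [t' [Tt' yE]]] := gQ y.
  split; first exact: lS.
  exists (c *: t + t'); split; first exact: lT.
  by rewrite {1}xE {1}yE lf scalerDr addrACA.
move=> v; have [Ss [t [Tt e]]] := gQ (f v).
have t0 : t = 0.
  apply: iT => //; exists (v - g (f v)).
  by rewrite (linB lf) {1}e addrAC subrr add0r.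
by rewrite {2}e t0 addr0.
Qed.

Lemma tmap_id_inj (U V W : lmodType K) (f : V -> W) :
  linear f -> injective f -> injective (tmap (@id U) f).
Proof.
move=> lf fI; have [g [lg fgf]] := generalized_inverse lf.
have gf : g \o f = id by apply/funext => v; apply: fI; exact: fgf.
apply: (can_inj (g := tmap id g)) => x.
by rewrite tmap_comp // gf tmap_id.
Qed.

Lemma tmap_id_ker (U V W : lmodType K) (f : V -> W) : linear f ->
  exists e : V -> V, [/\ linear e, forall v, f (e v) = 0
    & forall t : tensor U V, tmap id f t = 0 -> tmap id e t = t].
Proof.
move=> lf; have [g [lg fgf]] := generalized_inverse lf.
have le : linear (fun v => v - g (f v)).
  by move=> c x y; rewrite lf lg scalerBr opprD addrACA.
exists (fun v => v - g (f v)); split=> [//|v|t ft].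
  by rewrite (linB lf) fgf subrr.
have h x : tmap id (fun v => v - g (f v)) x + tmap id g (tmap id f x) = x :> tensor U V.
  move: x; apply: tens_linear_ext => [x y|//|u v].
  - by rewrite !(linD (tmap_linear _ _)) // addrACA.
  - by rewrite !tmap_tens // -tensDr subrK.
by rewrite -[RHS]h ft (lin0 (tmap_linear _ _)) // addr0.
Qed.
End Complements.

Section StarAlgebras.
Variable R : realType.
Local Notation C := R[i].

Definition conj_linear (V W : lmodType C) (f : V -> W) : Prop :=
  forall c x y, f (c *: x + y) = c^* *: f x + f y.

Definition is_star (A : algType C) (s : A -> A) : Prop :=
  [/\ conj_linear s, involutive s & {morph s : a b / a * b >-> b * a}].

Definition is_alg_map (A B : algType C) (f : A -> B) : Prop :=
  [/\ linear f, {morph f : a b / a * b} & f 1 = 1].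

Definition tmul (A B : algType C) : tensor A B -> tensor A B -> tensor A B :=
  tmap2 *%R *%R.

Definition tstar (V W : lmodType C) (s : V -> V) (s' : W -> W) :
    tensor V W -> tensor V W :=
  tlift (fun v w => tens (s v) (s' w)).

(* The ground field is R[i], R being the real numbers. *)
Record hopfStarAlg := HopfStarAlg {
  hs_sort :> algType C;
  comul : hs_sort -> tensor hs_sort hs_sort;
  counit : hs_sort -> C;
  antipode : hs_sort -> hs_sort;
  star : hs_sort -> hs_sort;
  comul_linear : linear comul;
  comul1 : comul 1 = tens 1 1;
  comulM : {morph comul : a b / a * b >-> tmul a b};
  comul_coassoc : forall a, tassoc (tmap comul id (comul a)) = tmap id comul (comul a);
  counit_scalar : scalar counit;
  counit1 : counit 1 = 1;
  counitM : {morph counit : a b / a * b};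
  counitl : forall a, tlift (fun x y => counit x *: y) (comul a) = a;
  counitr : forall a, tlift (fun x y => counit y *: x) (comul a) = a;
  antipode_linear : linear antipode;
  antipode_bij : bijective antipode;
  antipodel : forall a, tlift (fun x y => antipode x * y) (comul a) = counit a *: 1;
  antipoder : forall a, tlift (fun x y => x * antipode y) (comul a) = counit a *: 1;
  star_is_star : is_star star;
  comul_star : forall a, comul (star a) = tstar star star (comul a)
}.

Arguments comul {h}.
Arguments counit {h}.
Arguments star {h}.

(* Surjective Hopf *-algebra maps; compatibility with antipodes is automatic. *)
Record hopfStarEpi (A H : hopfStarAlg) := HopfStarEpi {
  hs_map :> A -> H;
  hs_map_alg : is_alg_map hs_map;
  hs_map_star : forall a, hs_map (star a) = star (hs_map a);
  hs_map_comul : forall a, comul (hs_map a) = tmap hs_map hs_map (comul a);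
  hs_map_counit : forall a, counit (hs_map a) = counit a;
  hs_map_surj : forall h, exists a, hs_map a = h
}.

Lemma mul_bilin (A : algType C) : bilin ( *%R : A -> A -> A).
Proof.
split=> [b c x y|a c x y]; first by rewrite mulrDl scalerAl.
by rewrite mulrDr scalerAr.
Qed.

Lemma tmul_tens (A B : algType C) (a a' : A) (b b' : B) :
  tmul (tens a b) (tens a' b') = tens (a * a') (b * b').
Proof. by rewrite /tmul tmap2_tens //; exact: mul_bilin. Qed.

Lemma tmul_bilin (A B : algType C) : bilin (@tmul A B).
Proof. by apply: tmap2_bilin; exact: mul_bilin. Qed.

Lemma tmap_tmul (A B A' B' : algType C) (f : A -> A') (g : B -> B') :
  is_alg_map f -> is_alg_map g -> {morph tmap f g : x y / tmul x y}.
Proof.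
move=> [lf fM _] [lg gM _] x y; have tl := tmap_linear lf lg.
have mb := tmul_bilin A B; have mb' := tmul_bilin A' B'.
elim/tensor_ind: x => [|x x' IH IH'|a b].
- by rewrite (bilin0l _ mb) !(lin0 tl) (bilin0l _ mb').
- by rewrite (bilinDl _ _ _ mb) !(linD tl) (bilinDl _ _ _ mb') IH IH'.
elim/tensor_ind: y => [|y y' IH IH'|a' b'].
- by rewrite (bilin0r _ mb) !(lin0 tl) (bilin0r _ mb').
- by rewrite (bilinDr _ _ _ mb) !(linD tl) (bilinDr _ _ _ mb') IH IH'.
by rewrite tmul_tens !tmap_tens // tmul_tens fM gM.
Qed.

Lemma id_linear (V : lmodType C) : linear (@id V).
Proof. by []. Qed.
Lemma id_alg (A : algType C) : is_alg_map (@id A).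
Proof. by []. Qed.

Lemma conj_linear_balanced (V W V' W' : lmodType C) (s : V -> V') (s' : W -> W') :
  conj_linear s -> conj_linear s' -> balanced (fun v w => tens (s v) (s' w)).
Proof.
move=> cs cs'.
have sD x y : s (x + y) = s x + s y by have := cs 1 x y; rewrite rmorph1 !scale1r.
have s0 : s 0 = 0 by apply: (addrI (s 0)); rewrite -sD !addr0.
have s'D x y : s' (x + y) = s' x + s' y by have := cs' 1 x y; rewrite rmorph1 !scale1r.
have s'0 : s' 0 = 0 by apply: (addrI (s' 0)); rewrite -s'D !addr0.
split=> [m m' n|m n n'|c m n]; rewrite ?sD ?s'D ?tensDl ?tensDr //.
have := cs c m 0; have := cs' c n 0.
by rewrite !addr0 s0 s'0 !addr0 => -> ->; rewrite tensZl tensZr.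
Qed.

Section Coinvariants.
Variables (A H : hopfStarAlg) (p : hopfStarEpi A H).

Definition coinv_pred : {pred A} := fun a => tmap id p (comul a) == tens a 1.

Lemma coinv_subalg : GRing.subsemialg_closed coinv_pred.
Proof.
have pA := hs_map_alg p; have [lp pM p1] := pA.
have L : linear (fun a => tmap id p (comul a)).
  by move=> c x y /=; rewrite comul_linear (tmap_linear (@id_linear _) lp).
apply: GRing.subalg_closed_semi; split; rewrite ?unfold_in.
- by rewrite comul1 tmap_tens // p1.
- move=> c x y /eqP xP /eqP yP; rewrite unfold_in L xP yP.
  by rewrite tensDl tensZl.
- move=> x y /eqP xP /eqP yP.
  by rewrite unfold_in comulM tmap_tmul // xP yP tmul_tens mulr1.
Qed.

Record coinv := Coinv { coinv_val :> A; _ : coinv_val \in coinv_pred }.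
HB.instance Definition _ := [isSub for coinv_val].
HB.instance Definition _ := [Choice of coinv by <:].
HB.instance Definition _ :=
  GRing.SubChoice_isSubAlgebra.Build C A coinv_pred coinv coinv_subalg.

Lemma coinvP (b : coinv) : tmap id p (comul b) = tens (b : A) 1.
Proof. exact/eqP/(valP b). Qed.

Lemma coinv_star_subproof (b : coinv) : star (b : A) \in coinv_pred.
Proof.
have [lp _ p1] := hs_map_alg p.
have [cA _ _] := star_is_star A; have [cH _ _] := star_is_star H.
have bA := conj_linear_balanced cA cA; have bH := conj_linear_balanced cA cH.
rewrite unfold_in comul_star.
have -> : tmap id p (tstar star star (comul b)) = tstar star star (tmap id p (comul b)).
  apply: (tens_linear_ext (f := fun t => tmap id p (tstar star star t))
    (g := fun t => tstar star star (tmap id p t))) => [x y|x y|m n] /=.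
  - by rewrite /tstar tlift_add // (linD (tmap_linear (@id_linear _) lp)).
  - by rewrite (linD (tmap_linear (@id_linear _) lp)) /tstar tlift_add.
  - by rewrite /tstar !(tlift_tens, tmap_tens) // hs_map_star.
rewrite coinvP /tstar tlift_tens //.
have s1 : star (1 : H) = 1.
  have [_ sK sM] := star_is_star H.
  by rewrite -[LHS]mulr1 -{2}(sK 1) -sM mulr1 sK.
by rewrite s1.
Qed.
Definition coinv_star (b : coinv) : coinv := Coinv (coinv_star_subproof b).

(* Δ restricts to a coaction B -> A ⊗ B; A ⊗ B embeds into A ⊗ A. *)
Lemma coinv_coact_ex (b : coinv) :
  exists t : tensor A coinv, tmap id coinv_val t = comul (b : A).
Proof.
have [lp _ p1] := hs_map_alg p; have il := @id_linear.
have lc := comul_linear (h := A); have lv : linear coinv_val by [].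
have lF : linear (tmap id p \o comul (h := A)).
  by move=> c x y /=; rewrite lc (tmap_linear (il _) lp).
have lG : linear (fun a : A => tens a (1 : H)).
  by move=> c x y; rewrite tensDl tensZl.
have lL : linear (fun a : A => tmap id p (comul a) - tens a 1).
  move=> c x y; rewrite [tmap id p _](lF c x y) lG scalerBr opprD addrACA //.
have [e [le eL kL]] := @tmap_id_ker _ A _ _ _ lL.
have eB a : e a \in coinv_pred.
  by rewrite unfold_in -subr_eq0; apply/eqP; exact: eL.
have leB : linear (fun a => Coinv (eB a)) by move=> c x y; apply: val_inj; exact: le.
exists (tmap id (fun a => Coinv (eB a)) (comul (b : A))).
rewrite tmap_comp //; apply: kL.
transitivity (tmap id (tmap id p \o comul (h := A)) (comul (b : A))
  - tmap id (fun a : A => tens a (1 : H)) (comul (b : A))).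
  move: (comul (b : A)); apply: tens_linear_ext => [x y|x y|a a'].
  - by rewrite (linD (tmap_linear (il _) lL)).
  - by rewrite !(linD (tmap_linear _ _)) // opprD addrACA.
  - by rewrite !tmap_tens // tensDr -scaleN1r tensZr scaleN1r.
rewrite -(tmap_comp _ (il _) lc (il _) (tmap_linear (il _) lp)) -comul_coassoc.
rewrite -(tassoc_nat _ (il _) (il _) lp) tmap_comp //; last exact: tmap_linear.
have -> : tmap id id \o comul (h := A) = comul (h := A) \o id.
  by apply/funext => a /=; rewrite tmap_id.
rewrite -[p \o id]/(id \o p) -(tmap_comp _ (il _) lp lc (il _)) coinvP tmap_tens //.
apply/eqP; rewrite subr_eq0; apply/eqP.
move: (comul (b : A)); apply: tens_linear_ext => [x y|x y|a a'].
- by rewrite tensDl (linD (@tassoc_linear _ _ _ _)).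
- by rewrite (linD (tmap_linear _ _)).
- by rewrite tassoc_tens tmap_tens.
Qed.

Definition coinv_coact (b : coinv) : tensor A coinv := sval (cid (coinv_coact_ex b)).

Lemma coinv_coactE (b : coinv) : tmap id coinv_val (coinv_coact b) = comul (b : A).
Proof. exact: svalP (cid (coinv_coact_ex b)). Qed.

Lemma coinv_tmap_inj : injective (tmap (@id A) coinv_val).
Proof. by apply: tmap_id_inj => //; exact: val_inj. Qed.

Lemma coinv_coact_linear : linear coinv_coact.
Proof.
move=> c x y; apply: coinv_tmap_inj.
rewrite (tmap_linear (@id_linear _) (fun _ _ _ => erefl)) !coinv_coactE.
exact: comul_linear.
Qed.

Lemma coinv_coact1 : coinv_coact 1 = tens 1 1.
Proof.
apply: coinv_tmap_inj; rewrite coinv_coactE tmap_tens //.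
exact: comul1.
Qed.
End Coinvariants.

Definition is_coaction (A : hopfStarAlg) (V : lmodType C) (d : V -> tensor A V) : Prop :=
  [/\ linear d,
      forall v, tassoc (tmap comul id (d v)) = tmap id d (d v)
    & forall v, tlift (fun a w => counit a *: w) (d v) = v].

Record comod (A : hopfStarAlg) := Comod {
  co_sort :> lmodType C;
  coact : co_sort -> tensor A co_sort;
  coactP : is_coaction coact
}.

Definition is_comod_map (A : hopfStarAlg) (V W : comod A) (f : V -> W) : Prop :=
  linear f /\ forall v, coact (f v) = tmap id f (coact v).

Definition comod_iso (A : hopfStarAlg) (V W : comod A) : Prop :=
  exists f : V -> W, is_comod_map f /\ bijective f.

(* The last condition says that δ(W) lies in the image of A ⊗ W. *)
Definition is_subcomod (A : hopfStarAlg) (V : comod A) (W : set V) : Prop :=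
  [/\ W 0, forall c x y, W x -> W y -> W (c *: x + y)
    & forall w, W w ->
        lspan [set t | exists a w', W w' /\ t = tens a w'] (coact w)].

Definition irreducible (A : hopfStarAlg) (V : comod A) : Prop :=
  (exists v : V, v <> 0) /\
  forall W : set V, is_subcomod W -> (forall w, W w -> w = 0) \/ (forall v, W v).

Section DirectSum.
Variables (A : hopfStarAlg) (I : finType) (V : I -> comod A).

Definition dsum := forall i, V i.
HB.instance Definition _ := gen_eqMixin dsum.
HB.instance Definition _ := gen_choiceMixin dsum.

Definition dsum_add (x y : dsum) : dsum := fun i => x i + y i.
Definition dsum_opp (x : dsum) : dsum := fun i => - x i.
Definition dsum_zero : dsum := fun i => 0.
Definition dsum_scale (c : C) (x : dsum) : dsum := fun i => c *: x i.
Lemma dsum_addA : associative dsum_add.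
Proof. by move=> x y z; apply/functional_extensionality_dep => i; exact: addrA. Qed.
Lemma dsum_addC : commutative dsum_add.
Proof. by move=> x y; apply/functional_extensionality_dep => i; exact: addrC. Qed.
Lemma dsum_add0 : left_id dsum_zero dsum_add.
Proof. by move=> x; apply/functional_extensionality_dep => i; exact: add0r. Qed.
Lemma dsum_addN : left_inverse dsum_zero dsum_opp dsum_add.
Proof. by move=> x; apply/functional_extensionality_dep => i; exact: addNr. Qed.
HB.instance Definition _ :=
  GRing.isZmodule.Build dsum dsum_addA dsum_addC dsum_add0 dsum_addN.
Lemma dsum_scaleA a b v : dsum_scale a (dsum_scale b v) = dsum_scale (a * b) v.
Proof. by apply/functional_extensionality_dep => i; exact: scalerA. Qed.
Lemma dsum_scale1 : left_id 1 dsum_scale.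
Proof. by move=> x; apply/functional_extensionality_dep => i; exact: scale1r. Qed.
Lemma dsum_scaleDr : right_distributive dsum_scale +%R.
Proof. by move=> c x y; apply/functional_extensionality_dep => i; exact: scalerDr. Qed.
Lemma dsum_scaleDl v : {morph dsum_scale^~ v : a b / a + b}.
Proof. by move=> a b; apply/functional_extensionality_dep => i; exact: scalerDl. Qed.
HB.instance Definition _ := GRing.Zmodule_isLmodule.Build C dsum
  dsum_scaleA dsum_scale1 dsum_scaleDr dsum_scaleDl.

Definition dsum_inj (i : I) (w : V i) : dsum := dfwith (fun j => 0 : V j) w.
Definition dsum_coact (v : dsum) : tensor A dsum :=
  \sum_i tmap id (@dsum_inj i) (coact (v i)).

Lemma dsum_inj_linear i : linear (@dsum_inj i).
Proof.
move=> c x y; apply/functional_extensionality_dep => j.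
rewrite [RHS]/(c *: dsum_inj x j + dsum_inj y j) /dsum_inj.
have [->|ji] := eqVneq j i; first by rewrite !dfwith_in.
rewrite !dfwith_out 1?eq_sym //.
by transitivity (c *: (0 : V j) + 0); first by rewrite scaler0 addr0.
Qed.

Lemma dsum_coact_linear : linear dsum_coact.
Proof.
move=> c x y; rewrite /dsum_coact scaler_sumr -big_split; apply: eq_bigr => i _ /=.
have [dl _ _] := coactP (V i).
rewrite [(c *: x + y) i]/(c *: x i + y i) dl.
by rewrite (tmap_linear (@id_linear _) (@dsum_inj_linear i)).
Qed.

Lemma dsum_coact_inj i (w : V i) : dsum_coact (dsum_inj w) = tmap id (@dsum_inj i) (coact w).
Proof.
rewrite /dsum_coact (bigD1 i) //= /dsum_inj dfwith_in big1 ?addr0 // => j ji.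
have [dl _ _] := coactP (V j).
rewrite dfwith_out 1?eq_sym // (lin0 dl).
exact: lin0 (tmap_linear (@id_linear _) (@dsum_inj_linear j)).
Qed.

Lemma dsum_split (v : dsum) : v = \sum_i dsum_inj (v i).
Proof.
apply/functional_extensionality_dep => j.
have e (s : seq I) : (\sum_(i <- s) dsum_inj (v i)) j = \sum_(i <- s) dsum_inj (v i) j.
  by elim: s => [|i s IH]; rewrite ?big_nil // !big_cons -IH.
rewrite e (bigD1 j) //= {1}/dsum_inj dfwith_in big1 ?addr0 // => i ij.
by rewrite /dsum_inj dfwith_out.
Qed.

Lemma dsum_coactP : is_coaction dsum_coact.
Proof.
have il := @id_linear; have dl := dsum_coact_linear.
have jl := dsum_inj_linear; have cl := comul_linear (h := A).
have sc : bilin (fun (a : A) (w : dsum) => counit a *: w).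
  split=> [n c x y|m c x y] /=; last by rewrite scalerDr !scalerA mulrC.
  by rewrite counit_scalar scalerDl scalerA.
have sc' i : bilin (fun (a : A) (w : V i) => counit a *: w).
  split=> [n c x y|m c x y] /=; last by rewrite scalerDr !scalerA mulrC.
  by rewrite counit_scalar scalerDl scalerA.
split=> [//|v|v]; rewrite {1}[v]dsum_split.
- pose f x := tassoc (tmap comul id (dsum_coact x)).
  pose g x := tmap id dsum_coact (dsum_coact x).
  have fl : linear f.
    move=> c x y; rewrite /f dl (tmap_linear cl (il _)).
    exact: tassoc_linear.
  have gl : linear g by move=> c x y; rewrite /g dl (tmap_linear (il _) dl).
  rewrite -/(f _) -/(g _) [X in g X]dsum_split.
  rewrite (big_morph f (linD fl) (lin0 fl)) (big_morph g (linD gl) (lin0 gl)).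
  apply: eq_bigr => i _; rewrite /f /g dsum_coact_inj.
  have [vl va _] := coactP (V i).
  rewrite !tmap_comp //.
  have -> : dsum_coact \o @dsum_inj i = tmap id (@dsum_inj i) \o coact (c := V i).
    by apply/funext => w; exact: dsum_coact_inj.
  transitivity (tmap id (tmap id (@dsum_inj i)) (tassoc (tmap comul id (coact (v i))))).
    move: (coact (v i)); apply: tens_linear_ext => [x y|x y|a w] /=.
    + rewrite (linD (tmap_linear _ _)) // ?(linD (@tassoc_linear _ _ _ _)) //.
    + by rewrite !(linD (tmap_linear _ _)) // (linD (@tassoc_linear _ _ _ _))
        (linD (tmap_linear _ _)) //; exact: tmap_linear.
    + rewrite !tmap_tens //=.
      move: (comul a); apply: tens_linear_ext => [x y|x y|b c].
      * by rewrite tensDl (linD (@tassoc_linear _ _ _ _)).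
      * rewrite tensDl (linD (@tassoc_linear _ _ _ _)) (linD (tmap_linear _ _)) //.
        exact: tmap_linear.
      * rewrite !tassoc_tens tmap_tens //; last exact: tmap_linear.
        by rewrite tmap_tens.
  rewrite va tmap_comp //; exact: tmap_linear.
- pose f x := tlift (fun (a : A) (w : dsum) => counit a *: w) (dsum_coact x).
  have fl : linear f by move=> c x y; rewrite /f dl (tlift_linear sc).
  rewrite -/(f _) (big_morph f (linD fl) (lin0 fl)) [RHS]dsum_split.
  apply: eq_bigr => i _; rewrite /f dsum_coact_inj.
  have [_ _ vc] := coactP (V i); rewrite -{2}(vc (v i)).
  move: (coact (v i)); apply: tens_linear_ext => [x y|x y|a w].
  + by rewrite (linD (tmap_linear _ _)) // (linD (tlift_linear sc)).
  + by rewrite (linD (tlift_linear (sc' i))) (linD (jl i)).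
  + rewrite tmap_tens // !tlift_tens ?(linZ (jl i)) //; exact: bilin_balanced.
Qed.

Definition comod_sum : comod A := Comod dsum_coactP.
End DirectSum.

Definition isotypic_sum (A : hopfStarAlg) (m : nat) (V : 'I_m -> comod A)
    (n : 'I_m -> nat) : comod A :=
  comod_sum (fun p : {i : 'I_m & 'I_(n i)} => V (tag p)).

(* Groups of bijections satisfying a property stable under composition and
   inversion; the product is composition. *)
Record autPred (T : Type) := AutPred {
  aut_pred :> (T -> T) -> Prop;
  aut_pred_id : aut_pred id;
  aut_pred_comp : forall f g, aut_pred f -> aut_pred g -> aut_pred (f \o g);
  aut_pred_inv : forall f g, aut_pred f -> cancel f g -> cancel g f -> aut_pred g
}.

Section AutGroup.
Variables (T : Type) (P : autPred T).

Record aut := Aut {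
  autf :> T -> T;
  autinv : T -> T;
  autfP : P autf;
  autK : cancel autf autinv;
  autVK : cancel autinv autf
}.

Lemma autP (f g : aut) : autf f = autf g -> f = g.
Proof.
case: f g => [f f' Pf fK fVK] [g g' Pg gK gVK] /= e.
have e' : f' = g' by apply/funext => x; rewrite -{1}(gVK x) -e fK.
by move: Pf fK fVK; rewrite e e' => *; congr Aut; exact: Prop_irrelevance.
Qed.

HB.instance Definition _ := gen_eqMixin aut.
HB.instance Definition _ := gen_choiceMixin aut.

Definition aut_one : aut := Aut (aut_pred_id P) (fun=> erefl) (fun=> erefl).
Definition aut_inv (f : aut) : aut :=
  Aut (aut_pred_inv (autfP f) (@autK f) (@autVK f)) (@autVK f) (@autK f).
Definition aut_mul (f g : aut) : aut :=
  Aut (aut_pred_comp (autfP f) (autfP g)) (can_comp (@autK f) (@autK g))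
    (can_comp (@autVK g) (@autVK f)).
Lemma aut_mulA : associative aut_mul. Proof. by move=> f g h; exact: autP. Qed.
Lemma aut_mul1 : left_id aut_one aut_mul. Proof. by move=> f; exact: autP. Qed.
Lemma aut_mulr1 : right_id aut_one aut_mul. Proof. by move=> f; exact: autP. Qed.
Lemma aut_mulV : left_inverse aut_one aut_inv aut_mul.
Proof. by move=> f; apply/autP/funext => x; exact: autK. Qed.
Lemma aut_mulrV : right_inverse aut_one aut_inv aut_mul.
Proof. by move=> f; apply/autP/funext => x; exact: autVK. Qed.
HB.instance Definition _ :=
  isGroup.Build aut aut_mulA aut_mul1 aut_mulr1 aut_mulV aut_mulrV.
End AutGroup.

Lemma comp_linear (U V W : lmodType C) (f : V -> W) (g : U -> V) :
  linear f -> linear g -> linear (f \o g).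
Proof. by move=> lf lg c x y; rewrite /= lg lf. Qed.

Lemma inv_linear (U V : lmodType C) (f : U -> V) (g : V -> U) :
  linear f -> cancel f g -> cancel g f -> linear g.
Proof. by move=> lf fK gK c x y; apply: (can_inj fK); rewrite lf !gK. Qed.

Section ComodAut.
Variables (A : hopfStarAlg) (V : comod A).
Lemma comod_map_id : is_comod_map (@id V).
Proof. by split=> // v; rewrite tmap_id. Qed.
Lemma comod_map_comp (f g : V -> V) :
  is_comod_map f -> is_comod_map g -> is_comod_map (f \o g).
Proof.
move=> [lf cf] [lg cg]; split; first exact: comp_linear.
by move=> v; rewrite /= cf cg tmap_comp.
Qed.
Lemma comod_map_inv (f g : V -> V) :
  is_comod_map f -> cancel f g -> cancel g f -> is_comod_map g.
Proof.
move=> [lf cf] fK gK; have lg := inv_linear lf fK gK; split=> // v.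
rewrite -{2}(gK v) cf tmap_comp //.
have -> : g \o f = id by apply/funext.
by rewrite tmap_id.
Qed.
Definition comodAutPred := AutPred comod_map_id comod_map_comp comod_map_inv.
Definition comodAut := aut comodAutPred.
HB.instance Definition _ := Group.on comodAut.
End ComodAut.

Section BalancedTensor.
Variables (B : Type) (M N : lmodType C) (r : M -> B -> M) (l : B -> N -> N).

(* M ⊗_B N = (M ⊗ N) / span (m b ⊗ n - m ⊗ b n) *)
Definition btens : lmodType C := lquot [set t : tensor M N |
  exists m b n, t = tens (r m b) n - tens m (l b n)].
Definition bt (m : M) (n : N) : btens := lproj _ (tens m n).
Definition blift (W : zmodType) (f : M -> N -> W) : btens -> W := qlift (tlift f).
End BalancedTensor.

Definition bmap (B : Type) (M N M' N' : lmodType C) (r : M -> B -> M)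
    (l : B -> N -> N) (r' : M' -> B -> M') (l' : B -> N' -> N')
    (f : M -> M') (g : N -> N') : btens r l -> btens r' l' :=
  blift (fun m n => bt r' l' (f m) (g n)).

Arguments bmap {B M N M' N' r l r' l'} f g.

Definition is_lact (B : algType C) (M : lmodType C) (l : B -> M -> M) : Prop :=
  [/\ bilin l, forall m, l 1 m = m & forall b c m, l (b * c) m = l b (l c m)].

Definition is_ract (B : algType C) (M : lmodType C) (r : M -> B -> M) : Prop :=
  [/\ bilin r, forall m, r m 1 = m & forall m b c, r m (b * c) = r (r m b) c].

Record leftMod (B : algType C) := LeftMod {
  lm_sort :> lmodType C;
  lm_act : B -> lm_sort -> lm_sort;
  lm_actP : is_lact lm_act
}.

Definition is_leftmod_map (B : algType C) (M N : leftMod B) (f : M -> N) : Prop :=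
  linear f /\ forall b m, f (lm_act b m) = lm_act b (f m).

(* im f = ker g; faithful flatness of M means that M ⊗_B - preserves and
   reflects exactness. *)
Definition exact_at (U V W : lmodType C) (f : U -> V) (g : V -> W) : Prop :=
  forall v, g v = 0 <-> exists u, f u = v.

Definition faithfully_flat_right (B : algType C) (M : lmodType C)
    (r : M -> B -> M) : Prop :=
  forall (N1 N2 N3 : leftMod B) (f : N1 -> N2) (g : N2 -> N3),
    is_leftmod_map f -> is_leftmod_map g ->
    (exact_at f g <->
     exact_at (bmap id f : btens r (@lm_act _ N1) -> btens r (@lm_act _ N2))
              (bmap id g : btens r (@lm_act _ N2) -> btens r (@lm_act _ N3))).

Record qhs (A H : hopfStarAlg) := Qhs {
  qh_proj :> hopfStarEpi A H;
  qh_flat : faithfully_flat_right (fun (a : A) (b : coinv qh_proj) => a * (b : A))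
}.

Section CovariantBimodules.
Variables (A H : hopfStarAlg) (X : qhs A H).
Local Notation B := (coinv X).

Record covBimod := CovBimod {
  cb_sort :> lmodType C;
  lact : B -> cb_sort -> cb_sort;
  ract : cb_sort -> B -> cb_sort;
  cb_coact : cb_sort -> tensor A cb_sort;
  lactP : is_lact lact;
  ractP : is_ract ract;
  lract : forall b m c, ract (lact b m) c = lact b (ract m c);
  cb_coactP : is_coaction cb_coact;
  cb_coact_cov : forall b m c, cb_coact (ract (lact b m) c) =
    tmap2 *%R ract (tmap2 *%R lact (coinv_coact b) (cb_coact m)) (coinv_coact c)
}.

Lemma cb_coact_lact (M : covBimod) (b : B) (m : M) :
  cb_coact (lact b m) = tmap2 *%R (@lact M) (coinv_coact b) (cb_coact m).
Proof.
have [rb r1 _] := ractP M.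
rewrite -[in LHS](r1 (lact b m)) cb_coact_cov coinv_coact1.
move: (tmap2 *%R (@lact M) _ _); have bt2 := tmap2_bilin (mul_bilin A) rb.
apply: (tens_linear_ext (f := fun t => tmap2 *%R (@ract M) t (tens 1 1)) (g := id)).
- by move=> x y; rewrite (bilinDl _ _ _ bt2).
- by [].
move=> a n; by rewrite tmap2_tens ?mulr1 ?r1 //; exact: mul_bilin.
Qed.

Definition is_covbimod_map (M N : covBimod) (f : M -> N) : Prop :=
  [/\ linear f,
      forall b m, f (lact b m) = lact b (f m),
      forall m b, f (ract m b) = ract (f m) b
    & forall m, cb_coact (f m) = tmap id f (cb_coact m)].

Definition coinv_plus : set B := [set b | counit (b : A) = 0].

Definition finitely_generated (M : covBimod) : Prop :=
  exists (n : nat) (e : 'I_n -> M), forall m, exists b : 'I_n -> B,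
    m = \sum_i lact (b i) (e i).

Definition plus_left (M : covBimod) : set M :=
  [set x | exists b m, coinv_plus b /\ x = lact b m].
Definition plus_right (M : covBimod) : set M :=
  [set x | exists m b, coinv_plus b /\ x = ract m b].

Definition in_mod0 (M : covBimod) : Prop :=
  finitely_generated M /\ lspan (@plus_right M) = lspan (@plus_left M).

Section BimodAut.
Variable M : covBimod.
Lemma covbimod_map_id : is_covbimod_map (@id M).
Proof. by split=> // v; rewrite tmap_id. Qed.
Lemma covbimod_map_comp (f g : M -> M) :
  is_covbimod_map f -> is_covbimod_map g -> is_covbimod_map (f \o g).
Proof.
move=> [lf f1 f2 cf] [lg g1 g2 cg]; split; first exact: comp_linear.
- by move=> b m; rewrite /= g1 f1.
- by move=> b m; rewrite /= g2 f2.
- by move=> v; rewrite /= cf cg tmap_comp.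
Qed.
Lemma covbimod_map_inv (f g : M -> M) :
  is_covbimod_map f -> cancel f g -> cancel g f -> is_covbimod_map g.
Proof.
move=> [lf f1 f2 cf] fK gK; have lg := inv_linear lf fK gK; split=> //.
- by move=> b m; apply: (can_inj fK); rewrite f1 !gK.
- by move=> b m; apply: (can_inj fK); rewrite f2 !gK.
move=> v; rewrite -{2}(gK v) cf tmap_comp //.
have -> : g \o f = id by apply/funext.
by rewrite tmap_id.
Qed.
Definition bimodAutPred :=
  AutPred covbimod_map_id covbimod_map_comp covbimod_map_inv.
Definition bimodAut := aut bimodAutPred.
HB.instance Definition _ := Group.on bimodAut.
End BimodAut.

Section Takeuchi.
Variable M : covBimod.

(* Φ(M) = M / B⁺M with coaction [m] |-> π(m_(-1)) ⊗ [m_(0)] *)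
Definition fibre : lmodType C := lquot (@plus_left M).
Definition fibre_proj : M -> fibre := lproj _.
Definition fibre_coact : fibre -> tensor H fibre :=
  qlift (fun m => tmap X fibre_proj (cb_coact m)).

Lemma fibre_proj_linear : linear fibre_proj.
Proof. exact: lproj_linear. Qed.

Lemma proj_linear : linear X.
Proof. by case: (hs_map_alg X). Qed.

Lemma val_linear : linear (@coinv_val _ _ X).
Proof. by []. Qed.

Lemma fibre_proj_lact (b : B) (m : M) : fibre_proj (lact b m) = counit (b : A) *: fibre_proj m.
Proof.
have [lb l1 _] := lactP M.
apply/eqP; rewrite -subr_eq0 -(linZ fibre_proj_linear) -(linB fibre_proj_linear); apply/eqP.
apply/lproj_eq0/lspan_gen; exists (b - counit (b : A) *: 1), m; split.
  have : counit ((b : A) - counit (b : A) *: 1) = 0.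
    by rewrite -scaleNr addrC counit_scalar counit1 mulr1 addNr.
  by [].
have /= -> := linB (lb.1 m) b (counit (b : A) *: 1).
by rewrite (bilinZl _ _ _ lb) l1.
Qed.

Lemma coinv_proj (b : B) : X (b : A) = counit (b : A) *: 1.
Proof.
have [lp _ p1] := hs_map_alg X; have il := @id_linear.
have sb : bilin (fun (a : A) (h : H) => counit a *: h).
  split=> [n c x y|m c x y] /=; last by rewrite scalerDr !scalerA mulrC.
  by rewrite counit_scalar scalerDl scalerA.
have sA : bilin (fun (a : A) (h : A) => counit a *: h).
  split=> [n c x y|m c x y] /=; last by rewrite scalerDr !scalerA mulrC.
  by rewrite counit_scalar scalerDl scalerA.
have := congr1 (tlift (fun (a : A) (h : H) => counit a *: h)) (coinvP b).
rewrite tlift_tens; last exact: bilin_balanced.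
move=> <-; rewrite -{1}(counitl (b : A)); move: (comul (b : A)).
apply: tens_linear_ext => [x y|x y|a a'].
- by rewrite (linD (tlift_linear sA)) (linD lp).
- by rewrite (linD (tmap_linear (il _) lp)) (linD (tlift_linear sb)).
- by rewrite tmap_tens // !tlift_tens ?(linZ lp) //; exact: bilin_balanced.
Qed.

Lemma fibre_coact_kernel g : plus_left g -> tmap X fibre_proj (cb_coact g) = 0.
Proof.
move=> [b [m [b0 ->]]].
have [rb r1 _] := ractP M; have [lb l1 _] := lactP M.
have lp := proj_linear; have lf := fibre_proj_linear; have il := @id_linear.
have [_ pM p1] := hs_map_alg X.
have [dl _ _] := cb_coactP M.
pose e (s : tensor A B) : H := tlift (fun a (c : B) => counit (c : A) *: X a) s.
have eb : bilin (fun a (c : B) => counit (c : A) *: X a).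
  split=> [n c x y|n c x y] /=; first by rewrite lp scalerDr !scalerA mulrC.
  by rewrite [counit _](counit_scalar c (x : A) (y : A)) scalerDl scalerA.
have eA : bilin (fun a c : A => counit c *: a).
  split=> [n c x y|n c x y] /=; first by rewrite scalerDr !scalerA mulrC.
  by rewrite counit_scalar scalerDl scalerA.
have e_coact (c : B) : e (coinv_coact c) = X (c : A).
  rewrite -[in RHS](counitr (c : A)) -coinv_coactE; move: (coinv_coact c).
  apply: tens_linear_ext => [x y|x y|a c'].
  - by rewrite /e (linD (tlift_linear eb)).
  - by rewrite (linD (tmap_linear (il _) val_linear)) (linD (tlift_linear eA)) (linD lp).
  - rewrite tmap_tens // /e !tlift_tens; try exact: bilin_balanced.
    by rewrite (linZ lp).
have key s (t : tensor A M) : tmap X fibre_proj (tmap2 *%R (@lact M) s t) =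
    tmap ( *%R (e s)) id (tmap X fibre_proj t).
  have mA := mul_bilin A; have bt2 := tmap2_bilin mA lb.
  have lX := tmap_linear lp lf.
  have lm h : linear (tmap ( *%R (h : H)) (@id fibre)).
    by apply: tmap_linear => //; exact: (mul_bilin H).2.
  elim/tensor_ind: s => [|s s' IH IH'|a c].
  - rewrite (bilin0l _ bt2) (lin0 lX) /e (lin0 (tlift_linear eb)).
    move: (tmap X _ t); apply: tens_linear_ext => [x y|x y|h x].
    + by rewrite addr0.
    + by rewrite (linD (lm 0)).
    + rewrite tmap_tens //; last exact: (mul_bilin H).2.
      by rewrite mul0r (bilin0l _ (tens_bilin _ _)).
  - rewrite (bilinDl _ _ _ bt2) (linD lX) IH IH' /e (linD (tlift_linear eb)).
    move: (tmap X _ t); apply: tens_linear_ext => [x y|x y|h x].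
    + by rewrite !(linD (lm _)) addrACA.
    + by rewrite (linD (lm _)).
    + rewrite !tmap_tens //; try exact: (mul_bilin H).2.
      by rewrite mulrDl tensDl.
  elim/tensor_ind: t => [|t t' IH IH'|a' n].
  - by rewrite (bilin0r _ bt2) (lin0 lX) (lin0 (lm _)).
  - by rewrite (bilinDr _ _ _ bt2) (linD lX) IH IH' (linD lX) (linD (lm _)).
  - rewrite tmap2_tens // !tmap_tens //; last exact: (mul_bilin H).2.
    rewrite pM fibre_proj_lact /e tlift_tens; last exact: bilin_balanced.
    by rewrite -scalerAl tensZr tensZl.
rewrite cb_coact_lact key e_coact coinv_proj b0 scale0r.
move: (tmap X _ _); apply: tens_linear_ext => [x y|x y|h x].
- have l0 : linear (tmap ( *%R (0 : H)) (@id fibre)).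
    by apply: tmap_linear => //; exact: (mul_bilin H).2.
  by rewrite (linD l0).
- by rewrite addr0.
- rewrite tmap_tens //; last exact: (mul_bilin H).2.
  by rewrite mul0r (bilin0l _ (tens_bilin _ _)).
Qed.

Lemma fibre_coact_proj m : fibre_coact (fibre_proj m) = tmap X fibre_proj (cb_coact m).
Proof.
have [dl _ _] := cb_coactP M.
rewrite /fibre_coact qlift_proj //; last exact: fibre_coact_kernel.
apply: (comp_linear (f := tmap X fibre_proj) (g := @cb_coact M)) => //.
by apply: tmap_linear; [exact: proj_linear|exact: fibre_proj_linear].
Qed.

Lemma fibre_coactP : is_coaction fibre_coact.
Proof.
have [dl da dc] := cb_coactP M.
have lp := proj_linear; have lf := fibre_proj_linear; have il := @id_linear.
have lX := tmap_linear lp lf.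
have lc : linear fibre_coact.
  apply: qlift_linear; last exact: fibre_coact_kernel.
  exact: (comp_linear lX dl).
split=> [//|x|x]; elim/lquot_ind: x => m; rewrite -/(fibre_proj m) fibre_coact_proj.
- rewrite !tmap_comp //; last exact: comul_linear.
  have -> : fibre_coact \o fibre_proj = tmap X fibre_proj \o @cb_coact M.
    by apply/funext => v; exact: fibre_coact_proj.
  rewrite -[id \o X]/(X \o id) -(tmap_comp _ (il _) dl lp lX) -da.
  rewrite -(tassoc_nat _ lp lp lf) tmap_comp //; last 2 first.
  + exact: comul_linear.
  + exact: tmap_linear.
  congr (tassoc (tmap _ _ _)); apply/funext => a; exact: hs_map_comul.
- rewrite -[in RHS](dc m); move: (cb_coact m).
  have sA : bilin (fun (a : A) (n : M) => counit a *: n).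
    split=> [n c y z|n c y z] /=; last by rewrite scalerDr !scalerA mulrC.
    by rewrite counit_scalar scalerDl scalerA.
  have sH : bilin (fun (a : H) (n : fibre) => counit a *: n).
    split=> [n c y z|n c y z] /=; last by rewrite scalerDr !scalerA mulrC.
    by rewrite counit_scalar scalerDl scalerA.
  apply: tens_linear_ext => [y z|y z|a n].
  + by rewrite (linD lX) (linD (tlift_linear sH)).
  + by rewrite (linD (tlift_linear sA)) (linD lf).
  + rewrite tmap_tens // !tlift_tens; try exact: bilin_balanced.
    by rewrite hs_map_counit (linZ lf).
Qed.

Definition Phi : comod H := Comod fibre_coactP.
End Takeuchi.

Section PhiAut.
Variable M : covBimod.

(* Φ on morphisms *)
Definition Phi_fun (f : M -> M) : Phi M -> Phi M :=
  qlift (fun m => fibre_proj (f m)).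

Lemma Phi_fun_proj (f : M -> M) : is_covbimod_map f ->
  forall m, Phi_fun f (fibre_proj m) = fibre_proj (f m).
Proof.
move=> [lf fl _ _] m; rewrite /Phi_fun qlift_proj //.
  exact: (comp_linear (@fibre_proj_linear M) lf).
move=> g [b [n [b0 ->]]]; rewrite fl; apply/lproj_eq0/lspan_gen.
by exists b, (f n).
Qed.

Lemma Phi_fun_comod (f : M -> M) : is_covbimod_map f -> is_comod_map (Phi_fun f).
Proof.
move=> ff; have [lf fl _ fc] := ff; have fE := Phi_fun_proj ff.
have lp := proj_linear; have lq := @fibre_proj_linear M.
have lP : linear (Phi_fun f).
  move=> c; elim/lquot_ind=> m; elim/lquot_ind=> n.
  by rewrite -!/(fibre_proj _) -lq !fE lf lq.
split=> // x; elim/lquot_ind: x => m; rewrite -/(fibre_proj m) fE.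
rewrite /= !fibre_coact_proj fc !tmap_comp //.
congr (tmap _ _ _); apply/funext => n /=.
by rewrite fE.
Qed.

Lemma Phi_funK (f g : M -> M) : is_covbimod_map f -> is_covbimod_map g ->
  cancel f g -> cancel (Phi_fun f) (Phi_fun g).
Proof.
by move=> ff gg fK; elim/lquot_ind=> m; rewrite -/(fibre_proj m) !Phi_fun_proj // fK.
Qed.

Definition Phi_aut (t : bimodAut M) : comodAut (Phi M) :=
  @Aut _ (comodAutPred (Phi M)) _ _ (Phi_fun_comod (autfP t))
    (Phi_funK (autfP t) (autfP (aut_inv t)) (@autK _ _ t))
    (Phi_funK (autfP (aut_inv t)) (autfP t) (@autVK _ _ t)).
End PhiAut.

Section Metrics.
Variable M : covBimod.
Local Notation MM := (btens (@ract M) (@lact M)).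
Local Notation "m ⊗ n" := (bt (@ract M) (@lact M) m n) (at level 40).

Definition bt_lact (b : B) : MM -> MM := bmap (lact b) id.
Definition bt_ract (t : MM) (b : B) : MM := bmap id (fun n => ract n b) t.
Definition bt_coact : MM -> tensor A MM :=
  blift (fun m n => tmap2 *%R (bt (@ract M) (@lact M)) (cb_coact m) (cb_coact n)).

(* In met_left, blift is ((w, ) ⊗_B id) followed by B ⊗_B M = M; similarly for
   met_right. *)
Record covMetric := CovMetric {
  met_g : MM;
  met_pair : MM -> B;
  met_pair_linear : linear met_pair;
  met_pair_lact : forall b t, met_pair (bt_lact b t) = b * met_pair t;
  met_pair_ract : forall t b, met_pair (bt_ract t b) = met_pair t * b;
  met_left : forall w, blift (fun m n => lact (met_pair (w ⊗ m)) n) met_g = w;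
  met_right : forall w, blift (fun m n => ract m (met_pair (n ⊗ w))) met_g = w;
  met_pair_coact : forall t,
    coinv_coact (met_pair t) = tmap id met_pair (bt_coact t);
  met_g_coact : forall b, bt_coact (bt_lact b met_g) =
    tmap id (fun c => bt_lact c met_g) (coinv_coact b)
}.

(* v = t . u for the action of an automorphism t of M *)
Definition metric_translate (t : bimodAut M) (u v : covMetric) : Prop :=
  met_g v = bmap id t (met_g u) /\
  forall x, met_pair v x = met_pair u (bmap (t^-1)%g id x).
End Metrics.

(* tot is the whole algebra, the direct sum of the images of the Om k; om0
   identifies B with Om 0. *)
Record covStarCalculus := CovStarCalculus {
  Om : nat -> covBimod;
  tot : algType C;
  inc : forall k, Om k -> tot;
  inc_linear : forall k, linear (@inc k);
  inc_span : forall t, exists n (x : forall k, Om k), t = \sum_(k < n) inc (x k);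
  inc_free : forall n (x : forall k, Om k), \sum_(k < n) inc (x k) = 0 ->
    forall k, (k < n)%N -> x k = 0;
  inc_mul : forall k l (x : Om k) (y : Om l), exists z : Om (k + l),
    inc x * inc y = inc z;
  om0 : B -> Om 0;
  om0_linear : linear om0;
  om0_bij : bijective om0;
  om0_alg : is_alg_map (fun b => inc (om0 b));
  inc_lact : forall k b (x : Om k), inc (lact b x) = inc (om0 b) * inc x;
  inc_ract : forall k (x : Om k) b, inc (ract x b) = inc x * inc (om0 b);
  dif : tot -> tot;
  dif_linear : linear dif;
  dif_deg : forall k (x : Om k), exists y : Om k.+1, dif (inc x) = inc y;
  dif_dif : forall t, dif (dif t) = 0;
  dif_leibniz : forall k (x : Om k) t,
    dif (inc x * t) = dif (inc x) * t + (-1) ^+ k *: (inc x * dif t);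
  tot_generated : forall S : set tot,
    (forall b, S (inc (om0 b))) -> (forall b, S (dif (inc (om0 b)))) ->
    (forall c x y, S x -> S y -> S (c *: x + y)) ->
    (forall x y, S x -> S y -> S (x * y)) -> forall t, S t;
  tot_star : tot -> tot;
  tot_star_conj : conj_linear tot_star;
  tot_starK : involutive tot_star;
  tot_star_deg : forall k (x : Om k), exists y : Om k, tot_star (inc x) = inc y;
  tot_star_om0 : forall b, tot_star (inc (om0 b)) = inc (om0 (coinv_star b));
  tot_star_dif : forall t, tot_star (dif t) = dif (tot_star t);
  tot_star_mul : forall k l (x : Om k) (y : Om l),
    tot_star (inc x * inc y) = (-1) ^+ (k * l) *: (tot_star (inc y) * tot_star (inc x));
  tot_coact : tot -> tensor A tot;
  tot_coactP : is_coaction tot_coact;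
  tot_coact1 : tot_coact 1 = tens 1 1;
  tot_coactM : {morph tot_coact : x y / x * y >-> tmul x y};
  tot_coact_om0 : forall b, tot_coact (inc (om0 b)) =
    tmap id (fun c => inc (om0 c)) (coinv_coact b);
  tot_coact_inc : forall k (x : Om k), tot_coact (inc x) = tmap id (@inc k) (cb_coact x);
  tot_coact_dif : forall t, tot_coact (dif t) = tmap id dif (tot_coact t);
  tot_coact_star : forall t, tot_coact (tot_star t) = tstar star tot_star (tot_coact t)
}.
End CovariantBimodules.

Section CompactQuantumGroups.

Definition is_cstar_norm (V : lmodType C) (mul : V -> V -> V) (s : V -> V)
    (nrm : V -> R) : Prop :=
  [/\ forall x y, nrm (x + y) <= nrm x + nrm y,
      forall c x, (nrm (c *: x))%:C%C = `|c| * (nrm x)%:C%C,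
      forall x, nrm x = 0 -> x = 0,
      forall x y, nrm (mul x y) <= nrm x * nrm y
    & forall x, nrm (mul (s x) x) = nrm x ^+ 2].

Definition is_complete (V : lmodType C) (nrm : V -> R) : Prop :=
  forall u : nat -> V,
    (forall e, 0 < e -> exists N, forall m n, (N <= m)%N -> (N <= n)%N ->
      nrm (u m - u n) < e) ->
    exists l, forall e, 0 < e -> exists N, forall n, (N <= n)%N -> nrm (u n - l) < e.

Record cstarAlg := CstarAlg {
  cs_sort :> algType C;
  cs_star : cs_sort -> cs_sort;
  cs_norm : cs_sort -> R;
  cs_starP : is_star cs_star;
  cs_normP : is_cstar_norm *%R cs_star cs_norm;
  cs_complete : is_complete cs_norm
}.

Definition is_star_hom (G G' : cstarAlg) (f : G -> G') : Prop :=
  is_alg_map f /\ forall x, f (cs_star x) = cs_star (f x).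

(* k exhibits E as the completion of the algebraic tensor product for the least
   C*-norm. *)
Definition is_min_tensor (X Y E : cstarAlg) (k : tensor X Y -> E) : Prop :=
  [/\ linear k /\ injective k,
      k (tens 1 1) = 1 /\ {morph k : s t / tmul s t >-> s * t},
      forall t, k (tstar (@cs_star X) (@cs_star Y) t) = cs_star (k t),
      forall x e, 0 < e -> exists t, cs_norm (x - k t) < e
    & forall p : tensor X Y -> R,
        is_cstar_norm (@tmul X Y) (tstar (@cs_star X) (@cs_star Y)) p ->
        forall t, cs_norm (k t) <= p t].

Definition is_dense (G : cstarAlg) (S : set G) : Prop :=
  forall x e, 0 < e -> exists y, S y /\ cs_norm (x - y) < e.

(* cqg_alg2 and cqg_alg3 are the minimal C*-tensor square and cube; cqg_comull
   and cqg_comulr are Δ ⊗ id and id ⊗ Δ. *)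
Record compactQuantumGroup := CompactQuantumGroup {
  cqg_alg : cstarAlg;
  cqg_alg2 : cstarAlg;
  cqg_alg3 : cstarAlg;
  cqg_tens : tensor cqg_alg cqg_alg -> cqg_alg2;
  cqg_tensl : tensor cqg_alg2 cqg_alg -> cqg_alg3;
  cqg_tensr : tensor cqg_alg cqg_alg2 -> cqg_alg3;
  cqg_tensP : is_min_tensor cqg_tens;
  cqg_tenslP : is_min_tensor cqg_tensl;
  cqg_tensrP : is_min_tensor cqg_tensr;
  cqg_tensA : forall a b c,
    cqg_tensl (tens (cqg_tens (tens a b)) c) = cqg_tensr (tens a (cqg_tens (tens b c)));
  cqg_comul : cqg_alg -> cqg_alg2;
  cqg_comulP : is_star_hom cqg_comul;
  cqg_comull : cqg_alg2 -> cqg_alg3;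
  cqg_comullP : is_star_hom cqg_comull;
  cqg_comullE : forall a b,
    cqg_comull (cqg_tens (tens a b)) = cqg_tensl (tens (cqg_comul a) b);
  cqg_comulr : cqg_alg2 -> cqg_alg3;
  cqg_comulrP : is_star_hom cqg_comulr;
  cqg_comulrE : forall a b,
    cqg_comulr (cqg_tens (tens a b)) = cqg_tensr (tens a (cqg_comul b));
  cqg_coassoc : forall a, cqg_comull (cqg_comul a) = cqg_comulr (cqg_comul a);
  cqg_densel : is_dense (lspan [set x | exists a b,
    x = cqg_tens (tens a 1) * cqg_comul b]);
  cqg_denser : is_dense (lspan [set x | exists a b,
    x = cqg_tens (tens 1 a) * cqg_comul b])
}.

Definition is_unitary_corep (G : compactQuantumGroup) (n : nat)
    (u : 'M[cqg_alg G]_n) : Prop :=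
  let ustar := map_mx (@cs_star _) (u^T)%R in
  [/\ forall i j, cqg_comul (u i j) = \sum_k cqg_tens (tens (u i k) (u k j)),
      u *m ustar = 1%:M & ustar *m u = 1%:M].

(* u coacts on C^n by e_j |-> Σ_i e_i ⊗ u_ij; the range of an idempotent P is
   invariant exactly when u P = P u P. *)
Definition is_irreducible_corep (G : compactQuantumGroup) (n : nat)
    (u : 'M[cqg_alg G]_n) : Prop :=
  (0 < n)%N /\ forall P : 'M[C]_n, P *m P = P ->
    let PG := map_mx (fun c => c%:A : cqg_alg G) P in
    u *m PG = PG *m (u *m PG) -> P = 0 \/ P = 1%:M.

Definition corep_coefficient (G : compactQuantumGroup) : set (cqg_alg G) :=
  [set x | exists n (u : 'M[cqg_alg G]_n),
    [/\ is_unitary_corep u, is_irreducible_corep u & exists i j, x = u i j]].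

Definition is_cqg_algebra (H : hopfStarAlg) : Prop :=
  exists (G : compactQuantumGroup) (f : H -> cqg_alg G),
    [/\ is_alg_map f /\ injective f,
        forall h, f (star h) = cs_star (f h),
        forall h, cqg_comul (f h) = cqg_tens (tmap f f (comul h))
      & range f = lspan (@corep_coefficient G)].
End CompactQuantumGroups.

Section GLProduct.
Variables (m : nat) (n : 'I_m -> nat).

Record GL (k : nat) := MkGL { GLmx :> 'M[C]_k; _ : GLmx \in unitmx }.
HB.instance Definition _ k := [isSub for @GLmx k].

Definition GLprod := forall i, GL (n i).
HB.instance Definition _ := gen_eqMixin GLprod.
HB.instance Definition _ := gen_choiceMixin GLprod.

Lemma GLmulP k (x y : GL k) : (x : 'M_k) *m (y : 'M_k) \in unitmx.
Proof. by rewrite unitmx_mul (valP x) (valP y). Qed.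
Lemma GLinvP k (x : GL k) : invmx (x : 'M_k) \in unitmx.
Proof. by rewrite unitmx_inv (valP x). Qed.

Definition GLprod_one : GLprod := fun i => MkGL (unitmx1 C (n i)).
Definition GLprod_mul (x y : GLprod) : GLprod := fun i => MkGL (GLmulP (x i) (y i)).
Definition GLprod_inv (x : GLprod) : GLprod := fun i => MkGL (GLinvP (x i)).
Lemma GLprodP (x y : GLprod) : (forall i, GLmx (x i) = GLmx (y i)) -> x = y.
Proof. by move=> h; apply/functional_extensionality_dep => i; apply: val_inj; exact: h. Qed.
Lemma GLprod_mulA : associative GLprod_mul.
Proof. by move=> x y z; apply: GLprodP => i; exact: mulmxA. Qed.
Lemma GLprod_mul1 : left_id GLprod_one GLprod_mul.
Proof. by move=> x; apply: GLprodP => i; exact: mul1mx. Qed.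
Lemma GLprod_mulr1 : right_id GLprod_one GLprod_mul.
Proof. by move=> x; apply: GLprodP => i; exact: mulmx1. Qed.
Lemma GLprod_mulV : left_inverse GLprod_one GLprod_inv GLprod_mul.
Proof. by move=> x; apply: GLprodP => i; exact/mulVmx/(valP (x i)). Qed.
Lemma GLprod_mulrV : right_inverse GLprod_one GLprod_inv GLprod_mul.
Proof. by move=> x; apply: GLprodP => i; exact/mulmxV/(valP (x i)). Qed.
HB.instance Definition _ := isGroup.Build GLprod
  GLprod_mulA GLprod_mul1 GLprod_mulr1 GLprod_mulV GLprod_mulrV.
End GLProduct.

End StarAlgebras.

Definition is_action (G : groupType) (T : Type) (act : G -> T -> T) : Prop :=
  (forall x, act 1%g x = x) /\ (forall g h x, act (g * h)%g x = act g (act h x)).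
Definition is_free (G : groupType) (T : Type) (act : G -> T -> T) : Prop :=
  forall g x, act g x = x -> g = 1%g.
(* A transitive action has exactly one orbit, so T is nonempty. *)
Definition is_transitive (G : groupType) (T : Type) (act : G -> T -> T) : Prop :=
  inhabited T /\ forall x y, exists g, act g x = y.

Definition is_group_iso (G G' : groupType) (f : G -> G') : Prop :=
  bijective f /\ {morph f : x y / (x * y)%g}.

(* Main.v *)
Require Import Defs.
From HB Require Import structures.
From mathcomp Require Import all_boot all_order all_algebra.
From mathcomp Require Import boolp classical_sets reals.
From mathcomp Require Import complex.

(** Write [M] for the bimodule of one-forms, [V = Phi(M) = M / B^+ M], [pi : A -> H] for
the projection, [S] for the antipode, and [c] for the matrix of the [H]-coaction on [V] in
a basis.

Everything rests on the invariant integral [h] of [H], which exists because [H] is spanned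
by the coefficients of irreducible corepresentations ([left_integral_exists]). It gives
the conditional expectation [E(a) = a_1 h(pi(a_2))] of [A] onto [B], and with it an
explicit inverse of Takeuchi's functor. In coordinates, [m |-> m_(-1) (x) [m_(0)]] embeds
[M] in [A^r], where [r = dim V]; [E(a S(n_(-1))) n_(0)] inverts it ([theta_coord]), and its
image consists of all vectors that transform by [c] ([coord_surj]). A comodule
endomorphism of [V] is a matrix commuting with [c], so it acts on these vectors and lifts
uniquely to [M]. This is the group isomorphism [Phi_aut_iso].

A covariant metric exists because [V] is self-dual. On the one hand every finite
dimensional corepresentation carries a nondegenerate invariant hermitian form, being a
direct summand of a unitary one ([corep_hermitian_form]). On the other hand the star of
the calculus descends to [V] and identifies it with its conjugate. The two combine to an
invariant bilinear form [q] on [V] with an invariant inverse tensor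
([invariant_bilinear_form]). The form extends to [M] through the coordinates, with values
in [B]; the tensor lifts to a coinvariant element of [M (x)_B M] by averaging a lift with
[E] ([form_metric], [covMetric_exists]).

An automorphism [t] acts on metrics by transport of structure ([translate]). The form of a
metric is nondegenerate, so [t] is determined by its effect on one metric, and the dual
tensor is determined by the form. Given two metrics, the adjoint of one form with respect
to the other is an automorphism of [M] that carries the first to the second
([translate_transitive]). So the action is free and transitive, and it is transported to
[Aut(V)] along the isomorphism above.

Finally Schur's lemma, over the algebraically closed field [R[i]], identifies the
automorphisms of an isotypic sum with families of invertible matrices
([isotypic_aut]); composing with the orbit map of a metric gives the parametrisation. *)

Set Implicit Arguments.
Unset Strict Implicit.
Unset Printing Implicit Defensive.
Import Order.TTheory GRing.Theory Num.Theory.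
Local Open Scope ring_scope.
Local Open Scope quotient_scope.
Local Open Scope classical_set_scope.

Arguments comul {R h}.
Arguments counit {R h}.
Arguments antipode {R h}.
Arguments star {R h}.
Arguments bmap {R B M N M' N' r l r' l'} f g.

(** * Sweedler sums *)

(** A Sweedler sum is [tlift f t] with [t] a coproduct or a coaction. By definition it is
a finite sum over a representative of [t], so two such sums can be exchanged, and an
additive map enters them, for arbitrary [f]. Only an identity between tensors, such
as coassociativity, requires [f] to be multilinear. *)

Section Sums.
Variable K : fieldType.
Implicit Types U V W : lmodType K.

Lemma eq_tlift U V (W : zmodType) (f g : U -> V -> W) :
  (forall u v, f u v = g u v) -> tlift f =1 tlift g.
Proof. by move=> e t; apply: eq_bigr => p _; exact: e. Qed.

Lemma tlift_morph U V (W W' : zmodType) (phi : W -> W') (f : U -> V -> W) t :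
  {morph phi : x y / x + y} -> phi (tlift f t) = tlift (fun u v => phi (f u v)) t.
Proof.
move=> pD; have p0 : phi 0 = 0 by apply: (addrI (phi 0)); rewrite -pD !addr0.
exact: (big_morph phi pD p0).
Qed.

Lemma tlift_lin U V W W' (phi : W -> W') (f : U -> V -> W) t :
  linear phi -> phi (tlift f t) = tlift (fun u v => phi (f u v)) t.
Proof. by move=> lp; apply: tlift_morph; exact: linD lp. Qed.

Lemma tlift_exchange U V U' V' (W : zmodType) (f : U -> V -> U' -> V' -> W) t t' :
  tlift (fun u v => tlift (f u v) t') t
  = tlift (fun u' v' => tlift (fun u v => f u v u' v') t) t'.
Proof. exact: exchange_big. Qed.

Lemma tlift_sum U V (W : zmodType) (I : finType) (f : I -> U -> V -> W) t :
  tlift (fun u v => \sum_i f i u v) t = \sum_i tlift (f i) t.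
Proof. exact: exchange_big. Qed.

Lemma tlift_tensE U V (t : tensor U V) : tlift tens t = t.
Proof. by rewrite [RHS]tens_span. Qed.

Lemma lin_id U : linear (@id U). Proof. by []. Qed.

Lemma lin_comp U V W (g : V -> W) (f : U -> V) :
  linear g -> linear f -> linear (fun x => g (f x)).
Proof. by move=> lg lf c x y; rewrite lf lg. Qed.

Lemma lin_bilinl U V V' W (g : V -> V' -> W) (f : U -> V) c :
  bilin g -> linear f -> linear (fun x => g (f x) c).
Proof. by move=> [lg _] lf; apply: (lin_comp (lg c) lf). Qed.

Lemma lin_bilinr U V V' W (g : V -> V' -> W) (f : U -> V') c :
  bilin g -> linear f -> linear (fun x => g c (f x)).
Proof. by move=> [_ lg] lf; apply: (lin_comp (lg c) lf). Qed.

Lemma lin_scalel U W (f : U -> K) (w : W) : scalar f -> linear (fun x => f x *: w).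
Proof. by move=> lf c x y; rewrite lf scalerDl scalerA. Qed.

Lemma lin_scaler U W (f : U -> W) (c : K) : linear f -> linear (fun x => c *: f x).
Proof. by move=> lf d x y; rewrite lf scalerDr !scalerA mulrC. Qed.

Lemma sca_comp U V (f : U -> V) (g : V -> K) : scalar g -> linear f ->
  scalar (fun x => g (f x)).
Proof. by move=> lg lf c x y; rewrite lf lg. Qed.

Lemma sca_mull U (f : U -> K) k : scalar f -> scalar (fun x => f x * k).
Proof. by move=> lf c x y; rewrite lf mulrDl mulrA. Qed.

Lemma sca_mulr U (f : U -> K) k : scalar f -> scalar (fun x => k * f x).
Proof. by move=> lf c x y; rewrite lf mulrDr mulrCA. Qed.

Lemma lin_opp U W (f : U -> W) : linear f -> linear (fun x => - f x).
Proof. by move=> lf c x y; rewrite lf opprD scalerN. Qed.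

Lemma lin_add U W (f g : U -> W) : linear f -> linear g -> linear (fun x => f x + g x).
Proof. by move=> lf lg c x y; rewrite lf lg scalerDr addrACA. Qed.

Lemma lin_sum U W (I : finType) (f : I -> U -> W) :
  (forall i, linear (f i)) -> linear (fun x => \sum_i f i x).
Proof.
move=> lf c x y; rewrite scaler_sumr -big_split; apply: eq_bigr => i _; exact: lf.
Qed.

Lemma sca_sum U (I : finType) (f : I -> U -> K) :
  (forall i, scalar (f i)) -> scalar (fun x => \sum_i f i x).
Proof.
move=> lf c x y; rewrite mulr_sumr -big_split; apply: eq_bigr => i _; exact: lf.
Qed.

Lemma lin_tlift_arg U V W W' (f : V -> W -> W') (t : U -> tensor V W) :
  bilin f -> linear t -> linear (fun x => tlift f (t x)).
Proof. by move=> bf; apply: lin_comp; exact: tlift_linear. Qed.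

Lemma lin_tlift_fun U V W W' (f : U -> V -> W -> W') (t : tensor V W) :
  (forall v w, linear (fun x => f x v w)) -> linear (fun x => tlift (f x) t).
Proof.
move=> lf c x y; rewrite /tlift /fsum scaler_sumr -big_split.
by apply: eq_bigr => p _; exact: lf.
Qed.

Lemma lin_tmap U U' V V' W (f : U -> U') (g : V -> V') (t : W -> tensor U V) :
  linear f -> linear g -> linear t -> linear (fun x => tmap f g (t x)).
Proof. by move=> lf lg; apply: lin_comp; exact: tmap_linear. Qed.

End Sums.


Create HintDb lin.

(** Multilinearity of the summand of a Sweedler sum, by recursion on the expression: each
   variable must occur once in every term, inside maps whose linearity is a hypothesis or
   a hint. *)
Ltac lin_leaf := solve [assumption | auto 2 with lin nocore].
Ltac lin :=
  cbv beta;
  lazymatch goal with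
  | |- bilin _ => first [lin_leaf | split; lin]
  | |- balanced _ => apply: bilin_balanced; lin
  | |- @GRing.linear_for _ _ _ (@GRing.mul _) _ =>
    first [ lin_leaf
    | match goal with
      | |- @GRing.linear_for _ _ _ _ (fun x => @?f x * ?c) => apply: (@sca_mull _ _ f c); lin
      | |- @GRing.linear_for _ _ _ _ (fun x => ?c * @?f x) => apply: (@sca_mulr _ _ f c); lin
      | |- @GRing.linear_for _ _ _ _ (fun x => \sum_i @?f i x) =>
        apply: (@sca_sum _ _ _ f); lin
      | |- @GRing.linear_for _ _ _ _ (fun x => ?g (@?f x)) =>
        apply: (@sca_comp _ _ _ f g); [lin_leaf | lin]
      end ]
  | |- @GRing.linear_for _ _ _ _ _ =>
    first [ lin_leaf
    | match goal with
      | |- @GRing.linear_for _ _ _ _ (fun x => x) => exact: lin_id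
      | |- @GRing.linear_for _ _ _ _ (fun x => - @?f x) => apply: (@lin_opp _ _ _ f); lin
      | |- @GRing.linear_for _ _ _ _ (fun x => @?f x + @?g x) =>
        apply: (@lin_add _ _ _ f g); lin
      | |- @GRing.linear_for _ _ _ _ (fun x => \sum_i @?f i x) =>
        apply: (@lin_sum _ _ _ _ f); lin
      | |- @GRing.linear_for _ _ _ _ (fun x => ?c *: @?f x) => apply: (@lin_scaler _ _ _ f c); lin
      | |- @GRing.linear_for _ _ _ _ (fun x => @?f x *: ?w) => apply: (@lin_scalel _ _ _ f w); lin
      | |- @GRing.linear_for _ _ _ _ (fun x => tlift ?f (@?t x)) =>
        apply: (@lin_tlift_arg _ _ _ _ _ f t); lin
      | |- @GRing.linear_for _ _ _ _ (fun x => tlift (@?f x) ?t) =>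
        apply: (@lin_tlift_fun _ _ _ _ _ f t); lin
      | |- @GRing.linear_for _ _ _ _ (fun x => tmap ?f ?g (@?t x)) =>
        apply: (@lin_tmap _ _ _ _ _ _ f g t); lin
      | |- @GRing.linear_for _ _ _ _ (fun x => ?g (@?f x) ?c) =>
        apply: (@lin_bilinl _ _ _ _ _ g f c); [lin_leaf | lin]
      | |- @GRing.linear_for _ _ _ _ (fun x => ?g ?c (@?f x)) =>
        apply: (@lin_bilinr _ _ _ _ _ g f c); [lin_leaf | lin]
      | |- @GRing.linear_for _ _ _ _ (fun x => ?g (@?f x)) =>
        apply: (@lin_comp _ _ _ _ g f); [lin_leaf | lin]
      | |- @GRing.linear_for _ _ _ _ (fun x => ?g (@?f x) ?c) =>
        apply: (@lin_comp _ _ _ _ (fun y => g y c) f); [lin_leaf | lin]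
      | |- @GRing.linear_for _ _ _ _ (fun x => ?g (@?f x) ?c ?d) =>
        apply: (@lin_comp _ _ _ _ (fun y => g y c d) f); [lin_leaf | lin]
      | |- @GRing.linear_for _ _ _ _ (fun x => ?g (@?f x) ?c ?d ?e) =>
        apply: (@lin_comp _ _ _ _ (fun y => g y c d e) f); [lin_leaf | lin]
      | |- @GRing.linear_for _ _ _ _ (tlift ?f) => apply: (@tlift_linear _ _ _ _ f); lin
      | |- @GRing.linear_for _ _ _ _ (tmap ?f ?g) => apply: (@tmap_linear _ _ _ _ _ f g); lin
      | |- @GRing.linear_for _ _ _ _ (?g ?c) => refine (proj2 (_ : bilin g) c); lin_leaf
      end ]
  | |- forall _, _ => intro; lin
  end.

#[global] Hint Extern 0 (bilin (@tens _ _ _)) => exact: tens_bilin : lin.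
#[global] Hint Extern 0 (bilin (@GRing.mul _)) => exact: mul_bilin : lin.
#[global] Hint Extern 0 (bilin (@tmul _ _ _)) => exact: tmul_bilin : lin.
#[global] Hint Extern 0 (GRing.linear_for _ (@comul _ _)) => exact: comul_linear : lin.
#[global] Hint Extern 0 (GRing.linear_for _ (@antipode _ _)) => exact: antipode_linear : lin.
#[global] Hint Extern 0 (GRing.linear_for _ (@counit _ _)) => exact: counit_scalar : lin.
#[global] Hint Extern 0 (GRing.linear_for _ (@id _)) => exact: lin_id : lin.
#[global] Hint Extern 0 (GRing.linear_for _ (@tassoc _ _ _ _)) => exact: tassoc_linear : lin.

Lemma eq_linear_tens (K : fieldType) (U V W : lmodType K) (f g : tensor U V -> W) :
  linear f -> linear g -> (forall u v, f (tens u v) = g (tens u v)) -> f =1 g.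
Proof. by move=> lf lg; apply: tens_linear_ext; exact: linD. Qed.

Section MoreSums.
Variable K : fieldType.
Implicit Types U V W : lmodType K.

Lemma tlift_tmap U V U' V' W (f : U' -> V' -> W) (p : U -> U') (q : V -> V') t :
  bilin f -> linear p -> linear q ->
  tlift f (tmap p q t) = tlift (fun u v => f (p u) (q v)) t.
Proof.
move=> bf lp lq; have bf1 := bf.1; have bf2 := bf.2.
have bg : bilin (fun u v => f (p u) (q v)).
  by split=> [v|u]; [exact: lin_comp (bf1 _) lp|exact: lin_comp (bf2 _) lq].
move: t; apply: eq_linear_tens => [||u v]; [by lin|by lin|cbv beta].
by rewrite tmap_tens // !tlift_tens //; exact: bilin_balanced.
Qed.

Definition trilin U V W W' (f : U -> V -> W -> W') :=
  [/\ forall v w, linear (fun u => f u v w), forall u w, linear (fun v => f u v w)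
    & forall u v, linear (f u v)].

Lemma tlift_assoc U V W W' (f : U -> V -> W -> W') t : trilin f ->
  tlift (fun u s => tlift (f u) s) (tassoc t)
  = tlift (fun s w => tlift (fun u v => f u v w) s) t.
Proof.
move=> [f1 f2 f3]; move: t; apply: eq_linear_tens => [||s w]; [by lin|by lin|cbv beta].
rewrite [RHS]tlift_tens; last by lin.
move: s; apply: eq_linear_tens => [||u v]; [by lin|by lin|cbv beta].
by rewrite tassoc_tens !tlift_tens //; lin.
Qed.
End MoreSums.

Section HopfSums.
Variable R : realType.
Local Notation C := R[i].
Implicit Types (A : hopfStarAlg R) (V W : lmodType C).

Lemma comul_sum A W (f : A -> A -> A -> W) (a : A) : trilin f ->
  tlift (fun x y => tlift (fun u v => f u v y) (comul x)) (comul a)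
  = tlift (fun x y => tlift (f x) (comul y)) (comul a).
Proof.
move=> tf; have [f1 f2 f3] := tf.
transitivity (tlift (fun s w => tlift (fun u v => f u v w) s) (tmap comul id (comul a))).
  by rewrite tlift_tmap //; lin.
by rewrite -tlift_assoc // comul_coassoc tlift_tmap //; lin.
Qed.

Lemma coact_sum A V W (d : V -> tensor A V) (f : A -> A -> V -> W) v :
  is_coaction d -> trilin f ->
  tlift (fun a w => tlift (fun x y => f x y w) (comul a)) (d v)
  = tlift (fun a w => tlift (f a) (d w)) (d v).
Proof.
move=> [dl da _] tf; have [f1 f2 f3] := tf.
transitivity (tlift (fun s w => tlift (fun u v => f u v w) s) (tmap comul id (d v))).
  by rewrite tlift_tmap //; lin.
by rewrite -tlift_assoc // da tlift_tmap //; lin.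
Qed.

Lemma counit_suml A W (f : A -> W) (a : A) : linear f ->
  tlift (fun x y => counit x *: f y) (comul a) = f a.
Proof.
by move=> lf; rewrite -[in RHS](counitl a) (tlift_lin _ _ lf); apply: eq_tlift => x y; rewrite linZ.
Qed.

Lemma counit_sumr A W (f : A -> W) (a : A) : linear f ->
  tlift (fun x y => counit y *: f x) (comul a) = f a.
Proof.
by move=> lf; rewrite -[in RHS](counitr a) (tlift_lin _ _ lf); apply: eq_tlift => x y; rewrite linZ.
Qed.

Lemma coact_counit A V W (d : V -> tensor A V) (f : V -> W) v : is_coaction d -> linear f ->
  tlift (fun x w => counit x *: f w) (d v) = f v.
Proof.
move=> [_ _ dc] lf; rewrite -[in RHS](dc v) (tlift_lin _ _ lf).
by apply: eq_tlift => x y; rewrite linZ.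
Qed.

Lemma antipode_suml A W (f : A -> W) (a : A) : linear f ->
  tlift (fun x y => f (antipode x * y)) (comul a) = counit a *: f 1.
Proof. by move=> lf; rewrite -linZ // -antipodel (tlift_lin _ _ lf). Qed.

Lemma antipode_sumr A W (f : A -> W) (a : A) : linear f ->
  tlift (fun x y => f (x * antipode y)) (comul a) = counit a *: f 1.
Proof. by move=> lf; rewrite -linZ // -antipoder (tlift_lin _ _ lf). Qed.

Lemma comulM_sum A W (f : A -> A -> W) (a b : A) : bilin f ->
  tlift f (comul (a * b)) =
  tlift (fun a1 a2 => tlift (fun b1 b2 => f (a1 * b1) (a2 * b2)) (comul b)) (comul a).
Proof.
move=> bf; have [f1 f2] := bf; rewrite comulM.
move: (comul a) => s; move: (comul b) => t.
move: s; apply: eq_linear_tens => [||u v]; [by lin|by lin|cbv beta].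
rewrite [RHS]tlift_tens; last by lin.
move: t; apply: eq_linear_tens => [||u' v']; [by lin|by lin|cbv beta].
by rewrite tmul_tens !tlift_tens //; lin.
Qed.
End HopfSums.

(** * Antipodes, counits and functionals *)

Section HopfFacts.
Variable R : realType.
Local Notation C := R[i].
Implicit Types (A H : hopfStarAlg R) (V W : lmodType C).

(** For the convolution product, [f = f * (g * k) = (f * g) * k = k]. *)
Lemma convolution_inverse_uniq A W (mu : W -> W -> W) (e : W) (f g k : A -> W) :
  bilin mu -> associative mu -> left_id e mu -> right_id e mu ->
  linear f -> linear g -> linear k ->
  (forall a, tlift (fun x y => mu (f x) (g y)) (comul a) = counit a *: e) ->
  (forall a, tlift (fun x y => mu (g x) (k y)) (comul a) = counit a *: e) ->
  f =1 k.
Proof.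
move=> bmu muA mu1 mur1 lf lg lk fg gk a.
transitivity (tlift (fun x y => mu (f x) (tlift (fun u v => mu (g u) (k v)) (comul y))) (comul a)).
  rewrite -[LHS](counit_sumr _ lf); apply: eq_tlift => x y.
  by rewrite gk (bilinZr _ _ _ bmu) mur1.
transitivity (tlift (fun x y => mu (tlift (fun u v => mu (f u) (g v)) (comul x)) (k y)) (comul a)).
  rewrite (eq_tlift (g := fun x y => tlift (fun u v => mu (f x) (mu (g u) (k v))) (comul y))).
    rewrite -(comul_sum (f := fun x u v => mu (f x) (mu (g u) (k v)))); last first.
      by split; lin.
    apply: eq_tlift => x y; rewrite (tlift_lin (phi := fun w => mu w (k y))); last by lin.
    by apply: eq_tlift => u v; rewrite muA.
  by move=> x y; rewrite (tlift_lin (phi := mu (f x))) //; lin.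
rewrite -[RHS](counit_suml _ lk); apply: eq_tlift => x y.
by rewrite fg (bilinZl _ _ _ bmu) mu1.
Qed.

Lemma antipode1 A : antipode (1 : A) = 1.
Proof.
have := antipodel (1 : A); rewrite comul1 tlift_tens; last by lin.
by rewrite mulr1 counit1 scale1r.
Qed.

Lemma antipodeM A (a b : A) : antipode (a * b) = antipode b * antipode a.
Proof.
(* In the convolution algebra of A (x) A, the maps S(ab) and S(b)S(a) are a left and a
   right inverse of ab. G and L are the triple product of the three maps, with one of the
   two coproducts still to be reassociated. *)
pose G (x y z : A) : A := tlift (fun t v => tlift (fun u w =>
  antipode (x * u) * (y * w) * (antipode v * antipode z)) (comul t)) (comul b).
have tG : trilin G by rewrite /G; split; lin.
have step (s z t v : A) : tlift (fun x y => tlift (fun u w =>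
    antipode (x * u) * (y * w) * (antipode v * antipode z)) (comul t)) (comul s)
    = counit s *: (counit t *: (antipode v * antipode z)).
  rewrite -(comulM_sum (f := fun p q => antipode p * q * (antipode v * antipode z))); last by lin.
  rewrite (antipode_suml (f := fun p => p * (antipode v * antipode z))); last by lin.
  by rewrite mul1r counitM scalerA.
transitivity (tlift (fun s z => tlift (fun x y => G x y z) (comul s)) (comul a)); last first.
  rewrite -(counit_suml (f := antipode) a); last by lin.
  rewrite (tlift_lin (phi := *%R (antipode b))); last by lin.
  apply: eq_tlift => s z; rewrite /G tlift_exchange (eq_tlift (fun t v => step s z t v)).
  rewrite /= -scalerAr -(counit_suml (f := fun b => counit s *: (antipode b * antipode z)) b); last by lin.
  by apply: eq_tlift => t v; rewrite !scalerA mulrC.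
rewrite comul_sum // -[LHS](counit_sumr (f := fun a => antipode (a * b))); last by lin.
apply: eq_tlift => x y.
pose L (u w v : A) : A := tlift (fun y z => antipode (x * u) * (y * w) * (antipode v * antipode z)) (comul y).
have tL : trilin L by rewrite /L; split; lin.
transitivity (tlift (fun t v => tlift (fun u w => L u w v) (comul t)) (comul b)); last first.
  rewrite /G tlift_exchange; apply: eq_tlift => t v; exact: tlift_exchange.
rewrite comul_sum // -(counit_sumr (f := fun b => counit y *: antipode (x * b)) b); last by lin.
apply: eq_tlift => u t; rewrite /L tlift_exchange.
transitivity (tlift (fun y z => counit t *: (antipode (x * u) * (y * antipode z))) (comul y)).
  rewrite (antipode_sumr (f := fun p => counit t *: (antipode (x * u) * p))); last by lin.
  by rewrite mulr1 !scalerA mulrC.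
apply: eq_tlift => p q.
rewrite (eq_tlift (g := fun w v => antipode (x * u) * (p * (w * antipode v) * antipode q))); last first.
  by move=> w v; rewrite !mulrA.
rewrite (antipode_sumr (f := fun r => antipode (x * u) * (p * r * antipode q))); last by lin.
by rewrite mulr1.
Qed.

Lemma tmulA (A B : algType C) : associative (@tmul _ A B).
Proof.
move=> s t w; move: s; apply: eq_linear_tens => [||a b]; [by lin|by lin|cbv beta].
move: t; apply: eq_linear_tens => [||a' b']; [by lin|by lin|cbv beta].
move: w; apply: eq_linear_tens => [||a'' b'']; [by lin|by lin|cbv beta].
by rewrite !tmul_tens !mulrA.
Qed.

Lemma tmul1 (A B : algType C) : left_id (tens 1 1) (@tmul _ A B).
Proof. by apply: eq_linear_tens => [||a b]; [by lin|by lin|rewrite tmul_tens !mul1r]. Qed.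

Lemma tmulr1 (A B : algType C) : right_id (tens 1 1) (@tmul _ A B).
Proof. by apply: eq_linear_tens => [||a b]; [by lin|by lin|rewrite tmul_tens !mulr1]. Qed.

(** Both sides are convolution inverses of [p]. *)
Lemma epi_antipode A H (p : hopfStarEpi A H) a : antipode (p a) = p (antipode a).
Proof.
have [lp pM p1] := hs_map_alg p.
apply: (convolution_inverse_uniq (mu := *%R) (e := 1) (g := p)
  (f := fun x => antipode (p x)) (k := fun x => p (antipode x))) => //; try by lin.
- exact: mulrA.
- exact: mul1r.
- exact: mulr1.
- move=> x; rewrite -(hs_map_counit p) -antipodel hs_map_comul tlift_tmap //; lin.
- move=> x; have := congr1 p (antipoder x); rewrite (linZ lp) p1 => <-.
  by rewrite (tlift_lin _ _ lp); apply: eq_tlift => u v; rewrite pM.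
Qed.

(** Both sides are convolution inverses of [comul]. *)
Lemma comul_antipode A (a : A) :
  comul (antipode a) = tlift (fun x y => tens (antipode y) (antipode x)) (comul a).
Proof.
move: a; apply: (convolution_inverse_uniq (mu := @tmul _ A A) (e := tens 1 1)
  (f := fun a => comul (antipode a)) (g := comul)
  (k := fun a => tlift (fun x y => tens (antipode y) (antipode x)) (comul a))); try by lin.
- exact: tmulA.
- exact: tmul1.
- exact: tmulr1.
- move=> a; rewrite -comul1 -(antipode_suml (f := comul)); last by lin.
  by apply: eq_tlift => x y; rewrite comulM.
move=> a; pose F (p q y : A) := tlift (fun u v => tens (p * antipode v) (q * antipode u)) (comul y).
transitivity (tlift (fun x y => tlift (fun p q => F p q y) (comul x)) (comul a)).
  apply: eq_tlift => x y; rewrite -{1}[comul x]tlift_tensE.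
  rewrite (tlift_lin (phi := fun w => tmul w _)); last by lin.
  apply: eq_tlift => p q; rewrite (tlift_lin (phi := tmul (tens p q))); last by lin.
  by apply: eq_tlift => u v; rewrite tmul_tens.
rewrite comul_sum; last by rewrite /F; split; lin.
rewrite -(antipode_sumr (f := fun p => tens p 1)); last by lin.
apply: eq_tlift => p y; rewrite /F.
rewrite -(comul_sum (f := fun q u v => tens (p * antipode v) (q * antipode u))); last by split; lin.
rewrite -(counit_suml (f := fun v => tens (p * antipode v) 1) y); last by lin.
apply: eq_tlift => s v.
by rewrite (antipode_sumr (f := fun q => tens (p * antipode v) q)) //; lin.
Qed.

Lemma star_conj A : conj_linear (star (h := A)).
Proof. by case: (star_is_star A). Qed.
Lemma starK A : involutive (star (h := A)).
Proof. by case: (star_is_star A). Qed.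
Lemma starM A (a b : A) : star (a * b) = star b * star a.
Proof. by case: (star_is_star A). Qed.

Section ConjLinear.
Variables (V W : lmodType C) (s : V -> W).
Hypothesis cs : conj_linear s.
Lemma conj_linD : {morph s : x y / x + y}.
Proof. by move=> x y; have := cs 1 x y; rewrite rmorph1 !scale1r. Qed.
Lemma conj_lin0 : s 0 = 0.
Proof. by apply: (addrI (s 0)); rewrite -conj_linD !addr0. Qed.
Lemma conj_linZ c x : s (c *: x) = c^* *: s x.
Proof. by have := cs c x 0; rewrite !addr0 conj_lin0 addr0. Qed.
Lemma conj_lin_sum (I : Type) (r : seq I) (f : I -> V) :
  s (\sum_(i <- r) f i) = \sum_(i <- r) s (f i).
Proof. exact: (big_morph s conj_linD conj_lin0). Qed.
End ConjLinear.

Lemma star1 A : star (1 : A) = 1.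
Proof. by rewrite -[LHS]mulr1 -{2}(starK (1 : A)) -starM mulr1 starK. Qed.

Lemma tlift_tstar (V V' W : lmodType C) (s : V -> V) (s' : V' -> V') (f : V -> V' -> W) t :
  conj_linear s -> conj_linear s' -> bilin f ->
  tlift f (tstar s s' t) = tlift (fun u v => f (s u) (s' v)) t.
Proof.
move=> cs cs' bf; have bb := bilin_balanced bf.
rewrite /tstar (tlift_morph _ _ (tlift_add bb)).
by apply: eq_tlift => u v; rewrite tlift_tens.
Qed.

Section Scalars.
Variables (V : lmodType C) (f : V -> C).
Hypothesis sf : scalar f.
Lemma scaD : {morph f : x y / x + y}.
Proof. by move=> x y; have := sf 1 x y; rewrite scale1r mul1r. Qed.
Lemma sca0 : f 0 = 0.
Proof. by apply: (addrI (f 0)); rewrite -scaD !addr0. Qed.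
Lemma scaZ c x : f (c *: x) = c * f x.
Proof. by have := sf c x 0; rewrite !addr0 sca0 addr0. Qed.
Lemma sca_sumE (I : Type) (r : seq I) (P : pred I) (g : I -> V) :
  f (\sum_(i <- r | P i) g i) = \sum_(i <- r | P i) f (g i).
Proof. exact: (big_morph f scaD sca0). Qed.
End Scalars.

Lemma counitD A : {morph counit (h := A) : x y / x + y}.
Proof. exact: scaD (@counit_scalar _ A). Qed.
Lemma counitZ A c (a : A) : counit (c *: a) = c * counit a.
Proof. exact: scaZ (@counit_scalar _ A) c a. Qed.

(** The conjugate of the counit of [star a] satisfies the axiom of a counit, and counits
   are unique. *)
Lemma counit_star A (a : A) : counit (star a) = (counit a)^*.
Proof.
pose e (a : A) : C^o := (counit (star a))^*.
have le : linear e.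
  by move=> c x y; rewrite /e star_conj counit_scalar rmorphD rmorphM /= conjCK.
have eE (b : A) : tlift (fun x y => e x *: y) (comul b) = b.
  have := congr1 star (counitl (star b)); rewrite starK comul_star => {2}<-.
  rewrite (tlift_tstar (f := fun x y => counit x *: y)); try exact: star_conj; last by lin.
  rewrite (tlift_morph _ _ (conj_linD (@star_conj A))); apply: eq_tlift => x y.
  by rewrite (conj_linZ (@star_conj A)) starK.
apply: (can_inj (@conjCK _)); rewrite conjCK -/(e a).
rewrite -(counit_sumr a le) -{2}(eE a).
rewrite (tlift_morph (phi := counit : A -> C^o)); last by move=> x y; exact: counitD.
apply: eq_tlift => x y; by rewrite counitZ mulrC.
Qed.
End HopfFacts.

Section Functionals.
Variable K : fieldType.

(** A generalised inverse of [c |-> c v] sends [v] to [1]. *)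
Lemma separating_functional (V : lmodType K) (v : V) : v != 0 ->
  exists f : V -> K, scalar f /\ f v != 0.
Proof.
move=> v0; have lf : linear (fun c : K^o => c *: v) by lin.
have [g [lg fgf]] := generalized_inverse lf.
exists g; split=> //; apply/eqP => gv; have := fgf 1.
by rewrite scale1r gv scale0r => /esym/eqP; rewrite (negbTE v0).
Qed.

Lemma functional_ext (V : lmodType K) (v w : V) :
  (forall f : V -> K, scalar f -> f v = f w) -> v = w.
Proof.
move=> h; apply/eqP; rewrite -subr_eq0; apply/negP => /negP n0.
have [f [lf]] := separating_functional n0.
by rewrite (linB (lf : linear (f : V -> K^o))) (h f lf) subrr eqxx.
Qed.

(** [v - g (v mod S)], where [g] is a generalised inverse of the projection modulo [S]. *)
Lemma linear_projector (V : lmodType K) (S : set V) : linear_set S -> S 0 ->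
  exists e : V -> V, [/\ linear e, forall v, S (e v) & forall v, S v -> e v = v].
Proof.
move=> lS S0; have lp := lproj_linear S.
have spanS v : lspan S v -> S v.
  move=> [s [hs ->]]; rewrite big_seq; elim/big_ind: _ => // [x y Sx Sy|p /hs Sp].
    by rewrite -[x]scale1r; exact: lS.
  exact: linear_setZ.
have [g [lg pgp]] := generalized_inverse lp.
exists (fun v => v - g (lproj S v)); split; first by lin.
  by move=> v; apply/spanS/lproj_eq0; rewrite (linB lp) pgp subrr.
by move=> v Sv; rewrite (proj2 (lproj_eq0 _ _)) ?(lin0 lg) ?subr0 //; exact: lspan_gen.
Qed.

End Functionals.

(** * Matrix corepresentations and the invariant integral *)

Section RowMatrix.
Variable K : fieldType.

Lemma linear_rV_mx m n (e : 'rV[K]_m -> 'rV[K]_n) : linear e ->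
  exists Q : 'M[K]_(m, n), forall v, e v = v *m Q.
Proof.
move=> le; exists (\matrix_i e (delta_mx 0 i)) => v.
rewrite {1}(row_sum_delta v) (big_morph e (linD le) (lin0 le)) mulmx_sum_row.
by apply: eq_bigr => i _; rewrite (linZ le) rowK.
Qed.

Lemma eq_mx_rV m n (P Q : 'M[K]_(m, n)) : (forall v : 'rV_m, v *m P = v *m Q) -> P = Q.
Proof. by move=> h; apply/row_matrixP => i; rewrite !rowE. Qed.
End RowMatrix.

Section ScalarMatrices.
Variable R : realType.
Local Notation C := R[i].
Variable A : algType C.

Definition smx m n (P : 'M[C]_(m, n)) : 'M[A]_(m, n) := map_mx (in_alg A) P.

Lemma smxM m n p (P : 'M[C]_(m, n)) (Q : 'M_(n, p)) : smx (P *m Q) = smx P *m smx Q.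
Proof. exact: map_mxM. Qed.
Lemma smx1 n : smx (1%:M : 'M_n) = 1%:M.
Proof. exact: map_mx1. Qed.

Lemma mulmx_smxE m n p (u : 'M[A]_(m, n)) (P : 'M[C]_(n, p)) i j :
  (u *m smx P) i j = \sum_k P k j *: u i k.
Proof. by rewrite mxE; apply: eq_bigr => k _; rewrite mxE -scalerAr mulr1. Qed.

Lemma mul_smxE m n p (P : 'M[C]_(m, n)) (u : 'M[A]_(n, p)) i j :
  (smx P *m u) i j = \sum_k P i k *: u k j.
Proof. by rewrite mxE; apply: eq_bigr => k _; rewrite mxE -scalerAl mul1r. Qed.

Lemma smx_delta_mul n p (u : 'M[A]_(n, p)) i j : (smx (delta_mx 0 i : 'rV_n) *m u) 0 j = u i j.
Proof.
rewrite mul_smxE (bigD1 i) //= mxE !eqxx scale1r big1 ?addr0 // => k ki.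
by rewrite mxE eqxx (negbTE ki) scale0r.
Qed.

Section Map.
Variables (f : A -> C).
Hypothesis sf : scalar f.

Lemma map_mulmx_smx m n p (u : 'M[A]_(m, n)) (P : 'M[C]_(n, p)) :
  map_mx f (u *m smx P) = map_mx f u *m P.
Proof.
apply/matrixP => i j; rewrite mxE mulmx_smxE mxE (sca_sumE sf).
by apply: eq_bigr => k _; rewrite (scaZ sf) mxE mulrC.
Qed.

Lemma map_mul_smx m n p (P : 'M[C]_(m, n)) (u : 'M[A]_(n, p)) :
  map_mx f (smx P *m u) = P *m map_mx f u.
Proof.
apply/matrixP => i j; rewrite mxE mul_smxE mxE (sca_sumE sf).
by apply: eq_bigr => k _; rewrite (scaZ sf) mxE.
Qed.
End Map.

Lemma mx_functional_ext m n (u v : 'M[A]_(m, n)) :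
  (forall f : A -> C, scalar f -> map_mx f u = map_mx f v) -> u = v.
Proof.
move=> h; apply/matrixP => i j; apply: functional_ext => f sf.
by have /matrixP/(_ i j) := h f sf; rewrite !mxE.
Qed.
End ScalarMatrices.
Arguments smx {R} A {m n}.

Lemma alg_map_mulmx (R : realType) (A B : algType R[i]) (f : A -> B) m n p
    (u : 'M[A]_(m, n)) (v : 'M[A]_(n, p)) : is_alg_map f ->
  map_mx f (u *m v) = map_mx f u *m map_mx f v.
Proof.
move=> [lf fM _]; apply/matrixP => i j; rewrite !mxE (big_morph f (linD lf) (lin0 lf)).
by apply: eq_bigr => k _; rewrite !mxE fM.
Qed.

Lemma alg_map_smx (R : realType) (A B : algType R[i]) (f : A -> B) m n
    (P : 'M[R[i]]_(m, n)) : is_alg_map f -> map_mx f (smx A P) = smx B P.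
Proof. by move=> [lf _ f1]; apply/matrixP => i j; rewrite !mxE (linZ lf) f1. Qed.

Section MatrixCoreps.
Variable R : realType.
Local Notation C := R[i].
Variable H : hopfStarAlg R.

Definition dagger m n (u : 'M[H]_(m, n)) : 'M[H]_(n, m) := (map_mx star u)^T.

(** The coefficients of the left coaction [e_i |-> sum_j u_ij (x) e_j]. *)
Definition matrix_corep n (u : 'M[H]_n) : Prop :=
  (forall i j, comul (u i j) = \sum_k tens (u i k) (u k j)) /\
  (forall i j, counit (u i j) = (i == j)%:R).

Definition unitary_corep n (u : 'M[H]_n) : Prop :=
  [/\ matrix_corep u, u *m dagger u = 1%:M & dagger u *m u = 1%:M].

Definition irreducible_corep n (u : 'M[H]_n) : Prop :=
  (0 < n)%N /\ forall P : 'M[C]_n, P *m P = P ->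
    u *m smx H P = smx H P *m (u *m smx H P) -> P = 0 \/ P = 1%:M.

Definition irrep_coefficient : set H := [set x | exists n (u : 'M[H]_n),
  [/\ unitary_corep u, irreducible_corep u & exists i j, x = u i j]].

(** The counit axiom reads [counit(u) u = u], so that an invertible [u] has counit [1]. *)
Lemma comultiplicative_corep n (u v : 'M[H]_n) :
  (forall i j, comul (u i j) = \sum_k tens (u i k) (u k j)) ->
  u *m v = 1%:M -> matrix_corep u.
Proof.
move=> uD uv; split=> // i j.
have e : smx H (map_mx counit u) *m u = u.
  apply/matrixP => a b; rewrite mul_smxE -[RHS](counitl (u a b)) uD.
  rewrite (big_morph _ (tlift_add (_ : balanced (fun x y : H => counit x *: y)))
    (tlift_zero (_ : balanced (fun x y : H => counit x *: y)))); try by lin.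
  by apply: eq_bigr => k _; rewrite tlift_tens ?mxE //; lin.
have : smx H (map_mx counit u) = 1%:M.
  by rewrite -[LHS]mulmx1 -uv mulmxA e.
move/matrixP/(_ i j); rewrite !mxE => /(congr1 counit).
by rewrite counitZ counit1 mulr1 => ->; case: eqP; rewrite ?counit1 // (sca0 (@counit_scalar _ H)).
Qed.

(** The entries of an irreducible unitary corepresentation of the compact quantum group
   lie in the range of the embedding [f] of [H], and the minimal tensor product contains
   the algebraic one, so the whole matrix pulls back to [H]. *)
Lemma cqg_spanned : is_cqg_algebra H -> forall h : H, lspan irrep_coefficient h.
Proof.
move=> [G [f [[fA fI] fS fD fr]]] h; have [lf fM f1] := fA.
have tI : injective (fun t : tensor H H => cqg_tens (tmap f f t)).
  have [[_ kI] _ _ _ _] := cqg_tensP G.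
  move=> s t /kI.
  have [g [lg fgf]] := generalized_inverse lf.
  have gf : g \o f = id by apply/funext => v; apply: fI; exact: fgf.
  by move/(congr1 (tmap g g)); rewrite !tmap_comp // gf !tmap_id.
have pull n (u : 'M[cqg_alg G]_n) : is_unitary_corep u -> is_irreducible_corep u ->
    forall i j, exists2 x, irrep_coefficient x & f x = u i j.
  move=> uu iu i j.
  have ur a b : exists x, f x = u a b.
    suff : range f (u a b) by move=> [x _ <-]; exists x.
    by rewrite fr; apply: lspan_gen; exists n, u; split=> //; exists a, b.
  have /choice[v vE] : forall p : 'I_n * 'I_n, exists x, f x = u p.1 p.2 by move=> p; exact: ur.
  pose w := \matrix_(a, b) v (a, b).
  have wE : map_mx f w = u by apply/matrixP => a b; rewrite !mxE vE.
  have [uD uU uU'] := uu.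
  have dE : map_mx f (dagger w) = map_mx (@cs_star _ _) u^T.
    by rewrite -wE; apply/matrixP => a b; rewrite !mxE fS.
  have mI p q (x y : 'M[H]_(p, q)) : map_mx f x = map_mx f y -> x = y.
    by move/matrixP => e; apply/matrixP => a b; apply: fI; have := e a b; rewrite !mxE.
  have f1m : map_mx f (1%:M : 'M_n) = 1%:M.
    apply/matrixP => a b; rewrite !mxE; case: eqP => // _; exact: lin0 lf.
  have ww : w *m dagger w = 1%:M.
    by apply: mI; rewrite alg_map_mulmx // wE dE f1m.
  exists (w i j); last by rewrite mxE vE.
  exists n, w; split; last by exists i, j.
    split=> //; last by apply: mI; rewrite alg_map_mulmx // wE dE f1m.
    apply: (comultiplicative_corep _ ww) => a b; apply: tI => /=.
    rewrite -fD mxE vE uD; have [[lk _] _ _ _ _] := cqg_tensP G.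
    have lt : linear (fun t : tensor H H => cqg_tens (tmap f f t)) by lin.
    rewrite (big_morph _ (linD lt) (lin0 lt)); apply: eq_bigr => k _.
    by rewrite tmap_tens // !mxE !vE.
  have [n0 irr] := iu; split=> // P PP Pw; apply: irr => //=.
  have := congr1 (map_mx f) Pw; rewrite !alg_map_mulmx // alg_map_smx // wE.
  by [].
have : range f (f h) by exists h.
rewrite fr => -[s [sG fhE]].
have /choice[v vE] : forall p : C * cqg_alg G, exists x : H, p \in s ->
    irrep_coefficient x /\ f x = p.2.
  move=> p; case: (boolP (p \in s)) => [ps|_]; last by exists 0.
  have [n [u [uu iu [i [j e]]]]] := sG p ps.
  by have [x xc xE] := pull n u uu iu i j; exists x; rewrite e.
exists [seq (p.1, v p) | p <- s]; split.
  by move=> p /mapP[q /vE[qc _] ->].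
apply: fI; rewrite fhE big_map (big_morph f (linD lf) (lin0 lf)) !big_seq.
by apply: eq_bigr => p /vE[_ e] /=; rewrite (linZ lf) e.
Qed.

(** The action on [H] of the dual algebra, whose submodules are the left subcomodules. *)
Definition contract (f : H -> C) (x : H) : H := tlift (fun a b => f a *: b) (comul x).

Lemma contract_linear f : scalar f -> linear (contract f).
Proof. by move=> sf; rewrite /contract; lin. Qed.

Lemma contract_row f n (u : 'M[H]_n) (x : 'rV[C]_n) j : scalar f -> matrix_corep u ->
  contract f ((smx H x *m u) 0 j) = (smx H (x *m map_mx f u) *m u) 0 j.
Proof.
move=> sf [uD _].
have lc := contract_linear sf.
rewrite smxM -mulmxA !mul_smxE (big_morph _ (linD lc) (lin0 lc)).
apply: eq_bigr => k _; rewrite (linZ lc); congr (_ *: _).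
have bf : bilin (fun a b : H => f a *: b) by lin.
rewrite /contract uD.
rewrite (big_morph _ (tlift_add (bilin_balanced bf)) (tlift_zero (bilin_balanced bf))).
rewrite mul_smxE; apply: eq_bigr => l _.
by rewrite tlift_tens ?mxE //; exact: bilin_balanced.
Qed.

Definition left_integral (h : H -> C) : Prop :=
  [/\ scalar h, h 1 = 1
    & forall x : H, tlift (fun a b => h b *: a) (comul x) = h x *: 1].

(** [H] is a sum of simple subcomodules, the columns of the irreducible [u]. Let [S] be
   maximal among the subcomodules that do not contain [1]. A column that is not inside
   [S + C1] meets it in [0] by simplicity, and then it could be added to [S] without
   reaching [1]. Hence [H] is the direct sum of [S] and [C1], and [h] is the projection on
   [C1] along [S]; it is invariant because [S] is a subcomodule. *)
Theorem left_integral_exists : (forall h : H, lspan irrep_coefficient h) ->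
  exists h, left_integral h.
Proof.
move=> spanned.
pose P (S : set H) := [/\ linear_set S,
  forall f x, scalar f -> S x -> S (contract f x) & ~ S 1].
have [|S [[lS cS S1] Smax]] := @Zorn_bigcup H P.
  move=> F FP Ftot; split.
  - move=> c x y [X FX Xx] [Y FY Yy].
    have [XY|YX] := Ftot _ _ FX FY.
      by exists Y => //; have [lY _ _] := FP _ FY; apply: lY => //; exact: XY.
    by exists X => //; have [lX _ _] := FP _ FX; apply: lX => //; exact: YX.
  - by move=> f x sf [X FX Xx]; exists X => //; have [_ cX _] := FP _ FX; exact: cX.
  - by move=> [X FX]; have [_ _] := FP _ FX.
have S0 : S 0.
  apply: contrapT => nS0; apply: (Smax [set 0]).
    split; last by move=> /(_ 0 erefl).
    by move=> x Sx; have := linear_set0 lS Sx.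
  split=> [c x y -> ->|f x sf ->|/= /eqP]; last by rewrite oner_eq0.
    by rewrite /= scaler0 addr0.
  by rewrite /= (lin0 (contract_linear sf)).
pose T x := exists s c, S s /\ x = s + c *: (1 : H).
have lT : linear_set T.
  move=> c x y [s [d [Ss ->]]] [s' [d' [Ss' ->]]].
  exists (c *: s + s'), (c * d + d'); split; first exact: lS.
  by rewrite scalerDr scalerDl scalerA addrACA.
have T0 : T 0 by exists 0, 0; rewrite scale0r addr0.
have ST x : S x -> T x by move=> Sx; exists x, 0; rewrite scale0r addr0.
have c1 f : scalar f -> contract f 1 = f 1 *: 1.
  by move=> sf; rewrite /contract comul1 tlift_tens //; lin.
have cT f x : scalar f -> T x -> T (contract f x).
  move=> sf [s [c [Ss ->]]]; have lc := contract_linear sf.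
  rewrite (linD lc) (linZ lc) (c1 _ sf) scalerA; exists (contract f s), (c * f 1).
  by split=> //; exact: cS.
have Tall x : T x.
  have [s [sG ->]] := spanned x; rewrite big_seq.
  elim/big_ind: _ => // [y z Ty Tz|p /sG [n [u [[uc uu uu'] iu [i [j ->]]]]]].
    by rewrite -[y]scale1r; exact: lT.
  apply: linear_setZ => //.
  (* The rows sent into T by the j-th column of u form an invariant subspace. *)
  pose K := [set y : 'rV[C]_n | T ((smx H y *m u) 0 j)].
  have rowE : linear (fun y : 'rV[C]_n => (smx H y *m u) 0 j).
    move=> c y z; rewrite !mul_smxE scaler_sumr -big_split; apply: eq_bigr => k _ /=.
    by rewrite !mxE scalerDl scalerA.
  have lK : linear_set K by move=> c y z; rewrite /K /= rowE; exact: lT.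
  have K0 : K 0 by rewrite /K /= (lin0 rowE).
  have [e [le eK Ke]] := linear_projector lK K0.
  have [Q eQ] := linear_rV_mx le.
  have QQ : Q *m Q = Q.
    by apply: eq_mx_rV => v; rewrite mulmxA -!eQ Ke.
  have uQ f : scalar f -> Q *m map_mx f u *m Q = Q *m map_mx f u.
    move=> sf; apply: eq_mx_rV => v; rewrite !mulmxA -!eQ Ke //.
    rewrite /K /= eQ -contract_row //; apply: cT => //; rewrite -eQ; exact: eK.
  have [n0 irr] := iu.
  have PP : (1%:M - Q) *m (1%:M - Q) = 1%:M - Q.
    by rewrite mulmxBl mul1mx mulmxBr mulmx1 QQ subrr subr0.
  have uP : u *m smx H (1%:M - Q) = smx H (1%:M - Q) *m (u *m smx H (1%:M - Q)).
    apply: mx_functional_ext => f sf.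
    rewrite map_mul_smx // map_mulmx_smx // mulmxBl mul1mx mulmxBr mulmx1.
    by rewrite mulmxBr mulmxA uQ // subrr subr0.
  have [Q1|Q0] := irr _ PP uP.
    have {}Q1 : Q = 1%:M by apply/eqP; rewrite eq_sym -subr_eq0 Q1.
    have : K (delta_mx 0 i) by rewrite -[delta_mx 0 i]mulmx1 -Q1 -eQ; exact: eK.
    by rewrite /K /= smx_delta_mul.
  have {}Q0 : Q = 0 by rewrite -[Q](subKr 1%:M) Q0 subrr.
  have K00 y : K y -> y = 0 by move=> /Ke; rewrite eQ Q0 mulmx0.
  pose S' z := exists s y, S s /\ z = s + (smx H (y : 'rV[C]_n) *m u) 0 j.
  have S'S z : S z -> S' z.
    by move=> Sz; exists z, 0; split=> //; rewrite (lin0 rowE) addr0.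
  have PS' : P S'.
    split.
    - move=> c z z' [s1 [y [Ss ->]]] [s1' [y' [Ss' ->]]].
      exists (c *: s1 + s1'), (c *: y + y'); split; first exact: lS.
      by rewrite rowE scalerDr addrACA.
    - move=> f z sf [s1 [y [Ss ->]]]; rewrite (linD (contract_linear sf)) contract_row //.
      by exists (contract f s1), (y *m map_mx f u); split=> //; exact: cS.
    - move=> [s1 [y [Ss e1]]].
      have Ky : K y.
        rewrite /K /=; exists (- s1), 1; split.
          by rewrite -scaleN1r; exact: linear_setZ.
        by rewrite scale1r {1}e1 addKr.
      by apply: S1; rewrite e1 (K00 _ Ky) (lin0 rowE) addr0.
  have SS' : S' `<=` S.
    by apply: contrapT => nSS'; apply: (Smax _ _ PS'); split.
  have : K (delta_mx 0 i).
    apply: ST; apply: SS'; exists 0, (delta_mx 0 i); split=> //.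
    by rewrite add0r.
  move/K00/matrixP/(_ 0 i); rewrite !mxE !eqxx => /eqP; by rewrite oner_eq0.
have Suniq s c s' c' : S s -> S s' -> s + c *: (1 : H) = s' + c' *: 1 -> c = c'.
  move=> Ss Ss' e; apply/eqP; rewrite -subr_eq0; apply/negP => /negP n0; apply: S1.
  have : (c - c') *: (1 : H) = s' - s.
    by rewrite scalerBl; apply/eqP; rewrite subr_eq addrAC -e addrAC subrr add0r.
  move/(congr1 (fun z => (c - c')^-1 *: z)); rewrite scalerA mulVf // scale1r => ->.
  by apply: linear_setZ => //; exact: linear_setB.
have Tall' x : exists c, exists s, S s /\ x = s + c *: 1.
  by have [s [c [Ss xE]]] := Tall x; exists c, s.
have [h hS] := choice Tall'.
have hE s c : S s -> h (s + c *: 1) = c.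
  by move=> Ss; have [s' [Ss' e]] := hS (s + c *: 1); apply/esym; exact: Suniq Ss Ss' e.
have sh : scalar h.
  move=> c x y; have [s [Ss xE]] := hS x; have [s' [Ss' yE]] := hS y.
  rewrite {1}xE {1}yE scalerDr addrACA scalerA -scalerDl hE //; exact: lS.
exists h; split=> // [|x]; first by rewrite -[RHS](hE 0 1) ?add0r ?scale1r.
apply: functional_ext => f sf; rewrite (scaZ sf) (tlift_morph _ _ (scaD sf)).
have -> : tlift (fun a b => f (h b *: a)) (comul x) = h (contract f x).
  by rewrite /contract (tlift_morph _ _ (scaD sh)); apply: eq_tlift => a b;
    rewrite (scaZ sf) (scaZ sh) mulrC.
have [s [Ss xE]] := hS x; rewrite {1}xE.
rewrite (linD (contract_linear sf)) (linZ (contract_linear sf)) c1 // scalerA.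
by rewrite hE //; exact: cS.
Qed.
End MatrixCoreps.

(** * Unitarisability of finite dimensional corepresentations *)

Section Hermitian.
Variable R : realType.
Local Notation C := R[i].

Definition ct m n (P : 'M[C]_(m, n)) : 'M[C]_(n, m) := (map_mx Num.conj P)^T.

Lemma ctM m n p (P : 'M[C]_(m, n)) (Q : 'M_(n, p)) : ct (P *m Q) = ct Q *m ct P.
Proof. by rewrite /ct map_mxM trmx_mul. Qed.

Lemma ctK m n (P : 'M[C]_(m, n)) : ct (ct P) = P.
Proof. by apply/matrixP => i j; rewrite !mxE; exact: conjCK. Qed.

Lemma ct1 n : ct (1%:M : 'M_n) = 1%:M.
Proof. by rewrite /ct map_mx1 trmx1. Qed.

Lemma mulmx_ct_eq0 n (y : 'rV[C]_n) : y *m ct y = 0 -> y = 0.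
Proof.
move=> /matrixP/(_ 0 0); rewrite !mxE => h.
have h' : \sum_i `|y 0 i| ^+ 2 = 0.
  by rewrite -[RHS]h; apply: eq_bigr => i _; rewrite !mxE normCK.
apply/rowP => i; rewrite mxE.
have p (j : 'I_n) : true -> 0 <= `|y 0 j| ^+ 2 by move=> _; rewrite exprn_ge0.
have /eqP : `|y 0 i| ^+ 2 = 0 by exact: (psumr_eq0P p h').
by rewrite expf_eq0 /= normr_eq0 => /eqP.
Qed.

Lemma gram_unit m n (W : 'M[C]_(m, n)) : row_free W -> W *m ct W \in unitmx.
Proof.
move=> fW; rewrite -row_free_unit -kermx_eq0; apply/rowV0P => v /sub_kermxP v0.
have : v *m W = 0 by apply: mulmx_ct_eq0; rewrite ctM mulmxA -(mulmxA v) v0 mul0mx.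
move/eqP; rewrite mulmx_free_eq0 // => /eqP; exact.
Qed.

Lemma ct_inv n (G : 'M[C]_n) : G \in unitmx -> ct (invmx G) = invmx (ct G).
Proof.
move=> uG; have e : ct (invmx G) *m ct G = 1%:M by rewrite -ctM mulmxV // ct1.
have uG' : ct G \in unitmx by case: (mulmx1_unit e).
by rewrite -[LHS]mulmx1 -(mulmxV uG') mulmxA e mul1mx.
Qed.

(** If the rows of [W] are a basis of the subspace, then [W W^t] is invertible, where
   [W^t] is the conjugate transpose, and [P] is the product of [W^t], the inverse of
   [W W^t] and [W]. *)
Lemma orthogonal_projector n (S : set 'rV[C]_n) : linear_set S -> S 0 ->
  exists P : 'M[C]_n, [/\ ct P = P, forall x, S (x *m P) & forall x, S x -> x *m P = x].
Proof.
move=> lS S0; have [e [le eS Se]] := linear_projector lS S0.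
have [Q eQ] := linear_rV_mx le.
have [W [fW eW]] : exists W : 'M_(\rank Q, n), row_free W /\ (W :=: Q)%MS.
  by exists (row_base Q); split; [exact: row_base_free|exact: eq_row_base].
have uW := gram_unit fW.
exists (ct W *m invmx (W *m ct W) *m W); split.
- by rewrite !ctM ct_inv // ctM !ctK mulmxA.
- move=> x; rewrite mulmxA.
  have /submxP[y ->] : (x *m (ct W *m invmx (W *m ct W)) *m W <= Q)%MS.
    by rewrite (submx_trans (submxMl _ _)) // eW.
  by rewrite -eQ; exact: eS.
- move=> x Sx; have /submxP[y ->] : (x <= W)%MS.
    by rewrite eW -(Se x Sx) eQ submxMl.
  by rewrite !mulmxA -(mulmxA y) -(mulmxA y) mulmxV // mulmx1.
Qed.
End Hermitian.

Section UnitaryFactorisation.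
Variable R : realType.
Local Notation C := R[i].
Variable H : hopfStarAlg R.

Lemma daggerM m n p (u : 'M[H]_(m, n)) (v : 'M_(n, p)) :
  dagger (u *m v) = dagger v *m dagger u.
Proof.
apply/matrixP => i j; rewrite !mxE (conj_lin_sum (@star_conj _ H)).
by apply: eq_bigr => k _; rewrite starM !mxE.
Qed.

Lemma dagger_smx m n (P : 'M[C]_(m, n)) : dagger (smx H P) = smx H (ct P).
Proof. by apply/matrixP => i j; rewrite !mxE (conj_linZ (@star_conj _ H)) star1. Qed.

Lemma corep_antipodel n (c : 'M[H]_n) : matrix_corep c ->
  map_mx antipode c *m c = 1%:M.
Proof.
move=> [cD ce]; apply/matrixP => i j; rewrite !mxE.
have bm : bilin (fun x y : H => antipode x * y) by lin.
have := antipodel (c i j); rewrite cD ce.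
rewrite (big_morph _ (tlift_add (bilin_balanced bm)) (tlift_zero (bilin_balanced bm))).
rewrite scaler_nat => <-; apply: eq_bigr => k _.
by rewrite mxE tlift_tens //; exact: bilin_balanced.
Qed.

Lemma corep_antipoder n (c : 'M[H]_n) : matrix_corep c ->
  c *m map_mx antipode c = 1%:M.
Proof.
move=> [cD ce]; apply/matrixP => i j; rewrite !mxE.
have bm : bilin (fun x y : H => x * antipode y) by lin.
have := antipoder (c i j); rewrite cD ce.
rewrite (big_morph _ (tlift_add (bilin_balanced bm)) (tlift_zero (bilin_balanced bm))).
rewrite scaler_nat => <-; apply: eq_bigr => k _.
by rewrite mxE tlift_tens //; exact: bilin_balanced.
Qed.

Section LinearMap.
Variable f : H -> H.
Hypothesis lf : linear f.
Lemma linear_map_mulmx_smx m n p (u : 'M[H]_(m, n)) (P : 'M[C]_(n, p)) :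
  map_mx f (u *m smx H P) = map_mx f u *m smx H P.
Proof.
apply/matrixP => i j; rewrite mxE !mulmx_smxE (big_morph f (linD lf) (lin0 lf)).
by apply: eq_bigr => k _; rewrite (linZ lf) mxE.
Qed.
Lemma linear_map_mul_smx m n p (P : 'M[C]_(m, n)) (u : 'M[H]_(n, p)) :
  map_mx f (smx H P *m u) = smx H P *m map_mx f u.
Proof.
apply/matrixP => i j; rewrite mxE !mul_smxE (big_morph f (linD lf) (lin0 lf)).
by apply: eq_bigr => k _; rewrite (linZ lf) mxE.
Qed.
End LinearMap.

(** The matrix coefficients of a single unitary corepresentation; block sums and scalar
   multipliers make this property linear in [c], so that it reduces to the coefficients
   spanning [H]. *)
Definition unitary_factor m n (c : 'M[H]_(m, n)) : Prop :=
  exists N (u : 'M[H]_N) (T : 'M[C]_(m, N)) (Z : 'M[C]_(N, n)),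
    unitary_corep u /\ c = smx H T *m u *m smx H Z.

Lemma unitary_corep_block n n' (u : 'M[H]_n) (v : 'M[H]_n') :
  unitary_corep u -> unitary_corep v -> unitary_corep (block_mx u 0 0 v).
Proof.
move=> [[uD ue] uu uu'] [[vD ve] vv vv'].
have s0 : star (0 : H) = 0 by exact: conj_lin0 (@star_conj _ H).
have dE : dagger (block_mx u 0 0 v) = block_mx (dagger u) 0 0 (dagger v).
  rewrite /dagger map_block_mx tr_block_mx; congr block_mx;
    by apply/matrixP => i j; rewrite !mxE.
split; last 2 first.
- by rewrite dE mulmx_block !mulmx0 !mul0mx !addr0 add0r uu vv -scalar_mx_block.
- by rewrite dE mulmx_block !mulmx0 !mul0mx !addr0 add0r uu' vv' -scalar_mx_block.
have t0 (x : H) : tens x 0 = 0 :> tensor H H := bilin0r _ (tens_bilin _ _).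
have t0' (x : H) : tens 0 x = 0 :> tensor H H := bilin0l _ (tens_bilin _ _).
have ur a b : block_mx u 0 0 v (lshift n' a) (rshift n b) = 0 by rewrite block_mxEur mxE.
have dl a b : block_mx u 0 0 v (rshift n a) (lshift n' b) = 0 by rewrite block_mxEdl mxE.
split=> i j; case: (split_ordP i) => a ->; case: (split_ordP j) => b ->;
  rewrite ?ur ?dl ?(lin0 (@comul_linear _ H)) ?big_split_ord /=.
- rewrite block_mxEul uD [X in _ + X]big1 ?addr0.
    by apply: eq_bigr => k _; rewrite !block_mxEul.
  by move=> k _; rewrite ur t0'.
- by rewrite !big1 ?addr0 // => k _; rewrite ur ?t0 ?t0'.
- by rewrite !big1 ?addr0 // => k _; rewrite dl ?t0 ?t0'.
- rewrite block_mxEdr vD [X in X + _]big1 ?add0r.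
    by apply: eq_bigr => k _; rewrite !block_mxEdr.
  by move=> k _; rewrite dl t0'.
- by rewrite block_mxEul ue (inj_eq (@lshift_inj _ _)).
- by rewrite (sca0 (@counit_scalar _ H)) eq_lrshift.
- by rewrite (sca0 (@counit_scalar _ H)) eq_rlshift.
- by rewrite block_mxEdr ve (inj_eq (@rshift_inj _ _)).
Qed.

Lemma unitary_factorD m n (c c' : 'M[H]_(m, n)) :
  unitary_factor c -> unitary_factor c' -> unitary_factor (c + c').
Proof.
move=> [N [u [T [Z [uu ->]]]]] [N' [u' [T' [Z' [uu' ->]]]]].
exists (N + N')%N, (block_mx u 0 0 u'), (row_mx T T'), (col_mx Z Z').
split; first exact: unitary_corep_block.
by rewrite /smx map_row_mx map_col_mx mul_row_block !mulmx0 addr0 add0r mul_row_col.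
Qed.

Lemma unitary_factor0 m n : unitary_factor (0 : 'M[H]_(m, n)).
Proof.
exists 0%N, 0, 0, 0; split; last by rewrite mulmx0 mul0mx.
by split; [split=> [] []|apply/matrixP => [] []..].
Qed.

Lemma unitary_factor_smx m n p q (c : 'M[H]_(n, p)) (S : 'M[C]_(m, n)) (S' : 'M[C]_(p, q)) :
  unitary_factor c -> unitary_factor (smx H S *m c *m smx H S').
Proof.
move=> [N [u [T [Z [uu ->]]]]]; exists N, u, (S *m T), (Z *m S'); split=> //.
by rewrite !smxM !mulmxA.
Qed.

Lemma unitary_factor_all m n (c : 'M[H]_(m, n)) :
  (forall h : H, lspan (@irrep_coefficient R H) h) -> unitary_factor c.
Proof.
move=> spanned.
have scalar_case (h : H) : unitary_factor (h%:M : 'M_1).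
  have [s [sG ->]] := spanned h; rewrite big_seq.
  elim/big_ind: _ => [|x y Dx Dy|p /sG [k [u [uu _ [i [j ->]]]]]].
  - by rewrite raddf0; exact: unitary_factor0.
  - by rewrite raddfD; exact: unitary_factorD.
  - exists k, u, (p.1 *: delta_mx 0 i), (delta_mx j 0); split=> //.
    apply/matrixP => a b; rewrite !ord1 mulmx_smxE mxE eqxx mulr1n (bigD1 j) //=.
    rewrite mxE !eqxx scale1r big1 => [|l lj]; last by rewrite mxE (negbTE lj) scale0r.
    rewrite addr0 mul_smxE (bigD1 i) //= !mxE !eqxx mulr1 big1 ?addr0 // => l li.
    by rewrite !mxE eqxx (negbTE li) mulr0 scale0r.
rewrite (_ : c = \sum_i \sum_j smx H (delta_mx i 0) *m (c i j)%:M *m smx H (delta_mx 0 j :> 'M_(1, n))).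
  elim/big_ind: _ => [||i _]; [exact: unitary_factor0|exact: unitary_factorD|].
  elim/big_ind: _ => [||j _]; [exact: unitary_factor0|exact: unitary_factorD|].
  exact: unitary_factor_smx.
rewrite {1}[c]matrix_sum_delta; apply: eq_bigr => i _; apply: eq_bigr => j _.
apply/matrixP => a b; rewrite mulmx_smxE big_ord1 mul_smxE big_ord1 !mxE !eqxx mulr1n /=.
by rewrite andbT scalerA -natrM mulnb andbC; case: andb; rewrite ?scale1r ?mulr1 ?scale0r ?mulr0.
Qed.

(** Write [c = T u Z] with [u] unitary. The rows [x] with [x u Z = x Z c] form a
   subcomodule [U] of [u], which contains the rows of [T] since [T Z = counit(c) = 1]. Let
   [P] be the orthogonal projection on [U]: then [P u P = P u], and by unitarity [P]
   commutes with [u]. Thus [Y = P Z] satisfies [u Y = Y c] and [T Y = 1], so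
   [c] is a summand of [u] and inherits an invariant form: for the conjugate transpose [Y^t],
   [G = Y^t Y] is invertible with [c^t G c = G], and [Q] is the inverse of [G] because [c] is
   invertible. *)
Theorem corep_hermitian_form k (c : 'M[H]_k) :
  (forall h : H, lspan (@irrep_coefficient R H) h) -> matrix_corep c ->
  exists2 Q : 'M[C]_k, Q \in unitmx & c *m smx H Q *m dagger c = smx H Q.
Proof.
move=> spanned cc; have [cD ce] := cc.
have [N [u [T [Z [[uc uu uu'] cE]]]]] := unitary_factor_all c spanned.
have [uD ue] := uc.
have counit_mx n (v : 'M[H]_n) : matrix_corep v -> map_mx counit v = 1%:M.
  by move=> [_ ve]; apply/matrixP => i j; rewrite !mxE ve.
have TZ : T *m Z = 1%:M.
  have := congr1 (map_mx counit) cE.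
  rewrite (map_mulmx_smx (@counit_scalar _ H)) (map_mul_smx (@counit_scalar _ H)).
  by rewrite !counit_mx // mulmx1.
pose U := [set x : 'rV[C]_N | smx H x *m u *m smx H Z = smx H (x *m Z) *m c].
have lU : linear_set U.
  move=> d x y Ux Uy; rewrite /U /=.
  have sZ m (z w : 'rV[C]_m) : smx H (d *: z + w) = smx H (d%:M) *m smx H z + smx H w.
    by rewrite -smxM /smx -map_mxD mul_scalar_mx.
  by rewrite mulmxDl -scalemxAl !sZ !mulmxDl -!(mulmxA (smx H d%:M)) Ux Uy.
have U0 : U 0 by rewrite /U /= mul0mx /smx !map_mx0 !mul0mx.
have Uf f x : scalar f -> U x -> U (x *m map_mx f u).
  move=> sf Ux.
  have fx : x *m map_mx f u *m Z = x *m Z *m map_mx f c.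
    by rewrite -!map_mul_smx // -map_mulmx_smx // Ux.
  rewrite /U /= fx; apply/matrixP => i j; rewrite !ord1.
  rewrite -contract_row // -Ux !mulmx_smxE.
  have lc := contract_linear sf.
  rewrite (big_morph _ (linD lc) (lin0 lc)); apply: eq_bigr => l _.
  by rewrite (linZ lc) contract_row.
have [P [Pct PU UP]] := orthogonal_projector lU U0.
have PuP : smx H P *m u *m smx H P = smx H P *m u.
  apply: mx_functional_ext => f sf; rewrite map_mulmx_smx // map_mul_smx //.
  by apply: eq_mx_rV => x; rewrite !mulmxA UP //; exact: Uf.
have duE : map_mx antipode u = dagger u.
  by rewrite -[LHS]mulmx1 -uu mulmxA corep_antipodel // mul1mx.
(* The antipode sends u to its adjoint, and PuP = Pu to the second half of what the
   adjoint of PuP = Pu asserts. *)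
have PduP : smx H P *m dagger u *m smx H P = smx H P *m dagger u.
  have := congr1 (map_mx antipode) PuP.
  rewrite (linear_map_mulmx_smx (@antipode_linear _ H)).
  by rewrite !(linear_map_mul_smx (@antipode_linear _ H)) duE.
have Pdu : smx H P *m dagger u = dagger u *m smx H P.
  by have := congr1 (fun v => dagger v) PuP; rewrite !daggerM !dagger_smx Pct mulmxA PduP.
have Pu : u *m smx H P = smx H P *m u.
  rewrite -[RHS]mul1mx -uu -(mulmxA u) (mulmxA (dagger u)) -Pdu.
  by rewrite -(mulmxA _ (dagger u)) uu' mulmx1.
have PuZ : smx H P *m u *m smx H Z = smx H (P *m Z) *m c.
  apply/row_matrixP => i; have := PU (delta_mx 0 i).
  rewrite /U /= !smxM !row_mul.
  have -> : smx H (delta_mx 0 i) *m smx H P = row i (smx H P).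
    by rewrite rowE; congr (_ *m _); apply/matrixP => a b; rewrite !mxE rmorph_nat.
  by [].
pose Y := P *m Z.
have uY : u *m smx H Y = smx H Y *m c by rewrite -PuZ -Pu smxM mulmxA.
have TP : T *m P = T.
  apply/row_matrixP => i; rewrite rowE mulmxA UP -?rowE // /U /=.
  by rewrite rowE -(mulmxA _ T) TZ mulmx1 smxM -!(mulmxA (smx H (delta_mx 0 i))) -cE.
have TY : T *m Y = 1%:M by rewrite mulmxA TP TZ.
have fY : row_free (ct Y) by apply/row_freeP; exists (ct T); rewrite -ctM TY ct1.
have uG := gram_unit fY; rewrite ctK in uG.
pose G := ct Y *m Y; rewrite -/G in uG.
have cG : dagger c *m smx H G *m c = smx H G.
  rewrite smxM -dagger_smx mulmxA -daggerM -mulmxA -uY daggerM.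
  by rewrite -mulmxA (mulmxA (dagger u)) uu' mul1mx dagger_smx smxM.
exists (invmx G); first by rewrite unitmx_inv.
have ScE : map_mx antipode c = smx H (invmx G) *m dagger c *m smx H G.
  rewrite -[LHS]mul1mx -smx1 -(mulVmx uG) smxM -[in LHS]cG -!mulmxA.
  by rewrite corep_antipoder // mulmx1.
have := corep_antipoder cc; rewrite ScE !mulmxA => /(congr1 (fun v => v *m smx H (invmx G))).
by rewrite mul1mx -!mulmxA -smxM mulmxV // smx1 mulmx1.
Qed.
End UnitaryFactorisation.

(** * Bases and coefficients of comodules *)

Section Bases.
Variable K : fieldType.

Definition is_basis (V : lmodType K) r (e : 'I_r -> V) (x : V -> 'rV[K]_r) : Prop :=
  [/\ linear x, forall v, v = \sum_i x v 0 i *: e i & forall i, x (e i) = delta_mx 0 i].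

(** The family gives a surjection [phi] from row vectors, with section [g]; the images of
   a row basis of the idempotent [g phi] form a basis. *)
Lemma spanned_basis (V : lmodType K) n (v : 'I_n -> V) :
  (forall w, exists a : 'rV[K]_n, w = \sum_i a 0 i *: v i) ->
  exists r (e : 'I_r -> V) (x : V -> 'rV[K]_r), is_basis e x.
Proof.
move=> vspan; pose phi (a : 'rV[K]_n) := \sum_i a 0 i *: v i.
have lphi : linear phi.
  move=> c a b; rewrite /phi scaler_sumr -big_split; apply: eq_bigr => i _ /=.
  by rewrite !mxE scalerDl scalerA.
have [g [lg pgp]] := generalized_inverse lphi.
have pg w : phi (g w) = w by have [a ->] := vspan w; exact: pgp.
have lgp : linear (fun a => g (phi a)) by lin.
have [Q eQ] := linear_rV_mx lgp.
have QQ : Q *m Q = Q by apply: eq_mx_rV => a; rewrite mulmxA -!eQ pg.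
have [W [fW eW]] : exists W : 'M_(\rank Q, n), row_free W /\ (W :=: Q)%MS.
  by exists (row_base Q); split; [exact: row_base_free|exact: eq_row_base].
exists (\rank Q), (fun i => phi (row i W)), (fun w => g w *m pinvmx W); split.
- by move=> c a b; rewrite lg mulmxDl scalemxAl.
- move=> w; rewrite -{1}(pg w).
  have gW : (g w <= W)%MS by rewrite eW -[g w](congr1 g (pg w)) eQ submxMl.
  rewrite -{1}(mulmxKpV gW) mulmx_sum_row (big_morph phi (linD lphi) (lin0 lphi)).
  by apply: eq_bigr => i _; rewrite (linZ lphi).
- move=> i; rewrite eQ.
  have -> : row i W *m Q = row i W.
    by have /submxP[y ->] : (row i W <= Q)%MS by [rewrite -eW row_sub]; rewrite -mulmxA QQ.
  by rewrite rowE -mulmxA mulmxVp // mulmx1.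
Qed.
End Bases.

Lemma basis_coord_linear (K : fieldType) (V : lmodType K) r (x : V -> 'rV[K]_r) j :
  linear x -> scalar (fun v => x v 0 j).
Proof. by move=> lx c v w; rewrite lx !mxE. Qed.

Lemma tlift_funsum (K : fieldType) (U V : lmodType K) (W : lmodType K) (I : finType)
    (f : U -> V -> W) (u : I -> U) (v : I -> V) : bilin f ->
  tlift f (\sum_i tens (u i) (v i)) = \sum_i f (u i) (v i).
Proof.
move=> bf; have bb := bilin_balanced bf.
rewrite (big_morph _ (tlift_add bb) (tlift_zero bb)).
by apply: eq_bigr => i _; rewrite tlift_tens.
Qed.

Section Coefficients.
Variable R : realType.
Local Notation C := R[i].
Variables (H : hopfStarAlg R) (V : comod H) (r : nat) (e : 'I_r -> V) (x : V -> 'rV[C]_r).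
Hypothesis ex : is_basis e x.

Definition coefs : 'M[H]_r :=
  \matrix_(i, j) tlift (fun k w => x w 0 j *: k) (coact (e i)).

Let lx : linear x. Proof. by case: ex. Qed.
Let sx j : scalar (fun v => x v 0 j). Proof. exact: basis_coord_linear. Qed.
Let ld : linear (coact (c := V)). Proof. by case: (coactP V). Qed.

Lemma coefs_coord v j :
  tlift (fun k w => x w 0 j *: k) (coact v) = (smx H (x v) *m coefs) 0 j.
Proof.
have [_ vE _] := ex; have sxj := sx j.
have lf : linear (fun v => tlift (fun k w => x w 0 j *: k) (coact v)) by lin.
rewrite {1}[v]vE (big_morph _ (linD lf) (lin0 lf)) mul_smxE.
by apply: eq_bigr => i _; rewrite (linZ lf) mxE.
Qed.

Lemma coact_coefs i : coact (e i) = \sum_j tens (coefs i j) (e j).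
Proof.
have [_ vE _] := ex.
transitivity (tlift (fun k w => \sum_j tens (x w 0 j *: k) (e j)) (coact (e i))).
  rewrite -{1}[coact _]tlift_tensE; apply: eq_tlift => k w.
  rewrite {1}[w]vE (big_morph _ (linD (_ : linear (tens k))) (lin0 (_ : linear (tens k)))); try by lin.
  by apply: eq_bigr => j _; rewrite tensZr tensZl.
rewrite tlift_sum; apply: eq_bigr => j _.
by rewrite mxE (tlift_lin (phi := fun y => tens y (e j))) //; lin.
Qed.

Lemma coefs_corep : matrix_corep coefs.
Proof.
have [_ vE xe] := ex; have cP := coactP V.
split=> i j; have sxj := sx j; last first.
  rewrite mxE (tlift_morph _ _ (scaD (@counit_scalar _ H))).
  have lc : linear (fun v => x v 0 j : C^o) by exact: sxj.
  have := coact_counit (e i) cP lc; rewrite xe mxE eqxx /= eq_sym => <-.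
  by apply: eq_tlift => k w; rewrite counitZ mulrC.
transitivity (tlift (fun a w => tlift (fun a1 a2 => tens a1 (x w 0 j *: a2)) (comul a)) (coact (e i))).
  rewrite mxE (tlift_lin (phi := comul)); last by lin.
  apply: eq_tlift => a w; rewrite (linZ (@comul_linear _ H)) -{1}[comul a]tlift_tensE.
  rewrite (tlift_lin (phi := fun y => x w 0 j *: y)); last by lin.
  by apply: eq_tlift => a1 a2; rewrite tensZr.
rewrite (coact_sum (f := fun a1 a2 w => tens a1 (x w 0 j *: a2))) //; last by split; lin.
rewrite coact_coefs tlift_funsum; last by lin.
apply: eq_bigr => k _; rewrite -(tlift_lin (phi := tens (coefs i k))); last by lin.
by rewrite coefs_coord xe smx_delta_mul.
Qed.
End Coefficients.

(** * The conditional expectation of A onto B *)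

Lemma hs_map_linear R (A H : hopfStarAlg R) (p : hopfStarEpi A H) : linear p.
Proof. by case: (hs_map_alg p). Qed.
Lemma hs_mapM R (A H : hopfStarAlg R) (p : hopfStarEpi A H) : {morph p : x y / x * y}.
Proof. by case: (hs_map_alg p). Qed.
Lemma hs_map1 R (A H : hopfStarAlg R) (p : hopfStarEpi A H) : p 1 = 1.
Proof. by case: (hs_map_alg p). Qed.
Lemma coinv_val_linear R (A H : hopfStarAlg R) (p : hopfStarEpi A H) :
  linear (@coinv_val R A H p).
Proof. by []. Qed.
Lemma lact_bilin R (A H : hopfStarAlg R) (X : qhs A H) (M : covBimod X) :
  bilin (@lact _ _ _ _ M).
Proof. by case: (lactP M). Qed.
Lemma ract_bilin R (A H : hopfStarAlg R) (X : qhs A H) (M : covBimod X) :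
  bilin (@ract _ _ _ _ M).
Proof. by case: (ractP M). Qed.
Lemma cb_coact_linear R (A H : hopfStarAlg R) (X : qhs A H) (M : covBimod X) :
  linear (@cb_coact _ _ _ _ M).
Proof. by case: (cb_coactP M). Qed.
#[global] Hint Extern 0 (GRing.linear_for _ (@hs_map _ _ _ _)) => exact: hs_map_linear : lin.
#[global] Hint Extern 0 (GRing.linear_for _ (@coinv_val _ _ _ _)) => exact: coinv_val_linear : lin.
#[global] Hint Extern 0 (GRing.linear_for _ (@coinv_coact _ _ _ _)) => exact: coinv_coact_linear : lin.
#[global] Hint Extern 0 (bilin (@lact _ _ _ _ _)) => exact: lact_bilin : lin.
#[global] Hint Extern 0 (bilin (@ract _ _ _ _ _)) => exact: ract_bilin : lin.
#[global] Hint Extern 0 (GRing.linear_for _ (@cb_coact _ _ _ _ _)) => exact: cb_coact_linear : lin.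
#[global] Hint Extern 0 (GRing.linear_for _ (@fibre_proj _ _ _ _ _)) => exact: fibre_proj_linear : lin.

Section Expectation.
Variable R : realType.
Local Notation C := R[i].
Variables (A H : hopfStarAlg R) (X : qhs A H).
Local Notation B := (coinv X).
Implicit Types (W : lmodType C) (M : covBimod X).

Lemma coinv_coact_sum W (f : A -> A -> W) (b : B) : bilin f ->
  tlift (fun a (c : B) => f a c) (coinv_coact b) = tlift f (comul (b : A)).
Proof. by move=> bf; rewrite -coinv_coactE tlift_tmap //; lin. Qed.

Lemma coinv_sum W (f : A -> H -> W) (b : B) : bilin f ->
  tlift (fun a c => f a (X c)) (comul (b : A)) = f b 1.
Proof.
move=> bf; transitivity (tlift f (tmap id X (comul (b : A)))).
  by rewrite tlift_tmap //; lin.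
by rewrite coinvP tlift_tens //; lin.
Qed.

Lemma cb_coact_lact_sum M W (f : A -> M -> W) (b : B) (m : M) : bilin f ->
  tlift f (cb_coact (lact b m)) =
  tlift (fun b1 b2 => tlift (fun a n => f (b1 * a) (lact b2 n)) (cb_coact m)) (coinv_coact b).
Proof.
move=> bf; have [f1 f2] := bf; rewrite cb_coact_lact.
move: (coinv_coact b) => s; move: (cb_coact m) => t.
have bm := tmap2_bilin (mul_bilin A) (lact_bilin M).
move: s; apply: eq_linear_tens => [||u v]; [by lin|by lin|cbv beta].
rewrite [RHS]tlift_tens; last by lin.
move: t; apply: eq_linear_tens => [||u' v']; [by lin|by lin|cbv beta].
rewrite tmap2_tens ?tlift_tens //; by [exact: mul_bilin|exact: lact_bilin|lin].
Qed.

Lemma cb_coact_ract M (m : M) (b : B) :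
  cb_coact (ract m b) = tmap2 *%R (@ract _ _ _ _ M) (cb_coact m) (coinv_coact b).
Proof.
have [lb l1 _] := lactP M; rewrite -[in LHS](l1 m) cb_coact_cov coinv_coact1.
congr tmap2; have bm := tmap2_bilin (mul_bilin A) (lact_bilin M).
move: (cb_coact m); apply: eq_linear_tens => [||a n]; [by lin|by lin|cbv beta].
by rewrite tmap2_tens ?mul1r ?l1 //; exact: mul_bilin.
Qed.

Lemma cb_coact_ract_sum M W (f : A -> M -> W) (b : B) (m : M) : bilin f ->
  tlift f (cb_coact (ract m b)) =
  tlift (fun a n => tlift (fun b1 b2 => f (a * b1) (ract n b2)) (coinv_coact b)) (cb_coact m).
Proof.
move=> bf; have [f1 f2] := bf; rewrite cb_coact_ract.
move: (coinv_coact b) => s; move: (cb_coact m) => t.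
have bm := tmap2_bilin (mul_bilin A) (ract_bilin M).
move: t; apply: eq_linear_tens => [||u v]; [by lin|by lin|cbv beta].
rewrite [RHS]tlift_tens; last by lin.
move: s; apply: eq_linear_tens => [||u' v']; [by lin|by lin|cbv beta].
rewrite tmap2_tens ?tlift_tens //; by [exact: mul_bilin|exact: ract_bilin|lin].
Qed.

Variable h : H -> C.
Hypothesis hh : left_integral h.
Let sh : scalar h. Proof. by case: hh. Qed.
Let h1 : h 1 = 1. Proof. by case: hh. Qed.

Definition expect_val (a : A) : A := tlift (fun x y => h (X y) *: x) (comul a).

Lemma expect_val_linear : linear expect_val.
Proof. by rewrite /expect_val; have shX := sca_comp sh (hs_map_linear X); lin. Qed.

(** Invariance of the integral, read in the last leg of the coproduct. *)
Lemma expect_subproof a : expect_val a \in coinv_pred X.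
Proof.
rewrite unfold_in; apply/eqP.
have lt : linear (fun a => tmap id X (comul a)) by lin.
rewrite /expect_val (tlift_lin _ _ lt).
transitivity (tlift (fun s z => tlift (fun x y => h (X z) *: tens x (X y)) (comul s)) (comul a)).
  apply: eq_tlift => s z; rewrite (linZ lt) -{1}[comul s]tlift_tensE (tlift_lin (phi := tmap id X)); last by lin.
  rewrite (tlift_lin (phi := fun t => h (X z) *: t)); last by lin.
  by apply: eq_tlift => x y; rewrite tmap_tens //; lin.
have shX := sca_comp sh (hs_map_linear X).
rewrite (comul_sum (f := fun x y z => h (X z) *: tens x (X y))); last by split; lin.
rewrite (tlift_lin (phi := fun x => tens x 1)); last by lin.
apply: eq_tlift => x s; rewrite tensZl -tensZr.
have [_ _ hI] := hh; rewrite -(hI (X s)) hs_map_comul tlift_tmap //; try by lin.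
rewrite (tlift_lin (phi := tens x)); last by lin.
by apply: eq_tlift => y z; rewrite tensZr.
Qed.

(** The conditional expectation [a |-> a_1 h(pi(a_2))] of [A] onto [B]. *)
Definition expect (a : A) : B := Coinv (expect_subproof a).

Lemma expect_linear : linear expect.
Proof. by move=> c x y; apply: val_inj; exact: expect_val_linear. Qed.

Lemma expect1 : expect 1 = 1.
Proof.
have shX := sca_comp sh (hs_map_linear X).
apply: val_inj => /=; rewrite /expect_val comul1 tlift_tens; last by lin.
by rewrite hs_map1 h1 scale1r.
Qed.

Lemma expectM (a : A) (b : B) : expect (a * (b : A)) = expect a * b.
Proof.
have shX := sca_comp sh (hs_map_linear X).
apply: val_inj => /=; rewrite /expect_val comulM_sum; last by lin.
rewrite (tlift_lin (phi := fun x => x * (b : A))); last by lin.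
apply: eq_tlift => x y.
rewrite (eq_tlift (g := fun u v => h (X y * X v) *: (x * u))); last first.
  by move=> u v; rewrite hs_mapM.
have shm (z : H) : scalar (fun v => h (z * v)) by apply: sca_comp => //; lin.
rewrite (coinv_sum (f := fun u v => h (X y * v) *: (x * u))); last by lin.
by rewrite mulr1 scalerAl.
Qed.

Lemma coact_expect a : coinv_coact (expect a) = tmap id expect (comul a).
Proof.
have shX := sca_comp sh (hs_map_linear X); have le := expect_linear.
apply: coinv_tmap_inj; rewrite coinv_coactE /= /expect_val.
rewrite -[in RHS](tlift_tensE (comul a)).
rewrite (tlift_lin (phi := comul)); last by lin.
rewrite (tlift_lin (phi := fun t => tmap id (@coinv_val _ _ _ X) (tmap id expect t))); last by lin.
transitivity (tlift (fun s z => tlift (fun x y => h (X z) *: tens x y) (comul s)) (comul a)).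
  apply: eq_tlift => s z; rewrite (linZ (@comul_linear _ A)) -{1}[comul s]tlift_tensE.
  by rewrite (tlift_lin (phi := fun t => h (X z) *: t)) //; lin.
rewrite (comul_sum (f := fun x y z => h (X z) *: tens x y)); last by split; lin.
apply: eq_tlift => x s; rewrite !tmap_tens //= /expect_val; try by lin.
rewrite (tlift_lin (phi := tens x)); last by lin.
by apply: eq_tlift => y z; rewrite tensZr.
Qed.

(** The expectation produces [a_1 S(c_2) c_3 h(pi(a_2 S(c_1)))], where [S(c_2) c_3]
   cancels. This is how all expectations disappear from coordinates. *)
Lemma expect_antipode_sum (a c : A) :
  tlift (fun c1 c2 => (expect (a * antipode c1) : A) * c2) (comul c) =
  tlift (fun a1 a2 => h (X a2 * antipode (X c)) *: a1) (comul a).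
Proof.
have shm (z : H) : scalar (fun v => h (z * v)) by apply: sca_comp => //; lin.
have shm' (z : H) : scalar (fun v => h (v * z)) by apply: sca_comp => //; lin.
have smA (z : A) : scalar (fun v => h (X (z * antipode v))) by apply: sca_comp => //; lin.
have smA' (z : A) : scalar (fun v => h (X (v * z))) by apply: sca_comp => //; lin.
have shX := sca_comp sh (hs_map_linear X).
transitivity (tlift (fun a1 a2 => tlift (fun s z => tlift (fun x y =>
    h (X (a2 * antipode x)) *: (a1 * antipode y * z)) (comul s)) (comul c)) (comul a)).
  rewrite tlift_exchange; apply: eq_tlift => s z /=.
  rewrite /expect_val comulM_sum; last by lin.
  rewrite (tlift_lin (phi := fun w => w * z)); last by lin.
  apply: eq_tlift => a1 a2; rewrite comul_antipode.
  rewrite (tlift_lin (phi := fun t => tlift _ t * z)); last by lin.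
  by apply: eq_tlift => x y; rewrite tlift_tens -?scalerAl //; lin.
apply: eq_tlift => a1 a2.
rewrite (comul_sum (f := fun x y z => h (X (a2 * antipode x)) *: (a1 * antipode y * z))); last by split; lin.
rewrite -(counit_sumr (f := fun c => h (X a2 * antipode (X c)) *: a1) c); last first.
  have saX (z : H) : scalar (fun v : A => h (z * antipode (X v))) by apply: sca_comp => //; lin.
  by lin.
apply: eq_tlift => x y.
rewrite (eq_tlift (g := fun u v => h (X (a2 * antipode x)) *: (a1 * (antipode u * v)))); last first.
  by move=> u v; rewrite mulrA.
rewrite (antipode_suml (f := fun w => h (X (a2 * antipode x)) *: (a1 * w))); last by lin.
by rewrite mulr1 hs_mapM -epi_antipode.
Qed.
End Expectation.
Arguments expect {R A H X h} hh a.

(** * Coordinates on a covariant bimodule *)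

Section Coordinates.
Variable R : realType.
Local Notation C := R[i].
Variables (A H : hopfStarAlg R) (X : qhs A H) (M : covBimod X).
Local Notation B := (coinv X).
Implicit Types (W : lmodType C).
Variables (r : nat) (e : 'I_r -> Phi M) (x : Phi M -> 'rV[C]_r).
Hypothesis ex : is_basis e x.
Local Notation c := (coefs e x).

Let lx : linear x. Proof. by case: ex. Qed.

Definition fibre_coord (j : 'I_r) (m : M) : C := x (fibre_proj m) 0 j.

Lemma fibre_coord_scalar j : scalar (fibre_coord j).
Proof. by apply: (sca_comp (basis_coord_linear j lx)); lin. Qed.
Let sf := fibre_coord_scalar.

Lemma fibre_coord_lact j (b : B) m : fibre_coord j (lact b m) = counit (b : A) * fibre_coord j m.
Proof. by rewrite /fibre_coord fibre_proj_lact (linZ lx) mxE. Qed.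

Lemma fibre_coord_coact (m : M) j :
  tlift (fun a n => fibre_coord j n *: X a) (cb_coact m) = (smx H (x (fibre_proj m)) *m c) 0 j.
Proof.
have sj := basis_coord_linear j lx.
rewrite -coefs_coord // [coact _]fibre_coact_proj tlift_tmap //; by lin.
Qed.

(** The entries of [m |-> m_(-1) (x) [m_(0)]] in a basis of the fibre. Together they embed
   [M] in [A^r], compatibly with both actions, as the vectors that transform by the
   coefficients [c]. *)
Definition coord (j : 'I_r) (m : M) : A := tlift (fun a n => fibre_coord j n *: a) (cb_coact m).

Lemma coord_linear j : linear (coord j).
Proof. by have sj := sf j; rewrite /coord; lin. Qed.

Lemma coord_lact j (b : B) m : coord j (lact b m) = (b : A) * coord j m.
Proof.
have sj := sf j; rewrite /coord cb_coact_lact_sum; last by lin.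
transitivity (tlift (fun b1 (b2 : B) => counit (b2 : A) *: (b1 * coord j m)) (coinv_coact b)).
  apply: eq_tlift => b1 b2; rewrite /coord (tlift_lin (phi := fun w => counit (b2 : A) *: (b1 * w))); last by lin.
  by apply: eq_tlift => a n; rewrite fibre_coord_lact -scalerAr scalerA.
rewrite (coinv_coact_sum (f := fun b1 b2 => counit b2 *: (b1 * coord j m))); last by lin.
by rewrite (counit_sumr (f := fun b => b * coord j m)) //; lin.
Qed.

Lemma comul_coord j m : comul (coord j m) = tmap id (coord j) (cb_coact m).
Proof.
have sj := sf j; have lj := coord_linear j.
rewrite -[cb_coact m in RHS]tlift_tensE (tlift_lin (phi := tmap id (coord j))); last by lin.
rewrite {1}/coord (tlift_lin (phi := comul)); last by lin.
transitivity (tlift (fun a n => tlift (fun a1 a2 => fibre_coord j n *: tens a1 a2) (comul a)) (cb_coact m)).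
  apply: eq_tlift => a n; rewrite (linZ (@comul_linear _ A)) -{1}[comul a]tlift_tensE.
  by rewrite (tlift_lin (phi := fun t => fibre_coord j n *: t)) //; lin.
rewrite (coact_sum (f := fun a1 a2 n => fibre_coord j n *: tens a1 a2)) //; [|exact: cb_coactP|by split; lin].
apply: eq_tlift => a n; rewrite tmap_tens // /coord (tlift_lin (phi := tens a)); last by lin.
by apply: eq_tlift => a2 n'; rewrite tensZr.
Qed.

Lemma coord_coinv j m : tmap id X (comul (coord j m)) = \sum_i tens (coord i m) (c i j).
Proof.
have sj := sf j; have lj := coord_linear j; have lXj := comp_linear (hs_map_linear X) lj.
rewrite comul_coord tmap_comp //; try by lin.
rewrite -[cb_coact m in LHS]tlift_tensE (tlift_lin (phi := tmap _ _)); last first.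
  exact: tmap_linear.
transitivity (tlift (fun a n => \sum_i tens (fibre_coord i n *: a) (c i j)) (cb_coact m)).
  apply: eq_tlift => a n; rewrite tmap_tens //=.
  rewrite /coord (tlift_lin (phi := X)); last by lin.
  rewrite (eq_tlift (g := fun a n => fibre_coord j n *: X a)); last first.
    by move=> a' n'; rewrite (linZ (hs_map_linear X)).
  rewrite fibre_coord_coact mul_smxE.
  rewrite (big_morph (tens a) (linD (_ : linear (tens a))) (lin0 (_ : linear (tens a)))); try by lin.
  by apply: eq_bigr => i _; rewrite tensZr tensZl.
rewrite tlift_sum; apply: eq_bigr => i _.
by rewrite /coord (tlift_lin (phi := fun y => tens y (c i j))) //; lin.
Qed.

Hypothesis mod0 : in_mod0 M.

(** Since [M B^+ = B^+ M], the right action on the fibre is trivial, as the left one. *)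
Lemma fibre_proj_ract (m : M) (b : B) : fibre_proj (ract m b) = counit (b : A) *: fibre_proj m.
Proof.
have [rb r1 _] := ractP M.
apply/eqP; rewrite -subr_eq0 -(linZ (@fibre_proj_linear _ _ _ X M)) -(linB (@fibre_proj_linear _ _ _ X M)); apply/eqP.
apply/lproj_eq0; rewrite -mod0.2; apply: lspan_gen; exists m, (b - counit (b : A) *: 1); split.
  have : counit ((b : A) - counit (b : A) *: 1) = 0.
    by rewrite -scaleNr addrC counit_scalar counit1 mulr1 addNr.
  by [].
have /= -> := linB (rb.2 m) b (counit (b : A) *: 1).
by rewrite (bilinZr _ _ _ rb) r1.
Qed.

Lemma coord_ract j (b : B) m : coord j (ract m b) = coord j m * (b : A).
Proof.
have sj := sf j; rewrite /coord cb_coact_ract_sum; last by lin.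
rewrite (tlift_lin (phi := fun w => w * (b : A))); last by lin.
apply: eq_tlift => a n.
rewrite (eq_tlift (g := fun b1 (b2 : B) => counit (b2 : A) *: (fibre_coord j n *: (a * b1)))); last first.
  by move=> b1 b2; rewrite /fibre_coord fibre_proj_ract (linZ lx) mxE scalerA.
rewrite (coinv_coact_sum (f := fun b1 b2 => counit b2 *: (fibre_coord j n *: (a * b1)))); last by lin.
by rewrite (counit_sumr (f := fun b => fibre_coord j n *: (a * b))) ?scalerAl //; lin.
Qed.

Variable h : H -> C.
Hypothesis hh : left_integral h.
Let sh : scalar h. Proof. by case: hh. Qed.
Let h1 : h 1 = 1. Proof. by case: hh. Qed.

Local Notation E := (@expect R A H X h hh).

(** The inverse of the embedding, as a map on [A (x) M]. *)
Definition theta (a : A) (n : M) : M :=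
  tlift (fun d n0 => lact (E (a * antipode d)) n0) (cb_coact n).

Lemma theta_bilin : bilin theta.
Proof. by have le := expect_linear X hh; rewrite /theta; lin. Qed.

(** In [S(b_1 n_(-1)) b_2 = S(n_(-1)) S(b_1) b_2] the legs of [b] cancel once [b_2] is
   moved inside the expectation. *)
Lemma theta_lact a (b : B) n : theta a (lact b n) = counit (b : A) *: theta a n.
Proof.
have le := expect_linear X hh.
rewrite /theta cb_coact_lact_sum; last by lin.
rewrite tlift_exchange (tlift_lin (phi := fun w => counit (b : A) *: w)); last by lin.
apply: eq_tlift => d n0.
rewrite (eq_tlift (g := fun (b1 : A) (b2 : B) =>
  lact (E (a * antipode d * (antipode b1 * (b2 : A)))) n0)); last first.
  move=> b1 b2; have [_ _ lA] := lactP M.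
  rewrite -lA; congr lact; by rewrite -expectM antipodeM !mulrA.
transitivity (tlift (fun b1 b2 : A => lact (E (a * antipode d * (antipode b1 * b2))) n0) (comul (b : A))).
  by rewrite -coinv_coact_sum //; lin.
rewrite (antipode_suml (f := fun w => lact (E (a * antipode d * w)) n0)); last by lin.
by rewrite mulr1.
Qed.

Variable l : 'I_r -> M.
Hypothesis lE : forall j, fibre_proj (l j) = e j.

Lemma theta_fibre a n : theta a n = \sum_j fibre_coord j n *: theta a (l j).
Proof.
have [tb1 tb2] := theta_bilin; have [_ vE _] := ex.
have lt : linear (theta a) := tb2 a.
have -> : \sum_j fibre_coord j n *: theta a (l j) = theta a (\sum_j fibre_coord j n *: l j).
  rewrite (big_morph _ (linD lt) (lin0 lt)); by apply: eq_bigr => j _; rewrite (linZ lt).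
apply/eqP; rewrite -subr_eq0 -(linB lt); apply/eqP.
have /lproj_eq0 : fibre_proj (n - \sum_j fibre_coord j n *: l j) = 0.
  rewrite (linB (@fibre_proj_linear _ _ _ X M)) {1}(vE (fibre_proj n)).
  rewrite (big_morph _ (linD (@fibre_proj_linear _ _ _ X M)) (lin0 (@fibre_proj_linear _ _ _ X M))).
  by apply/eqP; rewrite subr_eq0; apply/eqP/eq_bigr => j _;
    rewrite (linZ (@fibre_proj_linear _ _ _ X M)) lE.
move=> [s [hs ->]]; rewrite (big_morph _ (linD lt) (lin0 lt)) big_seq big1 // => p /hs[b [m [b0 pE]]].
by rewrite (linZ lt) pE theta_lact b0 scale0r scaler0.
Qed.

(** As [theta a n] only depends on the class of [n], the sum over the basis collapses to
   [E(m_(-2) S(m_(-1))) m_(0) = m]. *)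
Lemma theta_coord m : \sum_j theta (coord j m) (l j) = m.
Proof.
have le := expect_linear X hh; have tb := theta_bilin; have [tb1 tb2] := tb.
transitivity (tlift theta (cb_coact m)).
  rewrite (eq_tlift (fun a n => theta_fibre a n)) tlift_sum; apply: eq_bigr => j _.
  rewrite /coord (tlift_lin _ _ (tb1 (l j))).
  by apply: eq_tlift => a n; rewrite (linZ (tb1 _)).
rewrite /theta -(coact_sum (f := fun a d n => lact (E (a * antipode d)) n)) //; [|exact: cb_coactP|by split; lin].
rewrite -[RHS](coact_counit (f := id) m (cb_coactP M)); last by lin.
apply: eq_tlift => a n; have [_ l1 _] := lactP M.
by rewrite (antipode_sumr (f := fun w => lact (E w) n)) ?expect1 ?l1 //; lin.
Qed.

Lemma coord_inj m n : (forall j, coord j m = coord j n) -> m = n.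
Proof. by move=> mn; rewrite -(theta_coord m) -(theta_coord n); apply: eq_bigr => j _; rewrite mn. Qed.

Lemma coord_theta a n j : coord j (theta a n) =
  tlift (fun a1 a2 => h (X a2 * antipode ((smx H (x (fibre_proj n)) *m c) 0 j)) *: a1) (comul a).
Proof.
have sj := sf j; have lj := coord_linear j; have le := expect_linear X hh.
have shX (z : H) : scalar (fun v => h (X v * z)) by apply: sca_comp => //; lin.
have shX' (z : H) : scalar (fun v => h (z * antipode (X v))) by apply: sca_comp => //; lin.
have shX'' (z : H) : scalar (fun v => h (z * antipode v)) by apply: sca_comp => //; lin.
rewrite /theta (tlift_lin _ _ lj).
transitivity (tlift (fun d n0 => tlift (fun d' n1 => fibre_coord j n1 *: ((E (a * antipode d) : A) * d')) (cb_coact n0)) (cb_coact n)).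
  apply: eq_tlift => d n0; rewrite coord_lact /coord (tlift_lin (phi := fun w => (E (a * antipode d) : A) * w)); last by lin.
  by apply: eq_tlift => d' n1; rewrite scalerAr.
rewrite -(coact_sum (f := fun d d' n1 => fibre_coord j n1 *: ((E (a * antipode d) : A) * d'))) //; [|exact: cb_coactP|by split; lin].
transitivity (tlift (fun d n1 => tlift (fun a1 a2 => fibre_coord j n1 *: (h (X a2 * antipode (X d)) *: a1)) (comul a)) (cb_coact n)).
  apply: eq_tlift => d n1; rewrite -(tlift_lin (phi := fun w => fibre_coord j n1 *: w)); last by lin.
  by rewrite expect_antipode_sum (tlift_lin (phi := fun w => fibre_coord j n1 *: w)) //; lin.
rewrite tlift_exchange; apply: eq_tlift => a1 a2.
rewrite -fibre_coord_coact (tlift_lin (phi := fun w => h (X a2 * antipode w) *: a1)); last by lin.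
apply: eq_tlift => d n1.
by rewrite (linZ (@antipode_linear _ H)) -scalerAr (scaZ sh) scalerA.
Qed.

(** The coordinates of [theta a n] are [a_1 h(pi(a_2) S(c))]; covariance of [y] replaces
   [pi(a_2)] by a coefficient, and [c S(c) = 1]. *)
Lemma coord_surj (y : 'I_r -> A) :
  (forall j, tmap id X (comul (y j)) = \sum_i tens (y i) (c i j)) ->
  forall j, coord j (\sum_k theta (y k) (l k)) = y j.
Proof.
move=> yc j; have lj := coord_linear j; have [_ _ xe] := ex.
have shX (z : H) : scalar (fun v => h (v * z)) by apply: sca_comp => //; lin.
rewrite (big_morph _ (linD lj) (lin0 lj)).
transitivity (\sum_k \sum_i h (c i k * antipode (c k j)) *: y i).
  apply: eq_bigr => k _; rewrite coord_theta lE xe smx_delta_mul.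
  transitivity (tlift (fun a z => h (z * antipode (c k j)) *: a) (tmap id X (comul (y k)))).
    by rewrite tlift_tmap //; lin.
  by rewrite yc tlift_funsum //; lin.
rewrite exchange_big /= (bigD1 j) //= [X in _ + X]big1 ?addr0 => [|i ij];
  rewrite -scaler_suml -(sca_sumE sh).
  have /matrixP/(_ j j) := corep_antipoder (coefs_corep ex).
  rewrite mxE => /(congr1 h); rewrite mxE eqxx h1 => ch.
  rewrite -[RHS]scale1r -ch; congr (h _ *: _); by apply: eq_bigr => k _; congr (_ * _); rewrite [RHS]mxE.
have /matrixP/(_ i j) := corep_antipoder (coefs_corep ex).
rewrite mxE => /(congr1 h); rewrite mxE (negbTE ij) (sca0 sh) => ch.
rewrite -[RHS](scale0r (y i)) -ch; congr (h _ *: _); by apply: eq_bigr => k _; congr (_ * _); rewrite [RHS]mxE.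
Qed.
End Coordinates.

(** * Takeuchi's equivalence on automorphisms *)

Lemma inj_surj_bij (T U : Type) (f : T -> U) :
  injective f -> (forall y, exists z, f z = y) -> bijective f.
Proof.
move=> fI /choice[g gE]; exists g => // z; exact: fI.
Qed.

Section Takeuchi.
Variable R : realType.
Local Notation C := R[i].
Variables (A H : hopfStarAlg R) (X : qhs A H) (M : covBimod X).
Local Notation B := (coinv X).
Variables (h : H -> C) (hh : left_integral h).
Hypothesis mod0 : in_mod0 M.

Lemma fibre_basis : exists r (e : 'I_r -> Phi M) (x : Phi M -> 'rV[C]_r), is_basis e x.
Proof.
have [[n [g gM]] _] := mod0; have lp := @fibre_proj_linear _ _ _ X M.
apply: (spanned_basis (v := fun i => fibre_proj (g i))).
elim/lquot_ind => m; rewrite -/(fibre_proj m).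
have [b ->] := gM m; exists (\row_i counit (b i : A)).
rewrite (big_morph _ (linD lp) (lin0 lp)); apply: eq_bigr => i _.
by rewrite fibre_proj_lact mxE.
Qed.

Section Basis.
Variables (r : nat) (e : 'I_r -> Phi M) (x : Phi M -> 'rV[C]_r).
Hypothesis ex : is_basis e x.
Local Notation c := (coefs e x).
Local Notation coord := (coord x).
Let lx : linear x. Proof. by case: ex. Qed.

Lemma basis_coord_inj : injective x.
Proof.
move=> v w xvw; have [_ vE _] := ex; rewrite (vE v) (vE w).
by apply: eq_bigr => i _; rewrite xvw.
Qed.

Lemma counit_coord j m : counit (coord j m) = x (fibre_proj m) 0 j.
Proof.
have sj := fibre_coord_scalar ex j.
have lc : linear (fibre_coord x j : M -> C^o) by exact: sj.
rewrite (tlift_morph _ _ (scaD (@counit_scalar _ A))).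
rewrite -/(fibre_coord x j m) -(coact_counit m (cb_coactP M) lc).
by apply: eq_tlift => a n; rewrite counitZ mulrC.
Qed.

Lemma fibre_lift : exists l : 'I_r -> M, forall j, fibre_proj (l j) = e j.
Proof.
exists (fun j => repr (e j)) => j; exact: lproj_repr.
Qed.

Lemma comod_map_mx (phi : Phi M -> Phi M) : is_comod_map phi ->
  exists F : 'M[C]_r, (forall v, x (phi v) = x v *m F) /\ c *m smx H F = smx H F *m c.
Proof.
move=> [lphi cphi]; have [_ vE xe] := ex.
have lxp : linear (fun a : 'rV[C]_r => x (phi (\sum_i a 0 i *: e i))).
  move=> d a b; rewrite -lx -lphi; congr (x (phi _)).
  rewrite scaler_sumr -big_split; apply: eq_bigr => i _ /=.
  by rewrite !mxE scalerDl scalerA.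
have [F FE] := linear_rV_mx lxp; exists F.
have xF v : x (phi v) = x v *m F by rewrite -FE -vE.
split=> //; apply/matrixP => i j.
have sj k := basis_coord_linear k lx.
have lpj : scalar (fun v => x (phi v) 0 j) by apply: (sca_comp (sj j)); lin.
transitivity (tlift (fun k w => x w 0 j *: k) (coact (phi (e i)))).
  have sjj := sj j.
  rewrite cphi tlift_tmap //; last by lin.
  rewrite (coact_coefs ex) tlift_funsum; last by lin.
  rewrite mulmx_smxE; apply: eq_bigr => k _. by rewrite xF xe -rowE [row k F 0 j]mxE.
by rewrite (coefs_coord ex) xF xe smxM -mulmxA smx_delta_mul.
Qed.

(** In coordinates the lift is right multiplication by the matrix of [phi], which
   commutes with [c] and therefore preserves the image of the embedding. *)
Lemma comod_map_lift (phi : Phi M -> Phi M) : is_comod_map phi ->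
  exists f : M -> M, is_covbimod_map f /\ forall m, fibre_proj (f m) = phi (fibre_proj m).
Proof.
move=> cphi; have [F [xF cF]] := comod_map_mx cphi.
have [l lE] := fibre_lift.
have lc j := coord_linear ex j.
pose y m j := \sum_i F i j *: coord i m.
pose f m := \sum_k theta hh (y m k) (l k).
have yc m j : tmap id X (comul (y m j)) = \sum_i tens (y m i) (c i j).
  have lt : linear (fun a => tmap id X (comul a)) by lin.
  rewrite (big_morph _ (linD lt) (lin0 lt)).
  transitivity (\sum_p tens (coord p m) ((c *m smx H F) p j)).
    transitivity (\sum_i \sum_p F i j *: tens (coord p m) (c p i)).
      apply: eq_bigr => i _; rewrite (linZ lt) (coord_coinv ex) scaler_sumr.
      by [].
    rewrite exchange_big; apply: eq_bigr => p _ /=; rewrite mulmx_smxE.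
    rewrite (big_morph _ (tensDr _) (lin0 (_ : linear (tens (coord p m))))); try by lin.
    by apply: eq_bigr => i _; rewrite tensZr.
  rewrite cF.
  transitivity (\sum_p \sum_i F p i *: tens (coord p m) (c i j)).
    apply: eq_bigr => p _; rewrite mul_smxE.
    rewrite (big_morph _ (tensDr _) (lin0 (_ : linear (tens (coord p m))))); try by lin.
    by apply: eq_bigr => i _; rewrite tensZr.
  rewrite exchange_big; apply: eq_bigr => i _ /=.
  rewrite (big_morph (fun y => tens y (c i j)) (fun a b => tensDl a b _) (bilin0l _ (tens_bilin _ _))).
  by apply: eq_bigr => p _; rewrite tensZl.
have cf m j : coord j (f m) = y m j := coord_surj ex hh lE (yc m) j.
have cI := coord_inj ex hh lE.
exists f; split; last first.
  move=> m; apply: basis_coord_inj; apply/rowP => j.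
  rewrite -counit_coord cf xF mxE (sca_sumE (@counit_scalar _ A)).
  by apply: eq_bigr => i _; rewrite counitZ counit_coord mulrC.
have lf : linear f.
  move=> d m n; apply: cI => j; rewrite lc !cf /y scaler_sumr -big_split.
  by apply: eq_bigr => i _ /=; rewrite lc scalerDr !scalerA mulrC.
split=> //.
- move=> b m; apply: cI => j; rewrite (coord_lact ex) // !cf /y mulr_sumr.
  by apply: eq_bigr => i _; rewrite (coord_lact ex) // scalerAr.
- move=> m b; apply: cI => j; rewrite (coord_ract ex mod0) // !cf /y mulr_suml.
  by apply: eq_bigr => i _; rewrite (coord_ract ex mod0) // scalerAl.
move=> m.
(* An element z of A (x) M is determined by its images under id (x) coord j. *)
have zE (z : tensor A M) : z = \sum_j tmap id (fun n => theta hh (coord j n) (l j)) z.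
  have lt j : linear (fun n => theta hh (coord j n) (l j)).
    have lj := lc j; have tb := theta_bilin M hh; lin.
  move: z; apply: eq_linear_tens => [||a n]; [by lin|by lin|cbv beta].
  transitivity (tens a (\sum_j theta hh (coord j n) (l j))).
    by rewrite (theta_coord ex hh lE).
  rewrite (big_morph _ (tensDr _) (lin0 (_ : linear (tens a)))); try by lin.
  by apply: eq_bigr => j _; rewrite tmap_tens.
have zI (z z' : tensor A M) : (forall j, tmap id (coord j) z = tmap id (coord j) z') -> z = z'.
  move=> zz; rewrite (zE z) (zE z'); apply: eq_bigr => j _.
  have lt : linear (fun a => theta hh a (l j)) by case: (theta_bilin M hh).
  by rewrite -[RHS](tmap_comp (g' := fun a => theta hh a (l j)) (f' := id)) // -zz tmap_comp.
apply: zI => j; rewrite -(comul_coord ex) cf tmap_comp //.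
have -> : coord j \o f = fun n => y n j by apply/funext => n; exact: cf.
rewrite /y (big_morph _ (linD (@comul_linear _ A)) (lin0 (@comul_linear _ A))).
rewrite -[cb_coact m in RHS]tlift_tensE (tlift_lin (phi := tmap _ _)); last first.
  by apply: tmap_linear => //; lin.
transitivity (tlift (fun a n => \sum_i F i j *: tens a (coord i n)) (cb_coact m)).
  rewrite tlift_sum; apply: eq_bigr => i _; rewrite (linZ (@comul_linear _ A)) (comul_coord ex).
  rewrite -[cb_coact m in LHS]tlift_tensE (tlift_lin (phi := fun z => F i j *: tmap id (coord i) z)); last by lin.
  by apply: eq_tlift => a n; rewrite tmap_tens.
apply: eq_tlift => a n; rewrite tmap_tens //; last by lin.
rewrite (big_morph _ (tensDr _) (lin0 (_ : linear (tens (a : A))))); try by lin.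
by apply: eq_bigr => i _; rewrite tensZr.
Qed.

(** By colinearity the coordinates of [f m] only involve [f] modulo [B^+ M]. *)
Lemma covbimod_map_fibre (f g : M -> M) : is_covbimod_map f -> is_covbimod_map g ->
  (forall m, fibre_proj (f m) = fibre_proj (g m)) -> f = g.
Proof.
move=> [lf _ _ cf] [lg _ _ cg] fg; have [l lE] := fibre_lift.
apply/funext => m; apply: (coord_inj ex hh lE) => j.
have sj := fibre_coord_scalar ex j.
rewrite /coord cf cg !tlift_tmap //; try by lin.
by apply: eq_tlift => a n; rewrite /fibre_coord fg.
Qed.
End Basis.

Theorem Phi_aut_iso : is_group_iso (@Phi_aut R A H X M).
Proof.
have [r [e [x ex]]] := fibre_basis.
have E (u : bimodAut M) m : Phi_aut u (fibre_proj m) = fibre_proj (u m) := Phi_fun_proj (autfP u) m.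
split; last first.
  move=> f g; apply: autP; apply/funext; elim/lquot_ind=> m; rewrite -/(fibre_proj m).
  rewrite E; transitivity (Phi_aut f (Phi_aut g (fibre_proj m))) => //.
  by rewrite !E.
apply: inj_surj_bij => [f g fg|phi].
  apply: autP; apply: (covbimod_map_fibre ex (autfP f) (autfP g)).
  by move=> m; rewrite -!E fg.
have [f [cf fE]] := comod_map_lift ex (autfP phi).
have [g [cg gE]] := comod_map_lift ex (autfP (aut_inv phi)).
have fK : cancel f g.
  move=> m; have /(congr1 (@^~ m)) := covbimod_map_fibre ex (covbimod_map_comp cg cf) (covbimod_map_id M)
    (fun m => etrans (gE _) (etrans (congr1 _ (fE m)) (autK phi _))).
  by [].
have gK : cancel g f.
  move=> m; have /(congr1 (@^~ m)) := covbimod_map_fibre ex (covbimod_map_comp cf cg) (covbimod_map_id M)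
    (fun m => etrans (fE _) (etrans (congr1 _ (gE m)) (autVK phi _))).
  by [].
exists (@Aut _ (bimodAutPred M) f g cf fK gK).
apply: autP; apply/funext; elim/lquot_ind=> m; rewrite -/(fibre_proj m).
by rewrite E fE.
Qed.
End Takeuchi.

(** * The balanced square of a covariant bimodule *)

Section BalancedTensor.
Variable R : realType.
Local Notation C := R[i].
Variables (B : Type) (M N : lmodType C) (r : M -> B -> M) (l : B -> N -> N).
Local Notation T := (btens r l).
Implicit Types W : lmodType C.

(** Middle-linear maps, those that factor through the balanced tensor product. *)
Definition middle_linear W (f : M -> N -> W) : Prop :=
  bilin f /\ forall m b n, f (r m b) n = f m (l b n).

Lemma eq_blift (W : zmodType) (f g : M -> N -> W) :
  (forall m n, f m n = g m n) -> blift f =1 (blift g : T -> W).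
Proof. by move=> e t; exact: eq_tlift. Qed.

Lemma blift_lin W W' (phi : W -> W') (f : M -> N -> W) (t : T) :
  linear phi -> phi (blift f t) = blift (fun m n => phi (f m n)) t.
Proof. exact: tlift_lin. Qed.

Lemma blift_sum (W : zmodType) (I : finType) (f : I -> M -> N -> W) (t : T) :
  blift (fun u v => \sum_i f i u v) t = \sum_i blift (f i) t.
Proof. exact: tlift_sum. Qed.

Lemma middle_kernel W (f : M -> N -> W) : middle_linear f ->
  forall t, (exists m b n, t = tens (r m b) n - tens m (l b n)) -> tlift f t = 0.
Proof.
move=> [bf fb] t [m [b [n ->]]]; have bb := bilin_balanced bf.
by rewrite (linB (tlift_linear bf)) !tlift_tens // fb subrr.
Qed.

Lemma blift_bt W (f : M -> N -> W) m n : middle_linear f ->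
  blift f (bt r l m n) = f m n.
Proof.
move=> mf; have [bf _] := mf; have lf := tlift_linear bf.
by rewrite /blift /bt qlift_proj ?tlift_tens //; [exact: bilin_balanced|exact: middle_kernel].
Qed.

Lemma blift_linear W (f : M -> N -> W) : middle_linear f -> linear (blift f : T -> W).
Proof.
move=> mf; have [bf _] := mf; have lf := tlift_linear bf.
by apply: qlift_linear => //; exact: middle_kernel.
Qed.

Lemma bt_middle : middle_linear (bt r l).
Proof.
have lp := lproj_linear [set t : tensor M N | exists m b n, t = tens (r m b) n - tens m (l b n)].
split; first by split=> [n|m] c x y; rewrite /bt -lp; congr lproj;
  rewrite ?tensDl ?tensDr ?tensZl ?tensZr.
move=> m b n; apply/lprojP/lspan_gen; by exists m, b, n.
Qed.

Lemma bt_bilin : bilin (bt r l).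
Proof. by case: bt_middle. Qed.

Lemma blift_btE (t : T) : blift (bt r l) t = t.
Proof.
have lp := lproj_linear [set t : tensor M N | exists m b n, t = tens (r m b) n - tens m (l b n)].
by rewrite -[RHS]lproj_repr -[repr t in RHS]tlift_tensE (tlift_lin _ _ lp).
Qed.

Lemma eq_linear_bt W (f g : T -> W) : linear f -> linear g ->
  (forall m n, f (bt r l m n) = g (bt r l m n)) -> f =1 g.
Proof.
move=> lf lg e t; rewrite -(blift_btE t) (blift_lin _ _ lf) (blift_lin _ _ lg).
exact: eq_blift.
Qed.
End BalancedTensor.

#[global] Hint Extern 0 (bilin (@bt _ _ _ _ _ _)) => exact: bt_bilin : lin.

Section CovariantTensor.
Variable R : realType.
Local Notation C := R[i].
Variables (A H : hopfStarAlg R) (X : qhs A H) (M : covBimod X).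
Local Notation B := (coinv X).
Local Notation T := (btens (@ract _ _ _ _ M) (@lact _ _ _ _ M)).
Local Notation bt := (bt (@ract _ _ _ _ M) (@lact _ _ _ _ M)).
Implicit Types W : lmodType C.

Lemma bt_ractl m (b : B) n : bt (ract m b) n = bt m (lact b n).
Proof. by have [_] := bt_middle (@ract _ _ _ _ M) (@lact _ _ _ _ M). Qed.

Lemma lactM (b d : B) (m : M) : lact (b * d) m = lact b (lact d m).
Proof. by have [_ _] := lactP M. Qed.
Lemma ractM (m : M) (b d : B) : ract m (b * d) = ract (ract m b) d.
Proof. by have [_ _] := ractP M. Qed.
Lemma lact1 (m : M) : lact 1 m = m.
Proof. by have [_] := lactP M. Qed.

Lemma bmap_middle (f g : M -> M) : linear f -> linear g ->
  (forall m b, f (ract m b) = ract (f m) b) -> (forall b m, g (lact b m) = lact b (g m)) ->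
  middle_linear (@ract _ _ _ _ M) (@lact _ _ _ _ M) (fun m n => bt (f m) (g n)).
Proof. by move=> lf lg fr gl; split; [lin|move=> m b n; rewrite fr gl bt_ractl]. Qed.

Lemma bmap_bt (f g : M -> M) m n : linear f -> linear g ->
  (forall m b, f (ract m b) = ract (f m) b) -> (forall b m, g (lact b m) = lact b (g m)) ->
  bmap f g (bt m n) = bt (f m) (g n).
Proof. by move=> lf lg fr gl; apply: blift_bt; exact: bmap_middle. Qed.

Lemma bmap_linear (f g : M -> M) : linear f -> linear g ->
  (forall m b, f (ract m b) = ract (f m) b) -> (forall b m, g (lact b m) = lact b (g m)) ->
  linear (bmap f g : T -> T).
Proof. by move=> lf lg fr gl; apply: blift_linear; exact: bmap_middle. Qed.

Lemma bt_lact_bt b m n : bt_lact b (bt m n) = bt (lact b m) n.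
Proof. by apply: bmap_bt => //; [lin|move=> m' b'; rewrite lract]. Qed.
Lemma bt_ract_bt b m n : bt_ract (bt m n) b = bt m (ract n b).
Proof. by apply: bmap_bt => //; [lin|move=> m' b'; rewrite lract]. Qed.

Lemma bt_lact_linear b : linear (bt_lact b : T -> T).
Proof. by apply: bmap_linear => //; [lin|move=> m' b'; rewrite lract]. Qed.
Lemma bt_ract_linear b : linear (fun t : T => bt_ract t b).
Proof. by apply: bmap_linear => //; [lin|move=> m' b'; rewrite lract]. Qed.

Lemma bt_lact_bilin : bilin (fun b (t : T) => bt_lact b t).
Proof.
split; last exact: bt_lact_linear.
by move=> t; apply: (lin_tlift_fun (f := fun b m n => bt (lact b m) n)); lin.
Qed.

Lemma bt_coactE m n : tmap2 *%R bt (cb_coact m) (cb_coact n) =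
  tlift (fun a m0 => tlift (fun b n0 => tens (a * b) (bt m0 n0)) (cb_coact n)) (cb_coact m).
Proof. by []. Qed.

Lemma bt_coact_middle : middle_linear (@ract _ _ _ _ M) (@lact _ _ _ _ M)
  (fun m n => tmap2 *%R bt (cb_coact m) (cb_coact n)).
Proof.
have bb := tmap2_bilin (mul_bilin A) (bt_bilin (@ract _ _ _ _ M) (@lact _ _ _ _ M)).
split=> [|m b n]; first by lin.
rewrite !bt_coactE cb_coact_ract_sum; last by lin.
apply: eq_tlift => a m0; rewrite cb_coact_lact_sum; last by lin.
apply: eq_tlift => b1 b2; apply: eq_tlift => d n0.
by rewrite bt_ractl mulrA.
Qed.

Lemma bt_coact_bt m n : bt_coact (bt m n) =
  tlift (fun a m0 => tlift (fun b n0 => tens (a * b) (bt m0 n0)) (cb_coact n)) (cb_coact m).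
Proof. by rewrite -bt_coactE; apply: blift_bt; exact: bt_coact_middle. Qed.

Lemma bt_coact_linear : linear (@bt_coact _ _ _ _ M).
Proof. by apply: blift_linear; exact: bt_coact_middle. Qed.

Lemma bt_coact_lact (b : B) (t : T) : bt_coact (bt_lact b t) =
  tlift (fun b1 (b2 : B) => tlift (fun a u => tens (b1 * a) (bt_lact b2 u)) (bt_coact t))
    (coinv_coact b).
Proof.
have ll b' := bt_lact_linear b'; have lc := bt_coact_linear; have bl := bt_lact_bilin.
have bA (b1 : A) (b2 : B) : bilin (fun a (u : T) => tens (b1 * a) (bt_lact b2 u)) by lin.
move: t; apply: eq_linear_bt; [by lin|by lin|].
move=> m n; rewrite bt_lact_bt !bt_coact_bt cb_coact_lact_sum; last by lin.
apply: eq_tlift => b1 b2; rewrite (tlift_lin _ _ (tlift_linear (bA b1 b2))).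
apply: eq_tlift => a m0; rewrite (tlift_lin _ _ (tlift_linear (bA b1 b2))).
apply: eq_tlift => d n0; rewrite tlift_tens; last exact: bilin_balanced.
by rewrite bt_lact_bt mulrA.
Qed.

(** Coassociativity of the diagonal coaction [m_(-1) n_(-1) (x) (m_(0) (x) n_(0))]. *)
Lemma diag_coassoc W (F : A -> A -> M -> M -> W) m n :
  (forall v m n, linear (fun u => F u v m n)) -> (forall u m n, linear (fun v => F u v m n)) ->
  (forall u v n, linear (fun m => F u v m n)) -> (forall u v m, linear (F u v m)) ->
  tlift (fun a m0 => tlift (fun b n0 => tlift (fun a' m1 => tlift (fun b' n1 =>
    F (a * b) (a' * b') m1 n1) (cb_coact n0)) (cb_coact m0)) (cb_coact n)) (cb_coact m)
  = tlift (fun a m1 => tlift (fun b n1 => tlift (fun u v => F u v m1 n1) (comul (a * b)))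
      (cb_coact n)) (cb_coact m).
Proof.
move=> F1 F2 F3 F4.
transitivity (tlift (fun a m0 => tlift (fun a' m1 => tlift (fun b n0 =>
    tlift (fun b' n1 => F (a * b) (a' * b') m1 n1) (cb_coact n0)) (cb_coact n)) (cb_coact m0)) (cb_coact m)).
  by apply: eq_tlift => a m0; rewrite tlift_exchange.
rewrite -(coact_sum (f := fun a a' m1 => tlift (fun b n0 =>
    tlift (fun b' n1 => F (a * b) (a' * b') m1 n1) (cb_coact n0)) (cb_coact n))); [|exact: cb_coactP|by split; lin].
apply: eq_tlift => a m1.
transitivity (tlift (fun a1 a2 => tlift (fun b n1 => tlift (fun b1 b2 => F (a1 * b1) (a2 * b2) m1 n1) (comul b)) (cb_coact n)) (comul a)).
  apply: eq_tlift => a1 a2.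
  by rewrite -(coact_sum (f := fun b b' n1 => F (a1 * b) (a2 * b') m1 n1)) //; [exact: cb_coactP|split; lin].
rewrite tlift_exchange; apply: eq_tlift => b n1.
by rewrite comulM_sum //; split; lin.
Qed.
End CovariantTensor.

#[global] Hint Extern 0 (bilin (@bt_lact _ _ _ _ _)) => exact: bt_lact_bilin : lin.
#[global] Hint Extern 0 (GRing.linear_for _ (@bt_coact _ _ _ _ _)) => exact: bt_coact_linear : lin.

(** * The covariant metric of an invariant form *)

Section MetricOfForm.
Variable R : realType.
Local Notation C := R[i].
Variables (A H : hopfStarAlg R) (X : qhs A H) (M : covBimod X).
Local Notation B := (coinv X).
Local Notation T := (btens (@ract _ _ _ _ M) (@lact _ _ _ _ M)).
Local Notation bt := (bt (@ract _ _ _ _ M) (@lact _ _ _ _ M)).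
Local Notation middle_linear := (middle_linear (@ract _ _ _ _ M) (@lact _ _ _ _ M)).
Variables (h : H -> C) (hh : left_integral h).
Local Notation E := (@expect R A H X h hh).
Hypothesis mod0 : in_mod0 M.
Variables (r : nat) (e : 'I_r -> Phi M) (x : Phi M -> 'rV[C]_r).
Hypothesis ex : is_basis e x.
Local Notation c := (coefs e x).
Local Notation coord := (coord x).
Variables q gam : 'M[C]_r.
Hypothesis q_inv : forall k l, \sum_i \sum_j q i j *: (c k i * c l j) = q k l *: 1.
Hypothesis gam_inv : forall k l, \sum_i \sum_j gam i j *: (c i k * c j l) = gam k l *: 1.
Hypothesis q_gam : q *m gam = 1%:M.
Hypothesis gam_q : gam *m q = 1%:M.

Let sh : scalar h. Proof. by case: hh. Qed.
Let h1 : h 1 = 1. Proof. by case: hh. Qed.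
Let le := expect_linear X hh.
Let lc j := coord_linear ex j.

(** The form on the fibre defined by [q], extended to coordinate vectors in [A^r]. *)
Definition form_val (m n : M) : A := \sum_i \sum_j q i j *: (coord i m * coord j n).

(** The coordinates of [m] and [n] transform by [c], under which [q] is invariant. *)
Lemma form_coinv m n : form_val m n \in coinv_pred X.
Proof.
have lt : linear (fun a => tmap id X (comul a)) by lin.
have tM a b : tmap id X (comul (a * b)) = tmul (tmap id X (comul a)) (tmap id X (comul b)).
  by rewrite comulM (tmap_tmul (id_alg A) (hs_map_alg X)).
rewrite unfold_in; apply/eqP; rewrite /form_val.
transitivity (\sum_i \sum_j q i j *: \sum_k \sum_l tens (coord k m * coord l n) (c k i * c l j)).
  rewrite (big_morph _ (linD lt) (lin0 lt)); apply: eq_bigr => i _.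
  rewrite (big_morph _ (linD lt) (lin0 lt)); apply: eq_bigr => j _.
  rewrite (linZ lt) tM !(coord_coinv ex); congr (_ *: _).
  have bl (t : tensor A H) : linear (fun s => tmul s t) by case: (tmul_bilin A H).
  have br (s : tensor A H) : linear (tmul s) by case: (tmul_bilin A H).
  rewrite (big_morph _ (linD (bl _)) (lin0 (bl _))); apply: eq_bigr => k _.
  rewrite (big_morph _ (linD (br _)) (lin0 (br _))); apply: eq_bigr => l _.
  exact: tmul_tens.
transitivity (\sum_k \sum_l tens (coord k m * coord l n) (\sum_i \sum_j q i j *: (c k i * c l j))).
  have br (a : A) : linear (tens a : H -> _) by lin.
  under eq_bigr => i _ do under eq_bigr => j _ do rewrite scaler_sumr.
  under eq_bigr => i _ do rewrite exchange_big /=.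
  rewrite exchange_big; apply: eq_bigr => k _ /=.
  under eq_bigr => i _ do under eq_bigr => j _ do rewrite scaler_sumr.
  under eq_bigr => i _ do rewrite exchange_big /=.
  rewrite exchange_big; apply: eq_bigr => l _ /=.
  rewrite (big_morph _ (linD (br _)) (lin0 (br _))); apply: eq_bigr => i _.
  rewrite (big_morph _ (linD (br _)) (lin0 (br _))); apply: eq_bigr => j _.
  by rewrite (linZ (br _)).
have bl : linear (fun a : A => tens a (1 : H)) by lin.
rewrite (big_morph _ (linD bl) (lin0 bl)); apply: eq_bigr => k _.
rewrite (big_morph _ (linD bl) (lin0 bl)); apply: eq_bigr => l _.
by rewrite q_inv tensZr (linZ bl).
Qed.

Definition form (m n : M) : B := Coinv (form_coinv m n).

Lemma form_middle : middle_linear form.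
Proof.
have bf : bilin form_val by rewrite /form_val; lin.
split=> [|m b n].
  by split=> [n z a b|m z a b]; apply: val_inj; [exact: bf.1|exact: bf.2].
apply: val_inj; apply: eq_bigr => i _; apply: eq_bigr => j _.
by rewrite (coord_ract ex mod0) (coord_lact ex) mulrA.
Qed.

Definition form_pair : T -> B := blift form.

Lemma form_pair_linear : linear form_pair.
Proof. exact: blift_linear form_middle. Qed.

Lemma form_pair_bt m n : form_pair (bt m n) = form m n.
Proof. exact: blift_bt form_middle. Qed.

Lemma form_pair_lact b t : form_pair (bt_lact b t) = b * form_pair t.
Proof.
have lp := form_pair_linear; have ll := bt_lact_linear b.
move: t; apply: eq_linear_bt; [by lin|by lin|move=> m n].
rewrite bt_lact_bt !form_pair_bt; apply: val_inj => /=.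
rewrite /form_val mulr_sumr; apply: eq_bigr => i _; rewrite mulr_sumr; apply: eq_bigr => j _.
by rewrite (coord_lact ex) -scalerAr mulrA.
Qed.

Lemma form_pair_ract t b : form_pair (bt_ract t b) = form_pair t * b.
Proof.
have lp := form_pair_linear; have ll := bt_ract_linear b.
move: t; apply: eq_linear_bt; [by lin|by lin|move=> m n].
rewrite bt_ract_bt !form_pair_bt; apply: val_inj => /=.
rewrite /form_val mulr_suml; apply: eq_bigr => i _; rewrite mulr_suml; apply: eq_bigr => j _.
by rewrite (coord_ract ex mod0) -scalerAl mulrA.
Qed.

Lemma form_pair_coact t : coinv_coact (form_pair t) = tmap id form_pair (bt_coact t).
Proof.
have lp := form_pair_linear; have lb := @bt_coact_linear _ _ _ _ M.
move: t; apply: eq_linear_bt; [by lin|by lin|move=> m n].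
apply: coinv_tmap_inj; rewrite coinv_coactE form_pair_bt bt_coact_bt.
have lt : linear (fun t : tensor A T => tmap id (@coinv_val _ _ _ X) (tmap id form_pair t)) by lin.
rewrite (tlift_lin _ _ lt).
transitivity (tlift (fun a m0 => tlift (fun b n0 => \sum_i \sum_j q i j *:
    tens (a * b) (coord i m0 * coord j n0)) (cb_coact n)) (cb_coact m)); last first.
  apply: eq_tlift => a m0; rewrite (tlift_lin _ _ lt); apply: eq_tlift => b n0.
  rewrite !tmap_tens //= form_pair_bt /= /form_val.
  have br : linear (tens (a * b) : A -> _) by lin.
  rewrite (big_morph _ (linD br) (lin0 br)); apply: eq_bigr => i _.
  rewrite (big_morph _ (linD br) (lin0 br)); apply: eq_bigr => j _.
  by rewrite (linZ br).
rewrite /= /form_val (eq_tlift (fun a m0 => tlift_sum _ _)) tlift_sum.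
have lcm := @comul_linear _ A.
rewrite (big_morph _ (linD lcm) (lin0 lcm)); apply: eq_bigr => i _.
rewrite (eq_tlift (fun a m0 => tlift_sum _ _)) tlift_sum.
rewrite (big_morph _ (linD lcm) (lin0 lcm)); apply: eq_bigr => j _.
rewrite (linZ lcm) comulM !(comul_coord ex).
have lci := lc i; have lcj := lc j.
rewrite -[X in tmap id (coord i) X]tlift_tensE -[X in tmap id (coord j) X]tlift_tensE.
rewrite (tlift_lin (phi := fun s => q i j *: tmul (tmap id (coord i) s) _)); last by lin.
apply: eq_tlift => a m0.
rewrite (tlift_lin (phi := fun s => q i j *: tmul _ (tmap id (coord j) s))); last by lin.
by apply: eq_tlift => b n0; rewrite !tmap_tens // tmul_tens.
Qed.

(** [E(S(x_(-1))) x_(0)] for [x = m (x) n], which produces coinvariant elements of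
   [M (x)_B M] out of arbitrary lifts of elements of the tensor square of the fibre. *)
Definition average (m n : M) : T :=
  tlift (fun a m0 => tlift (fun b n0 => bt (lact (E (antipode (a * b))) m0) n0)
    (cb_coact n)) (cb_coact m).

(** [S(x_(-2)) x_(-1)] cancels in the coaction of [E(S(x_(-1))) x_(0)]. *)
Lemma average_coact m n : bt_coact (average m n) = tens 1 (average m n).
Proof.
have lb := @bt_coact_linear _ _ _ _ M; have ll := @bt_lact_linear _ _ _ _ M.
rewrite /average (tlift_lin _ _ lb).
pose F (u v : A) (m1 n1 : M) := tlift (fun y z =>
  tens (antipode z * v) (bt (lact (E (antipode y)) m1) n1)) (comul u).
transitivity (tlift (fun a m0 => tlift (fun b n0 => tlift (fun a' m1 => tlift (fun b' n1 =>
    F (a * b) (a' * b') m1 n1) (cb_coact n0)) (cb_coact m0)) (cb_coact n)) (cb_coact m)).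
  apply: eq_tlift => a m0; rewrite (tlift_lin _ _ lb); apply: eq_tlift => b n0.
  rewrite -bt_lact_bt bt_coact_lact coact_expect.
  rewrite (tlift_tmap (f := fun b1 (b2 : B) => tlift (fun a u => tens (b1 * a) (bt_lact b2 u)) (bt_coact (bt m0 n0)))) //; last by lin.
  rewrite comul_antipode.
  transitivity (tlift (fun y z => tlift (fun a u => tens (antipode z * a) (bt_lact (E (antipode y)) u)) (bt_coact (bt m0 n0))) (comul (a * b))).
    rewrite (tlift_lin (phi := tlift _)); last by apply: tlift_linear; lin.
    by apply: eq_tlift => y z; rewrite tlift_tens //; lin.
  rewrite /F.
  have bG (y z : A) : bilin (fun a (u : T) => tens (antipode z * a) (bt_lact (E (antipode y)) u)) by lin.
  transitivity (tlift (fun y z => tlift (fun a' m1 => tlift (fun b' n1 =>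
     tens (antipode z * (a' * b')) (bt (lact (E (antipode y)) m1) n1)) (cb_coact n0)) (cb_coact m0)) (comul (a * b))).
    apply: eq_tlift => y z; rewrite bt_coact_bt (tlift_lin _ _ (tlift_linear (bG y z))).
    apply: eq_tlift => a' m1; rewrite (tlift_lin _ _ (tlift_linear (bG y z))).
    apply: eq_tlift => b' n1; rewrite tlift_tens; last exact: bilin_balanced.
    by rewrite bt_lact_bt.
  rewrite tlift_exchange; apply: eq_tlift => a' m1; exact: tlift_exchange.
rewrite diag_coassoc; try by rewrite /F; lin.
rewrite (tlift_lin (phi := tens 1)); last by lin.
apply: eq_tlift => a m1; rewrite (tlift_lin (phi := tens 1)); last by lin.
apply: eq_tlift => b n1; rewrite /F.
rewrite (comul_sum (f := fun y z v => tens (antipode z * v) (bt (lact (E (antipode y)) m1) n1))); last by split; lin.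
rewrite -(counit_sumr (f := fun y => tens 1 (bt (lact (E (antipode y)) m1) n1)) (a * b)); last by lin.
apply: eq_tlift => y s.
by rewrite (antipode_suml (f := fun w => tens w (bt (lact (E (antipode y)) m1) n1))) //; lin.
Qed.

Lemma coord2_middle i j : middle_linear (fun m n => coord i m * coord j n).
Proof.
have lci := lc i; have lcj := lc j.
by split=> [|m b n]; [lin|rewrite (coord_ract ex mod0) (coord_lact ex) mulrA].
Qed.

Lemma average_coord2 i j m n : blift (fun m n => coord i m * coord j n) (average m n) =
  h (antipode ((smx H (x (fibre_proj m)) *m c) 0 i * (smx H (x (fibre_proj n)) *m c) 0 j)) *: 1.
Proof.
have lci := lc i; have lcj := lc j; have mij := coord2_middle i j.
have si := fibre_coord_scalar ex i; have sj := fibre_coord_scalar ex j.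
have lb := blift_linear mij.
pose F (u v : A) (m1 n1 : M) : A :=
  (fibre_coord x i m1 * fibre_coord x j n1) *: ((E (antipode u) : A) * v).
transitivity (tlift (fun a m0 => tlift (fun b n0 => tlift (fun a' m1 => tlift (fun b' n1 =>
    F (a * b) (a' * b') m1 n1) (cb_coact n0)) (cb_coact m0)) (cb_coact n)) (cb_coact m)).
  rewrite /average (tlift_lin _ _ lb); apply: eq_tlift => a m0.
  rewrite (tlift_lin _ _ lb); apply: eq_tlift => b n0; rewrite blift_bt //.
  rewrite (coord_lact ex) {1}/coord.
  rewrite (tlift_lin (phi := fun w => (E (antipode (a * b)) : A) * w * coord j n0)); last by lin.
  apply: eq_tlift => a' m1; rewrite /coord.
  rewrite (tlift_lin (phi := fun w => (E (antipode (a * b)) : A) * (fibre_coord x i m1 *: a') * w)); last by lin.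
  by apply: eq_tlift => b' n1; rewrite /F -!(scalerAr, scalerAl) scalerA mulrC -mulrA.
rewrite diag_coassoc; try by rewrite /F; lin.
pose L (w : H) : A := h (antipode w) *: 1.
have sha : scalar (fun w : H => h (antipode w)) by apply: sca_comp => //; lin.
have lL : linear L by rewrite /L; lin.
transitivity (tlift (fun a m1 => tlift (fun b n1 => L ((fibre_coord x i m1 *: X a) * (fibre_coord x j n1 *: X b))) (cb_coact n)) (cb_coact m)).
  apply: eq_tlift => a m1; apply: eq_tlift => b n1; rewrite /F.
  rewrite -(tlift_lin (phi := fun w => (fibre_coord x i m1 * fibre_coord x j n1) *: w)); last by lin.
  have := expect_antipode_sum X hh (1 : A) (a * b).
  rewrite (eq_tlift (g := fun u v => (E (antipode u) : A) * v)); last by move=> u v; rewrite mul1r.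
  have shX (z : H) : scalar (fun v => h (X v * z)) by apply: sca_comp => //; lin.
  move=> ->; rewrite comul1 tlift_tens; last by lin.
  rewrite hs_map1 mul1r hs_mapM -scalerAr -scalerAl scalerA !(linZ lL) /L !scalerA.
  by rewrite (mulrC (fibre_coord x i m1)).
rewrite -!(fibre_coord_coact ex).
have bb : bilin (fun w w' : H => L (w * w')) by lin.
rewrite -/(L _) (tlift_lin (phi := fun w => L (w * _))); last by case: bb => bb1 _; exact: bb1.
apply: eq_tlift => a m1; rewrite (tlift_lin (phi := fun w => L (_ * w))) //.
by case: bb => _ bb2; exact: bb2.
Qed.

Variable l : 'I_r -> M.
Hypothesis lE : forall j, fibre_proj (l j) = e j.

Definition form_dual : T := \sum_k \sum_p gam k p *: average (l k) (l p).

Lemma form_dual_coord2 i j : blift (fun m n => coord i m * coord j n) form_dual = gam i j *: 1.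
Proof.
have [_ _ xe] := ex; have lb := blift_linear (coord2_middle i j).
pose L (w : H) : A := h (antipode w) *: 1.
have sha : scalar (fun w : H => h (antipode w)) by apply: sca_comp => //; lin.
have lL : linear L by rewrite /L; lin.
transitivity (L (\sum_k \sum_p gam k p *: (c k i * c p j))).
  rewrite /form_dual (big_morph _ (linD lb) (lin0 lb)) (big_morph _ (linD lL) (lin0 lL)).
  apply: eq_bigr => k _; rewrite (big_morph _ (linD lb) (lin0 lb)) (big_morph _ (linD lL) (lin0 lL)).
  by apply: eq_bigr => p _; rewrite (linZ lb) average_coord2 !lE !xe !smx_delta_mul (linZ lL).
by rewrite gam_inv (linZ lL) /L antipode1 h1 scale1r.
Qed.

(** After the coordinates of the dual tensor are replaced by [gam], this is [q gam = 1]. *)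
Lemma form_dual_left w : blift (fun m n => lact (form_pair (bt w m)) n) form_dual = w.
Proof.
apply: (coord_inj ex hh lE) => j; have lcj := lc j.
rewrite (blift_lin _ _ lcj).
transitivity (blift (fun m n => \sum_k \sum_i q k i *: (coord k w * (coord i m * coord j n))) form_dual).
  apply: eq_blift => m n; rewrite (coord_lact ex) form_pair_bt /= /form_val mulr_suml.
  apply: eq_bigr => k _; rewrite mulr_suml; apply: eq_bigr => i _.
  by rewrite -scalerAl mulrA.
rewrite blift_sum; transitivity (\sum_k (q *m gam) k j *: coord k w); last first.
  rewrite q_gam (bigD1 j) //= mxE eqxx scale1r big1 ?addr0 // => k kj.
  by rewrite mxE (negbTE kj) scale0r.
apply: eq_bigr => k _; rewrite blift_sum mxE scaler_suml; apply: eq_bigr => i _.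
rewrite -(blift_lin (phi := fun w' => q k i *: (coord k w * w'))); last by lin.
by rewrite form_dual_coord2 -scalerAr mulr1 scalerA.
Qed.

Lemma form_dual_right w : blift (fun m n => ract m (form_pair (bt n w))) form_dual = w.
Proof.
apply: (coord_inj ex hh lE) => i; have lci := lc i.
rewrite (blift_lin _ _ lci).
transitivity (blift (fun m n => \sum_k \sum_p q k p *: (coord i m * coord k n * coord p w)) form_dual).
  apply: eq_blift => m n; rewrite (coord_ract ex mod0) form_pair_bt /= /form_val mulr_sumr.
  apply: eq_bigr => k _; rewrite mulr_sumr; apply: eq_bigr => p _.
  by rewrite -scalerAr mulrA.
rewrite blift_sum; transitivity (\sum_p (gam *m q) i p *: coord p w); last first.
  rewrite gam_q (bigD1 i) //= mxE eqxx scale1r big1 ?addr0 // => k ki.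
  by rewrite mxE eq_sym (negbTE ki) scale0r.
under [RHS]eq_bigr => p _ do rewrite mxE scaler_suml.
rewrite [RHS]exchange_big; apply: eq_bigr => k _ /=; rewrite blift_sum; apply: eq_bigr => p _.
rewrite -(blift_lin (phi := fun w' => q k p *: (w' * coord p w))); last by lin.
by rewrite form_dual_coord2 -scalerAl mul1r scalerA mulrC.
Qed.

Lemma form_dual_coact b : bt_coact (bt_lact b form_dual) =
  tmap id (fun c => bt_lact c form_dual) (coinv_coact b).
Proof.
have lb := @bt_coact_linear _ _ _ _ M.
have g1 : bt_coact form_dual = tens 1 form_dual.
  have l1 : linear (tens (1 : A) : T -> _) by lin.
  rewrite /form_dual (big_morph _ (linD lb) (lin0 lb)) (big_morph _ (linD l1) (lin0 l1)).
  apply: eq_bigr => k _; rewrite (big_morph _ (linD lb) (lin0 lb)) (big_morph _ (linD l1) (lin0 l1)).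
  by apply: eq_bigr => p _; rewrite (linZ lb) average_coact (linZ l1).
rewrite bt_coact_lact g1; apply: eq_tlift => b1 b2.
by rewrite tlift_tens ?mulr1 //; lin.
Qed.

Definition form_metric : covMetric M :=
  CovMetric form_pair_linear form_pair_lact form_pair_ract form_dual_left form_dual_right
    form_pair_coact form_dual_coact.
End MetricOfForm.

(** * Existence of a covariant metric *)

Section InvariantForm.
Variable R : realType.
Local Notation C := R[i].
Variable H : hopfStarAlg R.

Lemma trmx_mul_smx m n p (P : 'M[C]_(m, n)) (u : 'M[H]_(n, p)) :
  (smx H P *m u)^T = u^T *m smx H P^T.
Proof.
apply/matrixP => i j; rewrite mxE mul_smxE mulmx_smxE.
by apply: eq_bigr => k _; rewrite !mxE.
Qed.

Lemma trmx_mulmx_smx m n p (u : 'M[H]_(m, n)) (P : 'M[C]_(n, p)) :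
  (u *m smx H P)^T = smx H P^T *m u^T.
Proof.
apply/matrixP => i j; rewrite mxE mulmx_smxE mul_smxE.
by apply: eq_bigr => k _; rewrite !mxE.
Qed.

(** An invertible [J] intertwining [c] with its conjugate turns the invariant
    hermitian form into an invariant bilinear one, and the inverse of the latter is an
    invariant tensor. *)
Lemma invariant_bilinear_form r (c : 'M[H]_r) (J : 'M[C]_r) :
  (forall h : H, lspan (@irrep_coefficient R H) h) -> matrix_corep c ->
  J \in unitmx -> smx H J *m c = map_mx star c *m smx H J ->
  exists q gam : 'M[C]_r,
  [/\ q *m gam = 1%:M, gam *m q = 1%:M,
      forall k l, \sum_i \sum_j q i j *: (c k i * c l j) = q k l *: 1
    & forall k l, \sum_i \sum_j gam i j *: (c i k * c j l) = gam k l *: 1].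
Proof.
move=> spanned cc uJ Jc; have [Q uQ cQ] := corep_hermitian_form spanned cc.
pose q := Q *m (invmx J)^T.
have uq : q \in unitmx by rewrite unitmx_mul uQ unitmx_tr unitmx_inv.
have cq : c *m smx H q *m c^T = smx H q.
  have dc : dagger c = smx H (invmx J)^T *m c^T *m smx H J^T.
    rewrite -trmx_mulmx_smx -trmx_mul_smx /dagger; congr trmx.
    by rewrite mulmxA Jc -mulmxA -smxM mulmxV // smx1 mulmx1.
  rewrite smxM -[in RHS]cQ dc -!mulmxA -smxM -trmx_mul mulVmx // trmx1 smx1 mulmx1.
  by [].
have Sc : map_mx antipode c = smx H q *m c^T *m smx H (invmx q).
  rewrite -[RHS]mul1mx -(corep_antipodel cc) -!mulmxA.
  by rewrite (mulmxA c) (mulmxA (c *m _)) cq -smxM mulmxV // smx1 mulmx1.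
have cg : c^T *m smx H (invmx q) *m c = smx H (invmx q).
  have := corep_antipodel cc; rewrite Sc => /(congr1 (fun u => smx H (invmx q) *m u)).
  by rewrite !mulmxA -smxM mulVmx // smx1 mul1mx mulmx1.
exists q, (invmx q); split.
- by rewrite mulmxV.
- by rewrite mulVmx.
- move=> k l; transitivity ((c *m smx H q *m c^T) k l); last by rewrite cq mxE.
  rewrite [RHS]mxE exchange_big; apply: eq_bigr => j _ /=.
  by rewrite mulmx_smxE mulr_suml mxE; apply: eq_bigr => i _; rewrite -scalerAl.
- move=> k l; transitivity ((c^T *m smx H (invmx q) *m c) k l); last by rewrite cg mxE.
  rewrite [RHS]mxE exchange_big; apply: eq_bigr => j _ /=.
  by rewrite mulmx_smxE mulr_suml; apply: eq_bigr => i _; rewrite mxE -scalerAl.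
Qed.
End InvariantForm.

Section MetricExists.
Variable R : realType.
Local Notation C := R[i].
Variables (A H : hopfStarAlg R) (X : qhs A H) (cal : covStarCalculus X).
Local Notation B := (coinv X).
Local Notation M := (Om cal 1).

(** An element of degree 1 is a family that vanishes in the other degrees. *)
Lemma inc_inj : injective (@inc _ _ _ _ cal 1).
Proof.
move=> y z yz; apply/eqP; rewrite -subr_eq0; apply/eqP.
pose w : forall k, Om cal k := dfwith (fun k => 0 : Om cal k) (y - z).
have w1 : w 1%N = y - z by rewrite /w dfwith_in.
have w0 : w 0%N = 0 by rewrite /w dfwith_out.
rewrite -w1; apply: (inc_free (n := 2) (x := w)) => //.
have li k := @inc_linear _ _ _ _ cal k.
by rewrite !big_ord_recl big_ord0 /= w0 [w _]w1 (lin0 (li _)) (linB (li _)) yz subrr !addr0.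
Qed.

Lemma star_on_forms : exists J : M -> M,
  [/\ conj_linear J, involutive J,
      forall b m, J (lact b m) = ract (J m) (coinv_star b)
    & forall m, cb_coact (J m) = tstar star J (cb_coact m)].
Proof.
have /choice[J JE] := @tot_star_deg _ _ _ _ cal 1.
have li := @inc_linear _ _ _ _ cal 1.
have cs := @tot_star_conj _ _ _ _ cal.
have cJ : conj_linear J.
  by move=> z m n; apply: inc_inj; rewrite -JE !li cs !JE.
exists J; split=> //.
- by move=> m; apply: inc_inj; rewrite -!JE tot_starK.
- move=> b m; apply: inc_inj; rewrite -JE inc_lact (tot_star_mul (om0 cal b) m) mul0n scale1r.
  by rewrite tot_star_om0 JE inc_ract.
- move=> m; have iI := tmap_id_inj (U := A) li inc_inj; apply: iI.
  rewrite -tot_coact_inc -JE tot_coact_star tot_coact_inc.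
  have b1 := conj_linear_balanced (@star_conj _ A) cs.
  have b2 := conj_linear_balanced (@star_conj _ A) cJ.
  have lt : linear (tmap (@id A) (@inc _ _ _ _ cal 1)) by exact: tmap_linear.
  move: (cb_coact m); apply: tens_linear_ext => [y z|y z|a n].
  + by rewrite (linD lt) /tstar (tlift_add b1).
  + by rewrite /tstar (tlift_add b2) (linD lt).
  + by rewrite /tstar tmap_tens // !tlift_tens // tmap_tens // JE.
Qed.

Hypothesis spanned : forall h : H, lspan (@irrep_coefficient R H) h.
Hypothesis mod0 : in_mod0 M.

(** As [M B^+ = B^+ M], the star of one-forms descends to a conjugate-linear involution of
   the fibre. Its matrix [Jm] intertwines the coefficients with their conjugates, which
   makes the fibre self-dual. *)
Theorem covMetric_exists : inhabited (covMetric M).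
Proof.
have [h hh] := left_integral_exists spanned.
have [r [e [x ex]]] := fibre_basis mod0.
have [l lE] := fibre_lift e.
have [J [cJ JK Jl Jc]] := star_on_forms.
have [lx vE xe] := ex; have lp := @fibre_proj_linear _ _ _ X M.
have J0 n : fibre_proj n = 0 -> fibre_proj (J n) = 0.
  move=> /lproj_eq0[s [hs ->]]; rewrite (conj_lin_sum cJ) (big_morph _ (linD lp) (lin0 lp)).
  rewrite big_seq big1 // => p /hs[b [m [b0 pE]]].
  rewrite (conj_linZ cJ) (linZ lp) pE Jl (fibre_proj_ract mod0) /= counit_star.
  by rewrite [counit _]b0 rmorph0 scale0r scaler0.
pose Jm := \matrix_(i, j) fibre_coord x j (J (l i)).
have JmE n j : fibre_coord x j (J n) = \sum_k (fibre_coord x k n)^* * Jm k j.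
  have : fibre_proj (J (n - \sum_k fibre_coord x k n *: l k)) = 0.
    apply: J0; apply/eqP; rewrite (linB lp) subr_eq0; apply/eqP.
    rewrite {1}(vE (fibre_proj n)) (big_morph _ (linD lp) (lin0 lp)).
    by apply: eq_bigr => k _; rewrite (linZ lp) lE.
  rewrite -scaleN1r addrC cJ (conj_lin_sum cJ) (linD lp) (linZ lp).
  rewrite rmorphN rmorph1 scaleN1r addrC => /eqP; rewrite subr_eq0 => /eqP e1.
  rewrite /fibre_coord e1 (big_morph _ (linD lp) (lin0 lp)) (big_morph _ (linD lx) (lin0 lx)).
  rewrite summxE; apply: eq_bigr => k _.
  by rewrite (conj_linZ cJ) (linZ lp) (linZ lx) !mxE.
have xl i k : fibre_coord x k (l i) = (i == k)%:R.
  by rewrite /fibre_coord lE xe mxE eqxx eq_sym.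
have uJ : Jm \in unitmx.
  have e1 : map_mx Num.conj Jm *m Jm = 1%:M.
    apply/matrixP => i j; rewrite !mxE -xl -[in RHS](JK (l i)) JmE.
    by apply: eq_bigr => k _; rewrite !mxE.
  by case: (mulmx1_unit e1).
have cJm : smx H Jm *m coefs e x = map_mx star (coefs e x) *m smx H Jm.
  apply/matrixP => i j.
  transitivity (tlift (fun a n => fibre_coord x j n *: X a) (cb_coact (J (l i)))).
    rewrite (fibre_coord_coact ex) !mul_smxE; apply: eq_bigr => k _; congr (_ *: _).
    by rewrite mxE.
  rewrite mulmx_smxE Jc; have sj := fibre_coord_scalar ex j.
  rewrite (tlift_tstar _ (@star_conj _ A) cJ); last by lin.
  transitivity (tlift (fun a n => \sum_k Jm k j *: star (fibre_coord x k n *: X a)) (cb_coact (l i))).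
    apply: eq_tlift => a n; rewrite JmE scaler_suml; apply: eq_bigr => k _.
    by rewrite (conj_linZ (@star_conj _ H)) scalerA mulrC hs_map_star.
  rewrite tlift_sum; apply: eq_bigr => k _.
  have sD : {morph (fun w : H => Jm k j *: star w) : y z / y + z}.
    by move=> y z; rewrite (conj_linD (@star_conj _ H)) scalerDr.
  rewrite -(tlift_morph _ _ sD) (fibre_coord_coact ex) lE xe smx_delta_mul.
  by congr (_ *: _); rewrite [RHS]mxE.
have [q [gam [qg gq cq cg]]] := invariant_bilinear_form spanned (coefs_corep ex) uJ cJm.
exact: inhabits (form_metric hh mod0 ex cq cg qg gq lE).
Qed.
End MetricExists.

(** * The action of automorphisms on metrics *)

Section Translation.
Variable R : realType.
Local Notation C := R[i].
Variables (A H : hopfStarAlg R) (X : qhs A H) (M : covBimod X).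
Local Notation B := (coinv X).
Local Notation T := (btens (@ract _ _ _ _ M) (@lact _ _ _ _ M)).
Local Notation bt := (bt (@ract _ _ _ _ M) (@lact _ _ _ _ M)).
Local Notation middle_linear := (middle_linear (@ract _ _ _ _ M) (@lact _ _ _ _ M)).
Implicit Types u v : covMetric M.

Lemma met_bilin u : bilin (fun m n => met_pair u (bt m n)).
Proof. by have lp := met_pair_linear u; lin. Qed.

Lemma met_lact u b m n : met_pair u (bt (lact b m) n) = b * met_pair u (bt m n).
Proof. by rewrite -bt_lact_bt met_pair_lact. Qed.
Lemma met_ract u b m n : met_pair u (bt m (ract n b)) = met_pair u (bt m n) * b.
Proof. by rewrite -bt_ract_bt met_pair_ract. Qed.

Lemma met_left_middle u w : middle_linear (fun m n => lact (met_pair u (bt w m)) n).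
Proof.
have bp := met_bilin u; have [bp1 bp2] := bp.
by split=> [|m b n]; [lin|rewrite met_ract lactM].
Qed.

Lemma bt_coact_bmap (f g : M -> M) (t : T) : is_covbimod_map f -> is_covbimod_map g ->
  bt_coact (bmap f g t) = tmap id (bmap f g) (bt_coact t).
Proof.
move=> [lf fl fr fc] [lg gl gr gc]; have lb := bmap_linear lf lg fr gl.
have lc := @bt_coact_linear _ _ _ _ M.
move: t; apply: eq_linear_bt; [by lin|by lin|move=> m n].
rewrite bmap_bt // !bt_coact_bt fc gc tlift_tmap //; last by lin.
have lt : linear (tmap (@id A) (bmap f g : T -> T)) by lin.
rewrite (tlift_lin _ _ lt); apply: eq_tlift => a m0.
rewrite (tlift_lin _ _ lt) tlift_tmap //; last by lin.
by apply: eq_tlift => b n0; rewrite tmap_tens // bmap_bt.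
Qed.

Lemma met_g_coinv u : bt_coact (met_g u) = tens 1 (met_g u).
Proof.
have lact1_bt (t : T) : bt_lact 1 t = t.
  have l1 := bt_lact_linear (1 : B).
  by move: t; apply: eq_linear_bt => // m n; rewrite bt_lact_bt lact1.
rewrite -{1}[met_g u]lact1_bt met_g_coact coinv_coact1 tmap_tens ?lact1_bt //; by lin.
Qed.

Lemma met_nondegenerate u w w' :
  (forall y, met_pair u (bt w y) = met_pair u (bt w' y)) -> w = w'.
Proof.
move=> e; rewrite -(met_left u w) -(met_left u w').
by apply: eq_blift => m n; rewrite e.
Qed.

(** Two dual tensors [m (x) n] and [m' (x) n'] of the same form agree, since both are
   equal to [m (n, m') (x) n']. *)
Lemma covMetric_eq u v : met_pair u =1 met_pair v -> u = v.
Proof.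
move=> uv; have g_eq : met_g u = met_g v.
  rewrite -[LHS]blift_btE.
  transitivity (blift (fun m n => blift (fun m' n' => bt (ract m (met_pair u (bt n m'))) n') (met_g v)) (met_g u)).
    apply: eq_blift => m n; rewrite -{1}(met_left v n).
    have lb : linear (bt m) by lin.
    rewrite (blift_lin _ _ lb); apply: eq_blift => m' n'.
    by rewrite -uv bt_ractl.
  rewrite /blift /qlift tlift_exchange -[RHS]blift_btE; apply: eq_tlift => m' n'.
  have lb : linear (fun m => bt m n') by lin.
  rewrite -{2}(met_right u m').
  by rewrite (blift_lin _ _ lb).
have {}uv : met_pair u = met_pair v by apply/funext.
case: u v g_eq uv => gu pu a1 a2 a3 a4 a5 a6 a7 [gv pv b1 b2 b3 b4 b5 b6 b7] /= eg ep.
move: b1 b2 b3 b4 b5 b6 b7; rewrite -eg -ep => b1 b2 b3 b4 b5 b6 b7.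
by congr CovMetric; exact: Prop_irrelevance.
Qed.

Section Translate.
Variables (t : bimodAut M) (u : covMetric M).
Local Notation f := (autf t).
Local Notation g := (autf (t^-1)%g).
Let cf : is_covbimod_map f := autfP t.
Let cg : is_covbimod_map g := autfP (t^-1)%g.
Let fK : cancel f g := autK t.
Let gK : cancel g f := autVK t.
Let lbg : linear (bmap g id : T -> T).
Proof. by have [lg gl gr gc] := cg; apply: bmap_linear. Qed.
Let lbf : linear (bmap id f : T -> T).
Proof. by have [lf fl fr fc] := cf; apply: bmap_linear. Qed.

Definition translate_pair (z : T) : B := met_pair u (bmap g id z).
Definition translate_g : T := bmap id f (met_g u).

Lemma translate_pair_bt m n : translate_pair (bt m n) = met_pair u (bt (g m) n).
Proof. by have [lg gl gr gc] := cg; rewrite /translate_pair bmap_bt. Qed.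

Lemma translate_pair_linear : linear translate_pair.
Proof. have lp := met_pair_linear u; by rewrite /translate_pair; lin. Qed.

Lemma translate_pair_lact b z : translate_pair (bt_lact b z) = b * translate_pair z.
Proof.
have [lg gl gr gc] := cg; rewrite /translate_pair -met_pair_lact; congr met_pair.
have ll := @bt_lact_linear _ _ _ _ M b.
move: z; apply: eq_linear_bt; [by lin|by lin|move=> m n].
by rewrite bt_lact_bt !bmap_bt // bt_lact_bt gl.
Qed.

Lemma translate_pair_ract z b : translate_pair (bt_ract z b) = translate_pair z * b.
Proof.
have [lg gl gr gc] := cg; rewrite /translate_pair -met_pair_ract; congr met_pair.
have ll := @bt_ract_linear _ _ _ _ M b.
move: z; apply: eq_linear_bt; [by lin|by lin|move=> m n].
by rewrite bt_ract_bt !bmap_bt // bt_ract_bt.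
Qed.

Lemma blift_bmapr (F : M -> M -> M) : middle_linear F ->
  blift F (bmap id f (met_g u) : T) = blift (fun m n => F m (f n)) (met_g u).
Proof.
have [lf fl fr fc] := cf.
move=> mF; have lF := blift_linear mF; rewrite {1}/bmap (blift_lin _ _ lF).
by apply: eq_blift => m n; rewrite blift_bt.
Qed.

Lemma translate_left w : blift (fun m n => lact (translate_pair (bt w m)) n) translate_g = w.
Proof.
have [lf fl fr fc] := cf.
rewrite (eq_blift (g := fun m n => lact (met_pair u (bt (g w) m)) n)); last first.
  by move=> m n; rewrite translate_pair_bt.
rewrite blift_bmapr; last exact: met_left_middle.
rewrite -[RHS]gK -[g w in RHS](met_left u) (blift_lin _ _ lf).
by apply: eq_blift => m n; rewrite fl.
Qed.

Lemma translate_right w : blift (fun m n => ract m (translate_pair (bt n w))) translate_g = w.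
Proof.
have [lg gl gr gc] := cg; have lp := met_pair_linear u.
rewrite (eq_blift (g := fun m n => ract m (met_pair u (bt (g n) w)))); last first.
  by move=> m n; rewrite translate_pair_bt.
rewrite blift_bmapr; last first.
  split=> [|m b n]; last by rewrite gl met_lact ractM.
  by lin.
rewrite -[RHS](met_right u); apply: eq_blift => m n; by rewrite fK.
Qed.

Lemma translate_pair_coact z :
  coinv_coact (translate_pair z) = tmap id translate_pair (bt_coact z).
Proof.
have lp := met_pair_linear u.
rewrite met_pair_coact bt_coact_bmap //; last exact: covbimod_map_id.
by rewrite tmap_comp.
Qed.

Lemma translate_g_coact b : bt_coact (bt_lact b translate_g) =
  tmap id (fun d => bt_lact d translate_g) (coinv_coact b).
Proof.
have [lf fl fr fc] := cf; have bl := @bt_lact_bilin _ _ _ _ M.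
have comm (d : B) z : bt_lact d (bmap id f z) = bmap id f (bt_lact d z).
  have ll := @bt_lact_linear _ _ _ _ M d.
  move: z; apply: eq_linear_bt; [by lin|by lin|move=> m n].
  by rewrite bt_lact_bt !bmap_bt // bt_lact_bt.
rewrite /translate_g comm bt_coact_bmap //; last exact: covbimod_map_id.
have ll : linear (fun d : B => bt_lact d (met_g u)) by lin.
rewrite met_g_coact tmap_comp //; congr (tmap _ _ _).
by apply/funext => d /=; rewrite comm.
Qed.

Definition translate : covMetric M :=
  CovMetric translate_pair_linear translate_pair_lact translate_pair_ract
    translate_left translate_right translate_pair_coact translate_g_coact.
End Translate.

Lemma translateP t u : metric_translate t u (translate t u).
Proof. by []. Qed.

Lemma bmap1 (z : T) : bmap id id z = z.
Proof. exact: blift_btE. Qed.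

Lemma translate1 u : translate 1%g u = u.
Proof.
apply: covMetric_eq => z; rewrite /= /translate_pair.
by rewrite [bmap _ _ _]bmap1.
Qed.

Lemma translateM s t u : translate (s * t)%g u = translate s (translate t u).
Proof.
apply: covMetric_eq; apply: eq_linear_bt => [||m n]; try exact: met_pair_linear.
rewrite -[LHS]/(translate_pair _ _ _) -[RHS]/(translate_pair _ _ _) !translate_pair_bt.
by rewrite -[RHS]/(translate_pair _ _ _) translate_pair_bt.
Qed.

Lemma translate_free t u : translate t u = u -> t = 1%g.
Proof.
move=> tu; rewrite -[t]invgK -[RHS]invg1; congr (_^-1)%g.
apply: autP; apply/funext => m; apply: (met_nondegenerate (u := u)) => y.
by rewrite -translate_pair_bt -[X in _ = met_pair X _]tu.
Qed.

Section Transport.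
Variables u v : covMetric M.

(** The endomorphism [s] of [M] with [(s x, y)_u = (x, y)_v]. *)
Definition transport (w : M) : M := blift (fun m n => lact (met_pair v (bt w m)) n) (met_g u).

Lemma transport_pair w y : met_pair u (bt (transport w) y) = met_pair v (bt w y).
Proof.
have lu := met_pair_linear u; have lv := met_pair_linear v.
have l1 : linear (fun z => met_pair u (bt z y)) by lin.
have l2 : linear (fun z => met_pair v (bt w z)) by lin.
rewrite /transport (blift_lin _ _ l1) -[y in RHS](met_right u) (blift_lin _ _ l2).
by apply: eq_blift => m n; rewrite met_lact met_ract.
Qed.

Lemma transport_linear : linear transport.
Proof.
have lv := met_pair_linear v.
by apply: (lin_tlift_fun (f := fun w m n => lact (met_pair v (bt w m)) n)); lin.
Qed.

(** The dual tensor of [u] is coinvariant and the form of [v] is colinear. *)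
Lemma transport_coact w : cb_coact (transport w) = tmap id transport (cb_coact w).
Proof.
have lv := met_pair_linear v; have ls := transport_linear.
have mv z := met_left_middle v z; have lb z := blift_linear (mv z).
have lt := @bt_coact_linear _ _ _ _ M; have bp := met_bilin v.
have lz p q : linear (fun z => tens (p * q : A) (blift (fun m n => lact (met_pair v (bt w m)) n) (z : T))).
  by have lw := lb w; lin.
have key (t : T) : cb_coact (blift (fun m n => lact (met_pair v (bt w m)) n) t) =
    tlift (fun p z => tlift (fun q y => tens (p * q)
      (blift (fun m n => lact (met_pair v (bt z m)) n) y)) (bt_coact t)) (cb_coact w).
  have lw := lb w.
  have ll p z : linear (fun y : T => blift (fun m n => lact (met_pair v (bt z m)) n) y) by exact: lb.
  move: t; apply: eq_linear_bt; [by lin| |move=> m n].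
    by apply: lin_tlift_fun => p z; have lbz := lb z; lin.
  rewrite blift_bt // -[LHS]tlift_tensE cb_coact_lact_sum; last by lin.
  rewrite met_pair_coact tlift_tmap //; last by lin.
  have bF : bilin (fun (p : A) (y : T) => tlift (fun a n0 =>
      tens (p * a) (lact (met_pair v y) n0)) (cb_coact n)) by lin.
  rewrite bt_coact_bt (tlift_lin _ _ (tlift_linear bF)); apply: eq_tlift => p z.
  have lbz := lb z.
  have bG : bilin (fun (q : A) (y : T) => tens (p * q)
      (blift (fun m n => lact (met_pair v (bt z m)) n) y)) by lin.
  rewrite bt_coact_bt (tlift_lin _ _ (tlift_linear bF)) (tlift_lin _ _ (tlift_linear bG)).
  apply: eq_tlift => q m0; rewrite tlift_tens; last exact: bilin_balanced.
  rewrite (tlift_lin _ _ (tlift_linear bG)); apply: eq_tlift => a n0.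
  by rewrite tlift_tens ?blift_bt ?mulrA //; exact: bilin_balanced.
rewrite key; apply: eq_tlift => p z; have lbz := lb z.
by rewrite met_g_coinv tlift_tens ?mulr1 //; lin.
Qed.

Lemma transport_map : is_covbimod_map transport.
Proof.
have ls := transport_linear; split=> //.
- move=> b m; apply: (met_nondegenerate (u := u)) => y.
  by rewrite met_lact !transport_pair met_lact.
- move=> m b; apply: (met_nondegenerate (u := u)) => y.
  by rewrite bt_ractl !transport_pair bt_ractl.
- exact: transport_coact.
Qed.
End Transport.

Lemma transportK u v : cancel (transport u v) (transport v u).
Proof.
by move=> w; apply: (met_nondegenerate (u := v)) => y; rewrite !transport_pair.
Qed.

(** Each form represents the other, so their transports are mutually inverse. *)
Lemma translate_transitive u v : exists t, translate t u = v.
Proof.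
exists (@Aut _ (bimodAutPred M) _ _ (transport_map v u) (transportK v u) (transportK u v)).
apply: covMetric_eq; apply: eq_linear_bt => [||m n]; try exact: met_pair_linear.
by rewrite /= translate_pair_bt transport_pair.
Qed.
End Translation.

(** * Schur's lemma and isotypic sums *)

Section Schur.
Variable R : realType.
Local Notation C := R[i].
Variable H : hopfStarAlg R.
Implicit Types U V W : comod H.

Lemma coact_linear V : linear (coact (c := V)).
Proof. by case: (coactP V). Qed.

Lemma comod_map_compose U V W (f : V -> W) (g : U -> V) :
  is_comod_map f -> is_comod_map g -> is_comod_map (f \o g).
Proof.
move=> [lf cf] [lg cg]; split; first exact: comp_linear.
by move=> v; rewrite /= cf cg tmap_comp.
Qed.

Lemma comod_map_inverse V W (f : V -> W) (g : W -> V) :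
  is_comod_map f -> cancel f g -> cancel g f -> is_comod_map g.
Proof.
move=> [lf cf] fK gK; have lg := inv_linear lf fK gK; split=> // v.
rewrite -{2}(gK v) cf tmap_comp //.
have -> : g \o f = id by apply/funext.
by rewrite tmap_id.
Qed.

Lemma lspan_sum (V : lmodType C) (G : set V) (I : Type) (s : seq I) (f : I -> V) :
  (forall i, G (f i)) -> lspan G (\sum_(i <- s) f i).
Proof.
move=> Gf; elim/big_ind: _ => [|y z|i _]; [exact: lspan0|exact: lspanD|exact: lspan_gen].
Qed.

Lemma ker_subcomod V W (f : V -> W) : is_comod_map f -> is_subcomod [set v | f v = 0].
Proof.
move=> [lf cf]; split=> [|c y z /= fy fz|w /= fw]; first exact: lin0.
  by rewrite lf fy fz scaler0 addr0.
have [e [le fe ek]] := @tmap_id_ker _ H _ _ _ lf.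
rewrite -(ek (coact w)) -?cf ?fw ?(lin0 (@coact_linear W)) //.
by apply: lspan_sum => p; exists p.1, (e p.2).
Qed.

Lemma im_subcomod V W (f : V -> W) : is_comod_map f -> is_subcomod (range f).
Proof.
move=> [lf cf]; split=> [|c _ _ [y _ <-] [z _ <-]|_ [w _ <-]].
- by exists 0 => //; exact: lin0.
- by exists (c *: y + z); rewrite ?lf.
by rewrite cf; apply: lspan_sum => p; exists p.1, (f p.2); split=> //; exists p.2.
Qed.

Lemma schur_zero V W (f : V -> W) : irreducible V -> irreducible W ->
  ~ comod_iso V W -> is_comod_map f -> forall v, f v = 0.
Proof.
move=> [[v0 v0n] irrV] [_ irrW] nVW cf; have [lf _] := cf.
have [ker0|//] := irrV _ (ker_subcomod cf).
have [im0|imW] := irrW _ (im_subcomod cf).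
  by exfalso; apply/v0n/ker0/im0; exists v0.
exfalso; apply: nVW; exists f; split=> //; apply: inj_surj_bij.
  by move=> y z yz; apply/eqP; rewrite -subr_eq0; apply/eqP/ker0; rewrite /= (linB lf) yz subrr.
by move=> y; have [z _] := imW y; exists z.
Qed.

Definition spanned_by_finite (V : lmodType C) : Prop :=
  exists n (v : 'I_n -> V), forall w, exists a : 'rV[C]_n, w = \sum_i a 0 i *: v i.

Lemma spanned_image (V W : lmodType C) (f : V -> W) : linear f -> (forall w, exists v, f v = w) ->
  spanned_by_finite V -> spanned_by_finite W.
Proof.
move=> lf fs [n [v vs]]; exists n, (fun i => f (v i)) => w.
have [y <-] := fs w; have [a ->] := vs y; exists a.
by rewrite (big_morph _ (linD lf) (lin0 lf)); apply: eq_bigr => i _; rewrite (linZ lf).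
Qed.

(** The field [R[i]] is algebraically closed, so [f] has an eigenvalue. *)
Lemma schur_scalar V (f : V -> V) : irreducible V -> spanned_by_finite V ->
  is_comod_map f -> exists c : C, forall v, f v = c *: v.
Proof.
move=> [[v0 v0n] irrV] [n [g gs]] [lf cf].
have [r [e [x ex]]] := spanned_basis gs; have [lx vE xe] := ex.
have lg : linear (fun a : 'rV[C]_r => x (f (\sum_i a 0 i *: e i))).
  move=> d a b; rewrite -lx -lf; congr (x (f _)).
  rewrite scaler_sumr -big_split; apply: eq_bigr => i _ /=.
  by rewrite !mxE scalerDl scalerA.
have [F FE] := linear_rV_mx lg.
have [c cF] : exists c, root (char_poly F) c.
  apply/closed_rootP; rewrite size_char_poly; case: r e x ex lx vE xe lg F FE => // e x ex lx vE.
  by exfalso; apply: v0n; rewrite (vE v0) big_ord0.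
rewrite -eigenvalue_root_char in cF; have /eigenvalueP[a aF a0] := cF.
exists c => v.
pose y := \sum_i a 0 i *: e i.
have xy : x y = a.
  rewrite /y (big_morph _ (linD lx) (lin0 lx)) [RHS]row_sum_delta.
  by apply: eq_bigr => i _; rewrite (linZ lx) xe.
have fy : f y = c *: y.
  rewrite (vE (f y)) FE aF /y scaler_sumr; apply: eq_bigr => i _.
  by rewrite mxE scalerA.
have lfc : linear (fun w => f w - c *: w) by lin.
have cfc : is_comod_map (fun w => f w - c *: w).
  split=> // w; rewrite (linB (@coact_linear V)) (linZ (@coact_linear V)) cf.
  move: (coact w); apply: eq_linear_tens => [||b u]; [by lin|by lin|].
  by rewrite !tmap_tens // -tensZr (linB (_ : linear (tens b))) //; lin.
have [ker0|kerV] := irrV _ (ker_subcomod cfc); last first.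
  by apply/eqP; rewrite -subr_eq0; apply/eqP; exact: kerV.
have : y = 0 by apply: ker0; rewrite /= fy subrr.
by move=> y0; move: a0; rewrite -xy y0 (lin0 lx) eqxx.
Qed.
End Schur.

Section Isotypic.
Variable R : realType.
Local Notation C := R[i].
Variables (H : hopfStarAlg R) (m : nat) (V : 'I_m -> comod H) (n : 'I_m -> nat).
Local Notation S := (isotypic_sum V n).
Local Notation idx := {i : 'I_m & 'I_(n i)}.
Local Notation pos i a := (existT (fun k : 'I_m => 'I_(n k)) i a).
Local Notation inj p := (@dsum_inj R H idx (fun k => V (tag k)) p).

Lemma dsum_proj_linear (p : idx) : linear (fun v : S => v p).
Proof. by []. Qed.

Lemma dsum_injE (p : idx) (w : V (tag p)) : inj p w p = w.
Proof. exact: dfwith_in. Qed.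

Lemma dsum_inj_neq (p q : idx) (w : V (tag p)) : p != q -> inj p w q = 0.
Proof. by move=> pq; rewrite /dsum_inj dfwith_out. Qed.

Lemma dsum_proj_comod (p : idx) : is_comod_map ((fun v => v p) : S -> V (tag p)).
Proof.
have lp := dsum_proj_linear p.
split=> // v; rewrite /= /dsum_coact.
have lt : linear (tmap (@id H) ((fun v => v p) : S -> V (tag p))) by lin.
rewrite (big_morph _ (linD lt) (lin0 lt)) (bigD1 p) //= big1 ?addr0 => [|q qp].
  have li := @dsum_inj_linear R H idx (fun p => V (tag p)) p.
  rewrite tmap_comp // -[LHS]tmap_id; congr (tmap _ _ _).
  by apply/funext => w /=; rewrite dsum_injE.
have li := @dsum_inj_linear R H idx (fun p => V (tag p)) q.
rewrite tmap_comp //.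
have -> : (fun v : S => v p) \o inj q = fun=> 0.
  by apply/funext => w /=; rewrite dsum_inj_neq.
rewrite /tmap /tlift /fsum big1 // => z _.
by rewrite (lin0 (_ : linear (tens z.1))) //; lin.
Qed.

Lemma dsum_inj_comod (p : idx) : is_comod_map (inj p : V (tag p) -> S).
Proof. by split; [exact: dsum_inj_linear|move=> w; exact: dsum_coact_inj]. Qed.

Lemma eq_linear_dsum (W : lmodType C) (f g : S -> W) : linear f -> linear g ->
  (forall p w, f (inj p w) = g (inj p w)) -> f =1 g.
Proof.
move=> lf lg fg v; rewrite (dsum_split v) (big_morph _ (linD lf) (lin0 lf)).
by rewrite (big_morph _ (linD lg) (lin0 lg)); apply: eq_bigr => p _.
Qed.

(** The blocks act on the multiplicity spaces of the sum. *)
Definition block_act (Y : forall i, 'M[C]_(n i)) (v : S) : S :=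
  fun p : idx => \sum_b Y (tag p) (tagged p) b *: (v (pos (tag p) b) : V (tag p)).

Lemma block_act_linear Y : linear (block_act Y).
Proof.
move=> c v w; apply/functional_extensionality_dep => p.
apply: (lin_sum (f := fun b (v : S) => Y (tag p) (tagged p) b *: (v (pos (tag p) b) : V (tag p)))).
by move=> b; apply: lin_scaler; exact: (dsum_proj_linear (pos (tag p) b)).
Qed.

Lemma block_act_inj Y i (a b : 'I_(n i)) (w : V i) :
  block_act Y (inj (pos i b) w) (pos i a) = Y i a b *: w.
Proof.
rewrite /block_act /= (bigD1 b) //= dsum_injE big1 ?addr0 // => b' b'b.
by rewrite dsum_inj_neq ?scaler0 //; apply: contraNneq b'b => pe; rewrite (existT_inj2 pe).
Qed.

Lemma block_act_inj_neq Y (p q : idx) (w : V (tag p)) : tag p != tag q ->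
  block_act Y (inj p w) q = 0.
Proof.
move=> pq; rewrite /block_act big1 // => b _; rewrite dsum_inj_neq ?scaler0 //.
by apply: contraNneq pq => ->.
Qed.

Lemma block_act_comod Y : is_comod_map (block_act Y).
Proof.
have lb := block_act_linear Y; split=> //.
have lt : linear (tmap (@id H) (block_act Y)) by lin.
have lc := @coact_linear R H S.
apply: eq_linear_dsum; [by lin|by lin|move=> [i b] w; cbv beta].
have cI a (w' : V i) : coact (inj (pos i a) w' : S) = tmap id (inj (pos i a)) (coact w').
  exact: dsum_coact_inj.
have li a := @dsum_inj_linear R H idx (fun p => V (tag p)) (pos i a).
have e (w' : V i) : block_act Y (inj (pos i b) w') = \sum_a Y i a b *: inj (pos i a) w'.
  apply/functional_extensionality_dep => -[j a].
  have -> : (\sum_a Y i a b *: inj (pos i a) w') (pos j a) = \sum_a' Y i a' b *: inj (pos i a') w' (pos j a).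
    by rewrite (big_morph (fun v : S => v (pos j a)) (id1 := 0) (op1 := +%R)).
  have [ij|ij] := eqVneq i j.
    subst j; rewrite block_act_inj (bigD1 a) //= dsum_injE big1 ?addr0 // => a' a'a.
    by rewrite dsum_inj_neq ?scaler0 //; apply: contraNneq a'a => pe; rewrite (existT_inj2 pe).
  rewrite block_act_inj_neq // big1 // => a' _; rewrite dsum_inj_neq ?scaler0 //.
  by apply: contraNneq ij => /(congr1 (fun p : idx => tag p)) /= ->.
rewrite e (big_morph _ (linD lc) (lin0 lc)) [in RHS]cI tmap_comp //.
transitivity (tmap id (fun w' : V i => \sum_a Y i a b *: (inj (pos i a) w' : S)) (coact w)); last first.
  by congr (tmap _ _ _); apply/funext => w'; exact: (esym (e w')).
have ls : linear (fun w' : V i => \sum_a Y i a b *: (inj (pos i a) w' : S)).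
  by apply: lin_sum => a; have lia := li a; lin.
transitivity (\sum_a Y i a b *: tmap id (inj (pos i a)) (coact w)).
  by apply: eq_bigr => a _; rewrite (linZ lc) cI.
move: (coact w); apply: eq_linear_tens; [|by lin|move=> h w'].
  by apply: lin_sum => a; have lia := li a; lin.
rewrite tmap_tens // (big_morph _ (tensDr _) (lin0 (_ : linear (tens h)))); try by lin.
by apply: eq_bigr => a _; rewrite tmap_tens ?tensZr.
Qed.

Lemma block_act_mul Y Z v : block_act (fun i => Y i *m Z i) v = block_act Y (block_act Z v).
Proof.
apply/functional_extensionality_dep => -[i a]; rewrite /block_act /=.
under [RHS]eq_bigr => b _ do rewrite scaler_sumr.
rewrite exchange_big; apply: eq_bigr => b _ /=; rewrite mxE scaler_suml.
by apply: eq_bigr => b' _; rewrite scalerA.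
Qed.

Lemma block_act1 v : block_act (fun i => 1%:M) v = v.
Proof.
apply/functional_extensionality_dep => -[i a]; rewrite /block_act /= (bigD1 a) //=.
rewrite mxE eqxx scale1r big1 ?addr0 // => b ba.
by rewrite mxE eq_sym (negbTE ba) scale0r.
Qed.

Hypothesis irrV : forall i, irreducible (V i).

Lemma block_act_uniq Y Z : block_act Y =1 block_act Z -> forall i, Y i = Z i.
Proof.
move=> YZ i; apply/matrixP => a b; have [[w w0] _] := irrV i.
have := congr1 (@^~ (pos i a)) (YZ (inj (pos i b) w)).
rewrite !block_act_inj => /eqP; rewrite -subr_eq0 -scalerBl scaler_eq0 => /orP[|/eqP //].
by rewrite subr_eq0 => /eqP.
Qed.

Hypothesis disjV : forall i j, i != j -> ~ comod_iso (V i) (V j).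
Hypothesis finV : spanned_by_finite S.

Lemma isotypic_endo (f : S -> S) : is_comod_map f -> exists Y, f =1 block_act Y.
Proof.
move=> cf; have [lf _] := cf.
have comp p q : is_comod_map (fun w => f (inj p w) q).
  have := comod_map_compose (comod_map_compose (dsum_proj_comod q) cf) (dsum_inj_comod p).
  exact.
have ex i (a b : 'I_(n i)) : exists c : C, forall w, f (inj (pos i b) w) (pos i a) = c *: w.
  apply: schur_scalar (comp (pos i b) (pos i a)) => //.
  apply: (spanned_image (dsum_proj_linear (pos i a))) finV => w.
  by exists (inj (pos i a) w); exact: dsum_injE.
pose Y i : 'M[C]_(n i) := \matrix_(a, b) sval (cid (ex i a b)).
exists Y; apply: eq_linear_dsum => //; first exact: block_act_linear.
move=> [i b] w; apply/functional_extensionality_dep => -[j a].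
have [ij|ij] := eqVneq i j.
  subst j; rewrite block_act_inj mxE; exact: (svalP (cid (ex i a b))).
rewrite block_act_inj_neq //.
exact: schur_zero (irrV i) (irrV j) (disjV ij) (comp (pos i b) (pos j a)) w.
Qed.
End Isotypic.

(** * Automorphisms of isotypic sums and covariant metrics *)

Section IsotypicAut.
Variable R : realType.
Local Notation C := R[i].
Variables (H : hopfStarAlg R) (m : nat) (V : 'I_m -> comod H) (n : 'I_m -> nat).
Local Notation S := (isotypic_sum V n).
Hypothesis irrV : forall i, irreducible (V i).
Hypothesis disjV : forall i j, i != j -> ~ comod_iso (V i) (V j).
Variable W : comod H.
Hypothesis finW : spanned_by_finite W.

(** Endomorphisms of the isotypic sum are blocks of scalars by Schur's lemma, and a block
   that has an inverse endomorphism is an invertible matrix. *)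
Theorem isotypic_aut : comod_iso W S ->
  exists theta : GLprod R n -> comodAut W, is_group_iso theta.
Proof.
move=> [F [cF [F' FK F'K]]]; have [lF _] := cF.
have cF' := comod_map_inverse cF FK F'K.
have finS : spanned_by_finite S.
  by apply: (spanned_image lF) finW => v; exists (F' v).
pose mx (x : GLprod R n) i : 'M[C]_(n i) := GLmx (x i).
pose f Y w := F' (block_act Y (F w)).
have cf Y : is_comod_map (f Y).
  exact: comod_map_compose cF' (comod_map_compose (block_act_comod V Y) cF).
have fM Y Z w : f (fun i => Y i *m Z i) w = f Y (f Z w).
  by rewrite /f F'K block_act_mul.
have f1 Y w : (forall i, Y i = 1%:M) -> f Y w = w.
  move=> Y1; have -> : Y = fun i => 1%:M by apply/functional_extensionality_dep.
  by rewrite /f block_act1 FK.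
have fK x : cancel (f (mx x)) (f (mx (x^-1)%g)).
  by move=> w; rewrite -fM f1 // => i; exact: mulVmx (valP (x i)).
have fVK x : cancel (f (mx (x^-1)%g)) (f (mx x)).
  by move=> w; rewrite -fM f1 // => i; exact: mulmxV (valP (x i)).
exists (fun x => @Aut _ (comodAutPred W) _ _ (cf (mx x)) (fK x) (fVK x)).
split; last by move=> x y; apply: autP; apply/funext => w; exact: fM.
apply: inj_surj_bij => [x y xy|phi].
  apply: GLprodP; apply: (block_act_uniq irrV) => v.
  have := congr1 (fun u : comodAut W => F (u (F' v))) xy.
  by rewrite /= /f !F'K.
have endo (g : W -> W) : is_comod_map g -> exists Y, g =1 f Y.
  move=> cg; have [Y gY] := isotypic_endo irrV disjV finS (comod_map_compose cF (comod_map_compose cg cF')).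
  by exists Y => w; rewrite /f -gY /= !FK.
have [Y YE] := endo _ (autfP phi); have [Z ZE] := endo _ (autfP (aut_inv phi)).
have YZ i : Y i *m Z i = 1%:M.
  have YZ1 : block_act (fun i => Y i *m Z i) =1 block_act (fun i => 1%:M : 'M[C]_(n i)) :> (S -> S).
    move=> v; apply: (can_inj F'K); rewrite block_act1.
    have := fM Y Z (F' v); rewrite {1}/f F'K => ->.
    by rewrite -ZE -YE; exact: autVK.
  exact: (block_act_uniq irrV YZ1 i).
have uY i : Y i \in unitmx by case: (mulmx1_unit (YZ i)).
exists (fun i => MkGL (uY i)); apply: autP; apply/funext => w.
by rewrite /= YE.
Qed.
End IsotypicAut.

Theorem theorem3p2 (R : realType) (A H : hopfStarAlg R) (X : qhs A H)
    (cal : covStarCalculus X) :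
  is_cqg_algebra H ->
  in_mod0 (Om cal 1) ->
  is_group_iso (@Phi_aut R A H X (Om cal 1)) /\
  exists act : comodAut (Phi (Om cal 1)) -> covMetric (Om cal 1) -> covMetric (Om cal 1),
    [/\ forall (t : bimodAut (Om cal 1)) (u : covMetric (Om cal 1)),
          metric_translate t u (act (Phi_aut t) u),
        is_action act,
        is_free act,
        is_transitive act
      & forall (m : nat) (V : 'I_m -> comod H) (n : 'I_m -> nat),
          (forall i, irreducible (V i)) ->
          (forall i j, i != j -> ~ comod_iso (V i) (V j)) ->
          comod_iso (Phi (Om cal 1)) (isotypic_sum V n) ->
          exists theta : GLprod R n -> comodAut (Phi (Om cal 1)),
            is_group_iso theta /\
            forall u : covMetric (Om cal 1), bijective (fun p => act (theta p) u)].
Proof.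
move=> cqg mod0; have spanned := cqg_spanned cqg.
have [h hh] := left_integral_exists spanned.
have iso := Phi_aut_iso hh mod0; split=> //.
have [[k kK Kk] PM] := iso.
have kM : {morph k : s t / (s * t)%g} by move=> s t; apply: (can_inj kK); rewrite PM !Kk.
have k1 : k 1%g = 1%g by apply: (mulgI (k 1%g)); rewrite -kM !mulg1.
pose act phi u := translate (k phi) u; exists act.
have free : is_free act.
  by move=> phi u /translate_free kphi; apply: (can_inj Kk); rewrite kphi k1.
have trans : is_transitive act.
  split; first exact: covMetric_exists spanned mod0.
  by move=> u v; have [t <-] := translate_transitive u v; exists (Phi_aut t); rewrite /act kK.
have action : is_action act.
  split=> [u|s t u]; first by rewrite /act k1 translate1.
  by rewrite /act kM translateM.
split=> // [t u|m V n irrV disjV isoV].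
  by rewrite /act kK; exact: translateP.
have [r [e [x [_ vE _]]]] := fibre_basis mod0.
have finP : spanned_by_finite (Phi (Om cal 1)) by exists r, e => w; exists (x w); exact: vE.
have [theta itheta] := isotypic_aut irrV disjV finP isoV.
exists theta; split=> // u; have [btheta _] := itheta; have [g gK Kg] := btheta.
apply: inj_surj_bij => [y z yz|v].
  have {}yz : act (theta z)^-1%g (act (theta y) u) = u.
    by rewrite yz -action.2 mulVg action.1.
  apply: (can_inj gK); apply: (mulgI (theta z)^-1%g).
  by rewrite mulVg; apply: (free _ u); rewrite action.2.
have [phi <-] := trans.2 u v; exists (g phi); by rewrite Kg.
Qed.
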